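(* There is an algorithm that, given a graph $G$ on $n$ vertices, a set $B\subseteq V(G)$, a vertex cover $S$ of $G$ with $|S|=\delta(G-B)+p$, and an integer $k\ge 0$, decides whether $G$ contains a cycle of length at least $2\delta(G-B)+k$, in time $2^{\mathcal{O}(p+|B|)}\cdot n^{\mathcal{O}(1)}$.
   Context: Graphs are finite, simple and undirected. For $X\subseteq V(G)$, $G-X$ is the subgraph induced by $V(G)\setminus X$; $\delta(H)$ is the minimum degree of $H$. A vertex cover of $G$ is a set of vertices meeting every edge. The length of a cycle is its number of edges. *)

(* Defs.v *)
(* MathComp world *)
From mathcomp Require Import all_boot.

Set Implicit Arguments.
Unset Strict Implicit.
Unset Printing Implicit Defensive.

(* A graph on the vertex type T is a symmetric irreflexive relation on T.     *)

Section Graphs.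
Variable T : finType.
Implicit Types (e : rel T) (X S : {set T}).

(* The graph minus X, on the subtype of the vertices outside X. *)
Definition del_vertices e X : rel {x : T | x \notin X} :=
  fun x y => e (val x) (val y).

Definition degree e (x : T) : nat := #|[set y | e x y]|.

(* In an irreflexive graph every degree is smaller than #|T|, so the neutral  *)
(* element #|T| matters only for the graph without vertices, whose minimum    *)
(* degree is 0 by convention.                                                 *)
Definition min_degree e : nat := \big[minn/#|T|]_(x : T) degree e x.

Definition vertex_cover e S : Prop :=
  forall x y, e x y -> (x \in S) || (y \in S).

(* ucycle allows cyclic sequences of size 0 or 2, which are not graph cycles; *)
(* from size 3 on, the number of edges is the size of the sequence.           *)
Definition has_cycle_geq e (l : nat) : Prop :=
  exists c : seq T, [/\ 2 < size c, ucycle e c & l <= size c].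

End Graphs.
Arguments del_vertices {T} e X _ _.

(* Sanity check: the excess p = |S| - delta(G - B) is never negative. *)
Lemma min_degree_del_le_cover (T : finType) (e : rel T) (B S : {set T}) :
  vertex_cover e S -> min_degree (del_vertices e B) <= #|S|.
Proof.
move=> covS; rewrite /min_degree.
have bigP (U : finType) (f : U -> nat) (m : nat) (x : U) :
    \big[minn/m]_(y : U) f y <= f x.
  elim: (index_enum U) (mem_index_enum x) => // z r IHr.
  rewrite inE big_cons geq_min => /orP[/eqP-> | /IHr->]; last exact: orbT.
  by rewrite leqnn.
have bigm (U : finType) (f : U -> nat) (m : nat) :
    \big[minn/m]_(y : U) f y <= m.
  by elim/big_rec: _ => // i x _ lexm; rewrite geq_min lexm orbT.
have [/existsP[x xS] | /existsPn allS] :=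
  boolP [exists x : {x : T | x \notin B}, val x \notin S].
  apply: leq_trans (bigP _ _ _ x) _; rewrite /degree.
  rewrite -(card_imset _ val_inj); apply/subset_leq_card/subsetP=> y.
  case/imsetP=> z; rewrite inE => exz ->.
  by have := covS _ _ exz; rewrite (negPf xS).
apply: leq_trans (bigm _ _ _) _.
rewrite -cardsT -(card_imset _ val_inj); apply/subset_leq_card/subsetP=> y.
by case/imsetP=> z _ ->; have := allS z; rewrite negbK.
Qed.

(* Algorithms are structured programs for a random access machine: registers  *)
(* and memory cells hold natural numbers, and each elementary instruction and *)
(* each test costs one time unit.  Without multiplication a step lengthens    *)
(* the numbers by at most one bit, so the model is polynomially equivalent to *)
(* Turing machines.                                                           *)

Definition reg := nat.

Inductive cmd :=
| Skip
| Const (r : reg) (a : nat)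
| Add (r x y : reg)
| Sub (r x y : reg)
| Read (r x : reg)
| Write (x y : reg)
| Seq (c1 c2 : cmd)
| If (x : reg) (c1 c2 : cmd)
| While (x : reg) (c : cmd).

Record state := State { regs : reg -> nat; mem : nat -> nat }.

Definition upd (f : nat -> nat) (i a : nat) : nat -> nat :=
  fun j => if j == i then a else f j.

Definition set_reg (s : state) (r : reg) (a : nat) : state :=
  State (upd (regs s) r a) (mem s).

Definition set_mem (s : state) (i a : nat) : state :=
  State (regs s) (upd (mem s) i a).

(* exec c s t s' : from s, the program c halts in s' after t time units.      *)
(* Sub is truncated subtraction; If and While test for a nonzero register.    *)
Inductive exec : cmd -> state -> nat -> state -> Prop :=
| exec_Skip s : exec Skip s 1 s
| exec_Const s r a : exec (Const r a) s 1 (set_reg s r a)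
| exec_Add s r x y : exec (Add r x y) s 1 (set_reg s r (regs s x + regs s y))
| exec_Sub s r x y : exec (Sub r x y) s 1 (set_reg s r (regs s x - regs s y))
| exec_Read s r x : exec (Read r x) s 1 (set_reg s r (mem s (regs s x)))
| exec_Write s x y : exec (Write x y) s 1 (set_mem s (regs s x) (regs s y))
| exec_Seq c1 c2 s1 s2 s3 t1 t2 :
    exec c1 s1 t1 s2 -> exec c2 s2 t2 s3 -> exec (Seq c1 c2) s1 (t1 + t2) s3
| exec_If_true x c1 c2 s s' t :
    regs s x != 0 -> exec c1 s t s' -> exec (If x c1 c2) s t.+1 s'
| exec_If_false x c1 c2 s s' t :
    regs s x = 0 -> exec c2 s t s' -> exec (If x c1 c2) s t.+1 s'
| exec_While_true x c s1 s2 s3 t1 t2 :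
    regs s1 x != 0 -> exec c s1 t1 s2 -> exec (While x c) s2 t2 s3 ->
    exec (While x c) s1 (t1 + t2).+1 s3
| exec_While_false x c s : regs s x = 0 -> exec (While x c) s 1 s.

(* Hence a program has at most one run on a given input. *)
Lemma exec_det c s t1 s1 t2 s2 :
  exec c s t1 s1 -> exec c s t2 s2 -> t1 = t2 /\ s1 = s2.
Proof.
move=> run1; elim: run1 t2 s2 => {c s t1 s1};
  intros; match goal with run2 : exec _ _ ?t2 ?s2 |- _ = ?t2 /\ _ = ?s2 =>
    inversion run2; clear run2; subst end => //;
  repeat match goal with
  | nz : is_true (?v != 0), z : ?v = 0 |- _ => by rewrite z in nz
  | IH : (forall t s, exec ?c ?s1 t s -> _), run : exec ?c ?s1 _ _ |- _ =>
    destruct (IH _ _ run); clear IH; subst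
  end; by [].
Qed.

(* The input word occupies the memory cells 0, 1, ..., (size w).-1; all other *)
(* cells and all registers are 0.                                             *)
Definition init_state (w : seq nat) : state := State (fun=> 0) (nth 0 w).

(* On input w, the program halts within T time units, and it accepts (with a  *)
(* nonzero value in register 0) exactly when Q holds.                         *)
Definition decides_within (P : cmd) (w : seq nat) (Q : Prop) (T : nat) : Prop :=
  exists t s, [/\ exec P (init_state w) t s, t <= T & regs s 0 != 0 <-> Q].

(* The numbers n and k, the 0/1 characteristic vectors of B and S, and the    *)
(* 0/1 adjacency matrix of the graph, row by row.                             *)
Definition encode_instance n (e : rel 'I_n) (B S : {set 'I_n}) (k : nat) :
    seq nat :=
  [:: n; k]
    ++ [seq nat_of_bool (i \in B) | i <- enum 'I_n]
    ++ [seq nat_of_bool (i \in S) | i <- enum 'I_n]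
    ++ [seq nat_of_bool (e i j) | i <- enum 'I_n, j <- enum 'I_n].

(* Main.v *)
(* Let D = p + |B| + 1 and let delta be the minimum degree of G - B.  Split   *)
(* the vertices as W + S0 + I0, with I0 independent and |W| = O(D).  If delta *)
(* <= 2048 D, then W = S and S0 is empty.  Otherwise I0 = V \ (S + B), and W  *)
(* consists of B, of the vertices of S with fewer than 512 D neighbours in I0 *)
(* (at most 2p, since a vertex of I0 misses at most p vertices of S) and of   *)
(* the ends of a maximal matching of the rest of S; if there is a matching    *)
(* with 8 D edges, then its ends stay in S0 instead.                          *)
(*                                                                            *)
(* The trace of a cycle on W (its edges inside W, and its vertices outside W  *)
(* that have a neighbour in W on the cycle) is a configuration: every vertex  *)
(* of W has degree 0 or 2, and all edges are connected to a root.  If delta   *)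
(* is small, the root is a vertex of S and a configuration is just a cycle.   *)
(* Otherwise the root is a virtual vertex that stands for the part of the     *)
(* cycle outside W.  Then the vertices of S0 have many neighbours in I0 and   *)
(* those of I0 are adjacent to nearly all of S0, so the paths of any          *)
(* configuration can be joined to a cycle, which can be enlarged by exchanges *)
(* until it contains S0 or I0 entirely.  Its length depends only on the       *)
(* number of vertices of W in the configuration, the number tau of its edges  *)
(* that join W to W or to S0, and the number g of edges inside S0, which is   *)
(* adjusted with the matching.                                                *)
(*                                                                            *)
(* It remains to find configurations with a given tau and given degrees.      *)
(* A dynamic program represents a set of edges by the vector, over GF(2), of  *)
(* the subsets K of W that contain both ends or no end of each edge.  For     *)
(* each tau and degree sequence it keeps only a basis of the span of these    *)
(* vectors.  A set of edges is connected to the root iff an odd number of     *)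
(* these K consist of vertices of positive degree other than the root; this   *)
(* parity is linear in the vector, hence it can be read off the basis.        *)
From Pilot Require Import Defs.
From mathcomp Require Import all_boot zify.

Set Implicit Arguments.
Unset Strict Implicit.
Unset Printing Implicit Defensive.

(** * Completing paths to a long cycle *)

(** Write D = p + |B| + 1, delta for the minimum degree of G - B, and L for the length sought. A
    vertex outside S and B has all its neighbours in S and at least delta of them, so it misses at
    most p vertices of S ([miss_le]). If delta <= 2048 D, then S itself has O(D) vertices and W = S.
    Otherwise, unless I0 is too small for a long cycle ([cycle_not_rejected]), all but O(D) vertices
    split into S0, a part of S, and an independent set I0; a vertex of I0 misses at most p vertices
    of S0, and one of S0 has many neighbours in I0. Only the way in which a cycle visits the small
    rest W has to be searched.

    Length: let a cycle C have x vertices in W, tau edges joining W to W or to S0, and g edges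
    inside S0. Every edge meets W or S0, so double counting gives x + |C ∩ S0| = |C ∩ I0| + tau + g
    ([cycle_config]). The length is thus 2 (x + |C ∩ S0|) - tau - g and also 2 |C ∩ I0| + tau + g,
    and a long cycle implies the inequalities of [accepts]. Conversely, the paths into which a
    configuration falls ([config_pieces]) are padded with g edges inside S0, linked to one cycle
    through S0 and I0, and enlarged by exchanges that add one vertex of S0 and one of I0 at a time,
    until S0 or I0 is exhausted ([complete]). One of the two length formulas then attains its
    extreme value, and [large_config_cycle] chooses g such that either way the length is at least L.

    Search: connectivity to the root is read off the parity of a number of cuts ([par_connected]),
    since a component away from the root can be added to or removed from any such cut, which pairs
    the cuts up. This parity is a linear functional of the cut vector, so for each tau and each
    degree sequence a basis of the span of the cut vectors suffices; it has at most 2^|W| elements.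
    [reach] describes the functionals that do not vanish on the span, [reach_config] and
    [config_reach] relate it to edge sets, and [solveP] shows that the program computes it by
    Gaussian elimination.

    Machine: the program is written in a language of loops with fixed bounds. [comp_stm_sim] shows
    that the compiled code simulates it within [cost], [cost_le] bounds [cost] by a fixed power of
    the largest loop bound, which is 2^O(D) times a polynomial in n, and [time_bound] brings this
    into the required form. *)

Ltac gen_lia :=
  repeat match goal with
  | |- context [ #|?A| ] => move: #|A| => ?
  | |- context [ size ?s ] => move: (size s) => ?
  | |- context [ count ?a ?s ] => move: (count a s) => ?
  | |- context [ sumn ?s ] => move: (sumn s) => ?
  | |- context [ nat_of_bool ?b ] => move: (leq_b1 b); move: (nat_of_bool b) => ?
  end; clear; lia.

Section Completion.
Variables (V : finType) (e : rel V).
Hypothesis e_sym : symmetric e.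

Lemma fresh (A : {set V}) (X : seq V) : size X < #|A| -> exists2 a, a \in A & a \notin X.
Proof.
move=> lt; have [/subsetP sub|/subsetPn[a aA aX]] := boolP (A \subset X).
  have /subset_leq_card le : A \subset X by apply/subsetP.
  by have := leq_trans le (card_size X); rewrite leqNgt lt.
by exists a.
Qed.

(** [next] and [prev] are injective on a cycle without repetitions, so each forbidden set excludes
    at most as many vertices of [A] as it has elements. *)
Lemma pick_next_prev (C : seq V) (A X1 X2 : {set V}) :
  uniq C -> {subset A <= C} -> #|X1| + #|X2| < #|A| ->
  exists c, [/\ c \in A, next C c \notin X1 & prev C c \notin X2].
Proof.
move=> uC AC lt.
pose B1 := A :&: next C @^-1: X1; pose B2 := A :&: prev C @^-1: X2.
have leB (f : V -> V) (X : {set V}) : {in C &, injective f} ->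
    #|A :&: f @^-1: X| <= #|X|.
  move=> inj; rewrite -(@card_in_imset _ _ f); last first.
    by move=> x y; rewrite !inE => /andP[/AC xC _] /andP[/AC yC _]; apply: inj.
  apply/subset_leq_card/subsetP=> y /imsetP[x].
  by rewrite !inE => /andP[_ fx] ->.
have /leB-/(_ X1) le1 : {in C &, injective (next C)}.
  by apply: in2W; apply: can_inj (prev_next uC).
have /leB-/(_ X2) le2 : {in C &, injective (prev C)}.
  by apply: in2W; apply: can_inj (next_prev uC).
have : 0 < #|A :\: (B1 :|: B2)|.
  have := cardsUI B1 B2; have := cardsID (B1 :|: B2) A.
  have /subset_leq_card : A :&: (B1 :|: B2) \subset B1 :|: B2 by apply: subsetIr.
  by move: lt le1 le2; rewrite -/B1 -/B2; gen_lia.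
case/card_gt0P=> c; rewrite !inE => /andP[+ cA]; rewrite cA /=.
by rewrite negb_or => /andP[n1 n2]; exists c.
Qed.

Lemma rot_next (C : seq V) c : uniq C -> c \in C ->
  exists R, [/\ perm_eq (c :: R) C, next C c = head c R, prev C c = last c R
    & ucycle e C -> ucycle e (c :: R)].
Proof.
move=> uC cC; case: (rot_to cC) => i R E; exists R; split.
- by rewrite -E perm_rot.
- rewrite -(next_rot i uC) E /=; case: (R) => [|a R'] /=; by rewrite eqxx.
- rewrite -(prev_rot i uC) E.
  have : uniq (c :: R) by rewrite -E rot_uniq.
  rewrite /prev /= => /andP[cR _].
  move: {3 4}c; elim: R cR {E} => [|y R IH] /= cR z; first by rewrite eqxx.
  by move: cR; rewrite inE negb_or => /andP[/negbTE cy cR']; rewrite cy IH.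
- by rewrite -E rot_ucycle.
Qed.

Lemma ucycle_swap (C : seq V) c v :
  ucycle e C -> 2 < size C -> c \in C -> v \notin C ->
  e v (next C c) -> e v (prev C c) ->
  exists C', [/\ ucycle e C', size C' = size C, next C' v = next C c
    & C' =i [predU1 v & [predD1 C & c]]].
Proof.
move=> uC sz cC vC; have [cyc un] := andP uC.
have [R [pR -> -> /(_ uC)]] := rot_next un cC.
have sR := perm_size pR; have mR := perm_mem pR.
case: R pR sR mR => [|a R] pR sR mR; first by rewrite -sR in sz.
rewrite /ucycle /= rcons_path => /andP[/andP[_ /andP[pth lst]]] /and3P[cR aR uR].
move=> ea el; exists (v :: a :: R); split=> //.
- rewrite /ucycle /= rcons_path ea pth e_sym el /= aR uR !andbT.
  by move: vC; rewrite -mR !inE !negb_or => /andP[_].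
- by rewrite /= eqxx.
move=> x; rewrite !inE -mR !inE; case: (x =P v) => //= _.
case: (x =P c) => [->|] //=.
by rewrite -in_cons; apply/negbTE.
Qed.

Lemma ucycle_insert (C : seq V) c s v :
  ucycle e C -> 2 < size C -> c \in C -> s \notin C -> v \notin C -> s != v ->
  e c s -> e s v -> e v (next C c) ->
  exists C', [/\ ucycle e C', size C' = (size C).+2
    & C' =i [predU1 s & [predU1 v & C]]].
Proof.
move=> uC sz cC sC vC sv cs esv; have [cyc un] := andP uC.
have [R [pR -> _ /(_ uC)]] := rot_next un cC.
have sR := perm_size pR; have mR := perm_mem pR.
case: R pR sR mR => [|a R] pR sR mR; first by rewrite -sR in sz.
rewrite /ucycle /= rcons_path => /andP[/andP[_ /andP[pth lst]]] /and3P[cR aR uR] va.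
exists (c :: s :: v :: a :: R); split.
- rewrite /ucycle /= rcons_path cs esv va pth lst /=.
  rewrite aR uR !andbT; move: vC sC; rewrite -!mR !inE !negb_or.
  move=> /and3P[vc -> ->] /and3P[sc -> ->]; rewrite sv eq_sym sc eq_sym vc /=.
  by move: cR; rewrite inE negb_or andbT.
- by rewrite /= -sR.
by move=> x; rewrite !inE -mR !inE; do !case: (_ == _).
Qed.

Variables (W S0 I0 : {set V}) (m p T : nat).
Hypothesis WS0 : [disjoint W & S0].
Hypothesis WI0 : [disjoint W & I0].
Hypothesis SI0 : [disjoint S0 & I0].
Hypothesis cover : forall x, [|| x \in W, x \in S0 | x \in I0].
Hypothesis I0_indep : forall x y, x \in I0 -> e x y -> y \notin I0.
Hypothesis W_le : #|W| <= m.
Hypothesis I0_nbr : forall v, v \in I0 -> #|[set s in S0 | ~~ e v s]| <= p.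
Hypothesis S0_nbr : forall s, s \in S0 -> T <= #|[set v in I0 | e s v]|.

Let Nset s := [set v in I0 | e s v].
Let Bad v := W :|: [set s in S0 | ~~ e v s].

Lemma notin_I0_W x : x \in W -> x \notin I0.
Proof. by move=> xW; rewrite (disjointFr WI0 xW). Qed.
Lemma notin_I0_S0 x : x \in S0 -> x \notin I0.
Proof. by move=> xS; rewrite (disjointFr SI0 xS). Qed.
Lemma notin_W_S0 x : x \in S0 -> x \notin W.
Proof. by move=> xS; rewrite (disjointFl WS0 xS). Qed.
Lemma notin_S0_I0 x : x \in I0 -> x \notin S0.
Proof. by move=> xS; rewrite (disjointFl SI0 xS). Qed.

Lemma Bad_le v : v \in I0 -> #|Bad v| <= m + p.
Proof.
move=> vI; apply: leq_trans (leq_card_setU _ _) _.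
by apply: leq_add => //; apply: I0_nbr.
Qed.

(** I0 is independent, so a neighbour of [c] lies in W or S0; outside [Bad v] only the vertices of
    S0 adjacent to [v] are left. Thus [v] can take the place of [c] on a cycle whose two vertices
    next to [c] avoid [Bad v]. *)
Lemma not_Bad c x v : c \in I0 -> e c x -> x \notin Bad v -> e v x.
Proof.
move=> cI ecx; have xI := I0_indep cI ecx; have := cover x.
rewrite (negbTE xI) orbF !inE negb_or => /orP[->|xS] //.
by rewrite xS negbK => /andP[].
Qed.

(** S0 and I0 gain the same number of vertices, so the difference of their shares, which is what the
    length identity controls, is invariant. *)
Definition grows d (C C' : seq V) :=
  [/\ ucycle e C', size C <= size C',
      {in W, C' =i C},
      #|[set x in S0 | x \in C']| = #|[set x in S0 | x \in C]| + d
    & #|[set x in I0 | x \in C']| = #|[set x in I0 | x \in C]| + d].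

Lemma grows_swap C c v :
  ucycle e C -> 2 < size C -> c \in I0 -> c \in C -> v \in I0 -> v \notin C ->
  next C c \notin Bad v -> prev C c \notin Bad v ->
  exists C', [/\ grows 0 C C', next C' v = next C c, size C' = size C
    & C' =i [predU1 v & [predD1 C & c]]].
Proof.
move=> uC sz cI cC vI vC nx pv; have [cyc un] := andP uC.
have ev1 : e v (next C c) by apply: (not_Bad cI) nx; exact: next_cycle.
have ev2 : e v (prev C c).
  by apply: (not_Bad cI) pv; rewrite e_sym; exact: prev_cycle.
have [C' [uC' sC' nC' mC']] := ucycle_swap uC sz cC vC ev1 ev2.
have nvc : v != c by apply: contraNneq vC => ->.
exists C'; split; [|by []|by []|by []].
split; [by [] | by rewrite sC' | | | ].
- move=> x xW; rewrite mC' !inE.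
  have /negbTE-> : x != v by apply: contraNneq (notin_I0_W xW) => ->.
  by have /negbTE-> : x != c by apply: contraNneq (notin_I0_W xW) => ->.
- rewrite addn0; apply: eq_card => x; rewrite !inE mC' !inE.
  case: (boolP (x \in S0)) => //= xS.
  have /negbTE-> : x != v by apply: contraNneq (notin_I0_S0 xS) => ->.
  by have /negbTE-> : x != c by apply: contraNneq (notin_I0_S0 xS) => ->.
rewrite addn0 (cardsD1 v) [in RHS](cardsD1 c) !inE mC' !inE eqxx vI cI cC /=.
congr (_ + _); apply: eq_card => x; rewrite !inE mC' !inE.
have [->|] //= := eqVneq x v; first by rewrite (negbTE vC) !andbF.
by rewrite andbCA.
Qed.

Lemma grows_insert C c s v :
  ucycle e C -> 2 < size C -> c \in I0 -> c \in C ->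
  s \in S0 -> s \notin C -> v \in I0 -> v \notin C ->
  e s c -> e s v -> next C c \notin Bad v ->
  exists2 C', grows 1 C C' & size C' = (size C).+2.
Proof.
move=> uC sz cI cC sS sC vI vC esc esv nx; have [cyc un] := andP uC.
have ev1 : e v (next C c) by apply: (not_Bad cI) nx; exact: next_cycle.
have sv : s != v by apply: contraNneq (notin_I0_S0 sS) => ->.
have [|C' [uC' sC' mC']] := ucycle_insert uC sz cC sC vC sv _ esv ev1.
  by rewrite e_sym.
exists C'; last by [].
split; [by [] | by rewrite sC' -addn2 leq_addr | | | ].
- move=> x xW; rewrite mC' !inE.
  have /negbTE-> : x != v by apply: contraNneq (notin_I0_W xW) => ->.
  by have /negbTE-> : x != s by apply: contraTneq xW => ->; apply: notin_W_S0.
- rewrite (cardsD1 s) !inE mC' !inE eqxx sS /= addnC; congr (_ + _).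
  apply: eq_card => x; rewrite !inE mC' !inE.
  have [->|] /= := eqVneq x s; first by rewrite (negbTE sC) andbF.
  by have [->|] //= := eqVneq x v; rewrite (negbTE (notin_S0_I0 vI)).
rewrite (cardsD1 v) !inE mC' !inE eqxx vI orbT /= addnC; congr (_ + _).
apply: eq_card => x; rewrite !inE mC' !inE.
have [->|] /= := eqVneq x v; first by rewrite (negbTE vC) andbF.
by have [->|] //= := eqVneq x s; rewrite (negbTE (notin_I0_S0 sS)).
Qed.

Lemma grows_trans d1 d2 C1 C2 C3 :
  grows d1 C1 C2 -> grows d2 C2 C3 -> grows (d1 + d2) C1 C3.
Proof.
move=> [_ s1 w1 c1 i1] [u2 s2 w2 c2 i2]; split=> //.
- exact: leq_trans s2.
- by move=> x xW; rewrite w2 // w1.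
- by rewrite c2 c1 addnA.
- by rewrite i2 i1 addnA.
Qed.

Hypothesis T_big : 4 * m + 4 * p + 4 <= T.

(** If [s] has many neighbours on the cycle, then [s] and a neighbour of it off the cycle go in
    behind one of them; when no neighbour is off the cycle, exchanging one for [v] frees it. If [s]
    has few neighbours on the cycle, then it has two off the cycle, [v1] and [v2], and [v1] is first
    exchanged into the cycle. *)
Lemma augment C s v :
  ucycle e C -> 2 < size C -> s \in S0 -> s \notin C -> v \in I0 -> v \notin C ->
  3 * (m + p) < #|[set x in I0 | x \in C]| ->
  exists2 C', grows 1 C C' & size C < size C'.
Proof.
move=> uC sz sS sC vI vC big; have [cyc un] := andP uC.
pose Nin := [set x in Nset s | x \in C].
pose Nout := [set x in Nset s | x \notin C].
have TN : T <= #|Nin| + #|Nout|.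
  apply: leq_trans (S0_nbr sS) _; rewrite -/(Nset s) -(cardsID [set x in C] (Nset s)).
  by rewrite leq_add //; apply/subset_leq_card/subsetP=> x; rewrite !inE // andbC.
have insert C2 v2 : ucycle e C2 -> 2 < size C2 -> s \notin C2 -> v2 \in Nset s ->
    v2 \notin C2 -> m + p < #|[set x in Nset s | x \in C2]| ->
    exists2 C', grows 1 C2 C' & size C' = (size C2).+2.
  move=> u2 sz2 s2; rewrite inE => /andP[v2I sv2] v2C lt; have [cyc2 un2] := andP u2.
  have [||c [+ nc _]] := @pick_next_prev C2 [set x in Nset s | x \in C2] (Bad v2) set0 un2.
  - by move=> x; rewrite inE => /andP[].
  - by rewrite cards0 addn0; apply: leq_ltn_trans lt; apply: Bad_le.
  by rewrite !inE => /andP[/andP[cI sc] cC2]; apply: (@grows_insert _ c s v2).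
have [NinB|NinS] := ltnP (3 * (m + p) + 1) #|Nin|.
  have [/existsP[v1 /andP[v1N v1C]]|/existsPn noN] :=
    boolP [exists v1, (v1 \in Nset s) && (v1 \notin C)].
    have [|C' gC' sC'] := insert C v1 uC sz sC v1N v1C; first by move: NinB; rewrite -/Nin; gen_lia.
    by exists C'; rewrite ?sC'.
  have [||c [cN nc pc]] := @pick_next_prev C Nin (Bad v) (Bad v) un.
  - by move=> x; rewrite inE => /andP[].
  - by move: (Bad_le vI) NinB; gen_lia.
  move: cN; rewrite !inE => /andP[/andP[cI sc] cC].
  have [C1 [g1 n1 s1 m1]] := grows_swap uC sz cI cC vI vC nc pc.
  have [||||| |C2 g2 s2] := insert C1 c.
  - by case: g1.
  - by rewrite s1.
  - rewrite m1 !inE (negbTE sC) andbF orbF.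
    by apply: contraNneq (notin_I0_S0 sS) => ->.
  - by rewrite inE cI.
  - by rewrite m1 !inE eqxx /= orbF; apply: contraNneq vC => <-.
  - apply: leq_trans (_ : #|Nin :\ c| <= _).
      have cN : c \in Nin by rewrite !inE cI sc cC.
      by move: NinB; rewrite (cardsD1 c Nin) cN; gen_lia.
    apply/subset_leq_card/subsetP=> x; rewrite !inE m1 !inE.
    by case/and3P=> -> /andP[-> ->] ->; rewrite orbT.
  exists C2; last by rewrite s2 s1.
  exact: (grows_trans g1 g2).
have Nout2 : 1 < #|Nout| by move: NinS TN T_big; gen_lia.
have [v1 v1N] : exists v1, v1 \in Nout by apply/card_gt0P; move: Nout2; gen_lia.
have [v2 /setD1P[v21 v2N]] : exists v2, v2 \in Nout :\ v1.
  by apply/card_gt0P; move: Nout2; rewrite (cardsD1 v1 Nout) v1N; gen_lia.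
move: v1N v2N; rewrite !inE => /andP[/andP[v1I sv1] v1C] /andP[/andP[v2I sv2] v2C].
(* The successor of [c] must suit both [v1], which replaces [c], and [v2], which is inserted with
   [s] between [v1] and that successor. This costs |W| + 2 p for the successor and m + p for the
   predecessor, at most 3 (m + p) in all. *)
have [||c [cN nc pc]] := @pick_next_prev C [set x in I0 | x \in C]
    (W :|: ([set x in S0 | ~~ e v1 x] :|: [set x in S0 | ~~ e v2 x])) (Bad v1) un.
- by move=> x; rewrite inE => /andP[].
- have := Bad_le v1I; have := I0_nbr v1I; have := I0_nbr v2I.
  have := (leq_card_setU W ([set x in S0 | ~~ e v1 x] :|: [set x in S0 | ~~ e v2 x])).1.
  have := (leq_card_setU [set x in S0 | ~~ e v1 x] [set x in S0 | ~~ e v2 x]).1.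
  by move: W_le big; rewrite -/(Bad v1); gen_lia.
move: cN; rewrite inE => /andP[cI cC].
have nc1 : next C c \notin Bad v1.
  by apply: contra nc; rewrite !inE => /orP[->|->] //; rewrite orbT.
have nc2 : next C c \notin Bad v2.
  by apply: contra nc; rewrite !inE => /orP[->|->] //; rewrite !orbT.
have [C1 [g1 n1 s1 m1]] := grows_swap uC sz cI cC v1I v1C nc1 pc.
have [||||||C2 g2 s2] := @grows_insert C1 v1 s v2 _ _ v1I _ sS _ v2I _ sv1 sv2.
- by case: g1.
- by rewrite s1.
- by rewrite m1 !inE eqxx.
- rewrite m1 !inE (negbTE sC) andbF orbF.
  by apply: contraNneq (notin_I0_S0 sS) => ->.
- by rewrite m1 !inE (negbTE v21) (negbTE v2C) andbF.
- by rewrite n1.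
exists C2; last by rewrite s2 s1.
exact: (grows_trans g1 g2).
Qed.

(** Each augmentation lengthens the cycle, so the process stops, and it adds a vertex of I0, so the
    hypothesis of [augment] persists. *)
Lemma augment_max C :
  ucycle e C -> 2 < size C -> 3 * (m + p) < #|[set x in I0 | x \in C]| ->
  exists d, exists2 C', grows d C C' &
    {subset S0 <= C'} \/ {subset I0 <= C'}.
Proof.
have [k] := ubnP (#|V| - size C); elim: k C => // k IH C ltk uC sz big.
have [/subsetP S0C | /subsetPn[s sS sC]] := boolP (S0 \subset C).
  by exists 0, C; [split; rewrite ?addn0 | left].
have [/subsetP I0C | /subsetPn[v vI vC]] := boolP (I0 \subset C).
  by exists 0, C; [split; rewrite ?addn0 | right].
have [C1 g1 lt1] := augment uC sz sS sC vI vC big.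
have [u1 s1 w1 c1 i1] := g1.
have le1 : size C1 <= #|V|.
  by have /andP[_ /card_uniqP <-] := u1; apply: max_card.
have [|||d [C2 g2 sub]] := IH C1 _ u1.
- by move: ltk lt1 le1; move: (size C) (size C1) #|V| => x y z; clear; lia.
- exact: leq_trans s1.
- by rewrite i1 addn1 ltnS ltnW.

by exists (1 + d), C2 => //; apply: grows_trans g2.
Qed.

(** * Linking disjoint paths to a cycle *)

Definition piece_ends_in (A : {set V}) (q : seq V) :=
  if q is x :: r then [&& path e x r, x \in A & last x r \in A] else false.

(** A piece consisting of one vertex of S0 counts twice, because it needs a new neighbour in I0 on
    either side. *)
Definition S0_ends (q : seq V) :=
  if q is x :: r then (x \in S0) + (last x r \in S0) else 0.

Lemma card_mem_uniq (A : {set V}) (C : seq V) :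
  uniq C -> #|[set x in A | x \in C]| = count (mem A) C.
Proof.
move=> uC; rewrite -size_filter -(card_uniqP (filter_uniq _ uC)).
by apply: eq_card => x; rewrite !inE mem_filter.
Qed.

(** Every end in S0 has at least [T] neighbours in I0, so one of them is fresh and becomes the new
    end. The sequence [A] collects vertices to be avoided. *)
Lemma extend_piece (A q : seq V) :
  piece_ends_in (~: W) q -> uniq (A ++ q) -> size A + size q + 2 < T ->
  exists X1 X2, [/\ piece_ends_in I0 (X1 ++ q ++ X2), all (mem I0) (X1 ++ X2),
    size (X1 ++ X2) = S0_ends q & uniq (A ++ X1 ++ q ++ X2)].
Proof.
have notW x : x \in ~: W -> (x \in S0) || (x \in I0).
  by rewrite inE => /negbTE xW; have := cover x; rewrite xW.
case: q => // x r /and3P[pth xW lW] uA lt.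
have [X1 [end1 all1 sz1 u1]] : exists X1, [/\ piece_ends_in setT (X1 ++ x :: r) &&
    (head x X1 \in I0), all (mem I0) X1, size X1 = (x \in S0) & uniq (A ++ X1 ++ x :: r)].
  have [xS|xS] := boolP (x \in S0); last first.
    exists [::]; split=> //=; rewrite pth !inE /=.
    by have := notW x xW; rewrite (negbTE xS).
  have [|v] := @fresh (Nset x) (A ++ x :: r).
    by apply: leq_trans (S0_nbr xS); move: lt; rewrite size_cat; gen_lia.
  rewrite inE => /andP[vI xv] vX; exists [:: v]; split=> //=.
  - by rewrite e_sym xv pth !inE vI.
  - by rewrite vI.
  by rewrite (uniq_catCA A [:: v]) cat_uniq /= uA andbT; apply/hasPn => z zX; rewrite inE; apply: contraNneq vX => <-.
have [X2 [all2 sz2 u2 end2]] : exists X2, [/\ all (mem I0) X2,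
    size X2 = (last x r \in S0), uniq (A ++ X1 ++ x :: r ++ X2)
    & path e (last x r) X2 && (last (last x r) X2 \in I0)].
  have [lS|lS] := boolP (last x r \in S0); last first.
    exists [::]; rewrite cats0; split=> //=.
    by have := notW _ lW; rewrite (negbTE lS).
  have [|v] := @fresh (Nset (last x r)) (A ++ X1 ++ x :: r).
    apply: leq_trans (S0_nbr lS); rewrite !size_cat sz1.
    by move: lt => /=; gen_lia.
  rewrite inE => /andP[vI xv] vX; exists [:: v]; split=> //=.
  - by rewrite vI.
  - rewrite -cat_cons !catA cats1 rcons_uniq.
    by rewrite -catA vX u1.
  by rewrite xv vI.
exists X1, X2; split=> //.
- case: X1 all1 {sz1 u1 u2} end1 => [|y X1] all1 /=.
    by case/andP=> _ ->; rewrite cat_path last_cat pth.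
  case/andP=> /and3P[p1 _ _] ->; rewrite cat_path last_cat /=.
  move: p1; rewrite cat_path /= => /and3P[-> -> _] /=.
  by rewrite cat_path last_cat pth.
- by rewrite all_cat all1 all2.
by rewrite size_cat sz1 sz2.
Qed.

Lemma extend_pieces (ps : seq (seq V)) (A : seq V) :
  all (piece_ends_in (~: W)) ps -> uniq (A ++ flatten ps) ->
  size A + size (flatten ps) + 2 * size ps < T ->
  exists ps' X, [/\ all (piece_ends_in I0) ps', size ps' = size ps,
    perm_eq (flatten ps') (flatten ps ++ X),
    all (mem I0) X /\ size X = sumn (map S0_ends ps)
    & uniq (A ++ flatten ps')].
Proof.
elim: ps A => [|q ps IH] A /=; first by move=> _ uA _; exists [::], [::].
case/andP=> gq gps uA lt.
have pA : perm_eq (A ++ q ++ flatten ps) ((A ++ flatten ps) ++ q).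
  by rewrite -catA perm_cat2l perm_catC.
have [||X1 [X2 [g' a' s' u']]] := @extend_piece (A ++ flatten ps) q gq.
- by rewrite -(perm_uniq pA).
- by move: lt; rewrite !size_cat; gen_lia.
have sX : size (X1 ++ X2) <= 2.
  rewrite s'; case: (q) => //= x r.
  by case: (_ \in _); case: (_ \in _).
have [||ps' [X [g2 s2 p2 [a2 z2] u2]]] := IH (A ++ X1 ++ q ++ X2) gps.
- rewrite -(perm_uniq (_ : perm_eq ((A ++ flatten ps) ++ X1 ++ q ++ X2) _)) //.
  by rewrite -!catA perm_cat2l perm_catC -!catA.
- by move: lt sX; rewrite !size_cat; gen_lia.
exists ((X1 ++ q ++ X2) :: ps'), (X1 ++ X2 ++ X); split.
- by rewrite /= g' g2.
- by rewrite /= s2.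
- rewrite /= (perm_trans (perm_cat (perm_refl _) p2)) //.
  by apply/permP=> a; rewrite !count_cat; gen_lia.
- split; first by move: a'; rewrite !all_cat a2 => /andP[-> ->].
  by rewrite /= -s' -z2 !size_cat; gen_lia.
by rewrite /= catA.
Qed.

Lemma common_nbr v1 v2 (Y : seq V) : v1 \in I0 -> v2 \in I0 ->
  size Y + 2 * p < #|S0| -> exists s, [/\ s \in S0, e v1 s, e s v2 & s \notin Y].
Proof.
move=> v1I v2I lt; pose B v := [set s in S0 | ~~ e v s].
have [|s] := @fresh (S0 :\: (B v1 :|: B v2)) Y.
  move: lt (I0_nbr v1I) (I0_nbr v2I) (cardsID (B v1 :|: B v2) S0).
  move: (subset_leq_card (subsetIr S0 (B v1 :|: B v2))) (leq_card_setU (B v1) (B v2)).1.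
  by rewrite -!/(B _); gen_lia.
rewrite !inE negb_or => /andP[/andP[+ +] sS]; rewrite sS /= !negbK => e1 e2 sY.
by exists s; split=> //; rewrite e_sym.
Qed.

(** Two vertices of I0 together miss at most 2 p vertices of S0, so the end of the path built so far
    and the start of the next piece have a fresh common neighbour in S0. *)
Lemma link_pieces (ps : seq (seq V)) x P :
  path e x P -> last x P \in I0 -> all (piece_ends_in I0) ps ->
  uniq (x :: P ++ flatten ps) ->
  (size P).+1 + size (flatten ps) + size ps + 2 * p < #|S0| ->
  exists P' X, [/\ path e x P' && (last x P' \in I0),
    perm_eq P' (P ++ flatten ps ++ X), uniq (x :: P'),
    all (mem S0) X & size X = size ps].
Proof.
elim: ps P => [|q ps IH] P pth lI /=.
  move=> _; rewrite cats0 => uP _; exists P, [::]; split=> //; last by rewrite cats0.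
  by rewrite pth lI.
case/andP=> gq gps uP lt; case: q gq uP lt => // y r /and3P[pq yI lq] uP lt.
have [|s [sS e1 e2 sY]] := @common_nbr (last x P) y (x :: P ++ (y :: r) ++ flatten ps) lI yI.
  by move: lt => /=; rewrite !size_cat /= ?size_cat; gen_lia.
have perm1 : perm_eq (s :: x :: P ++ (y :: r) ++ flatten ps)
    (x :: (P ++ s :: y :: r) ++ flatten ps).
  by apply/permP=> a; rewrite /= !count_cat /= !count_cat; gen_lia.
have [|||||P' [X [pl pP uP' aX sX]]] := IH (P ++ s :: y :: r).
- by rewrite cat_path pth /= e1 e2.
- by rewrite last_cat.
- by [].
- by rewrite -(perm_uniq perm1) cons_uniq sY.
- by move: lt => /=; rewrite !size_cat /= ?size_cat; gen_lia.
exists P', (s :: X); split=> //=; [ | by rewrite sS | by rewrite sX].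
rewrite (perm_trans pP) //; apply/permP=> a.
by rewrite /= !count_cat /= !count_cat /=; gen_lia.
Qed.

Lemma link_cycle (ps : seq (seq V)) :
  0 < size ps -> all (piece_ends_in (~: W)) ps -> uniq (flatten ps) ->
  size (flatten ps) + 2 * size ps < T ->
  size (flatten ps) + 3 * size ps + 2 * p + 1 < #|S0| ->
  exists C XI XS, [/\ ucycle e C, perm_eq C (flatten ps ++ XI ++ XS),
    all (mem I0) XI /\ size XI = sumn (map S0_ends ps)
    & all (mem S0) XS /\ size XS = size ps].
Proof.
move=> sz0 gps ups lT lS.
have [ps' [XI [g1 s1 p1 [a1 z1] u1]]] := @extend_pieces ps [::] gps ups lT.
have zXI : size XI <= 2 * size ps.
  rewrite z1; elim: (ps) => //= q r IH; rewrite mulnS; apply: leq_add => //.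
  by case: (q) => //= x q'; case: (_ \in _); case: (_ \in _).
have sF := perm_size p1; rewrite size_cat in sF.
case: ps' g1 s1 p1 u1 sF => [|[|x P] ps'] //= g1 s1 p1 u1 sF.
  by rewrite -s1 in sz0.
case/andP: g1 => /and3P[pP xI lI] g1.
have [||P' [XS [/andP[pP' lP'] pp' uP' aXS zXS]]] := link_pieces pP lI g1.
- by [].
- by move: lS sF zXI s1; rewrite size_cat; gen_lia.
have [|s [sS e1 e2 sY]] := @common_nbr (last x P') x (x :: P') lP' xI.
  move: (perm_size pp') lS sF zXI s1 zXS; rewrite !size_cat /=; gen_lia.
exists (x :: rcons P' s), XI, (s :: XS); split.
- rewrite /ucycle /= !rcons_path last_rcons pP' e1 e2 /=.
  rewrite mem_rcons rcons_uniq; move: sY uP'.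
  by rewrite !inE negb_or eq_sym => /andP[/negbTE-> ->] /= /andP[-> ->].
- apply/permP=> a; move/permP/(_ a): pp'; move/permP/(_ a): p1.
  by rewrite /= -cats1 !count_cat /=; gen_lia.
- by [].
by rewrite /= sS aXS zXS -s1.
Qed.

(** Linking adds one vertex of S0 per piece and one of I0 per piece end in S0; augmenting adds
    equally many of both. This gives the identity. The many vertices of I0 in the pieces are what
    [augment] needs to start. *)
Lemma complete (ps : seq (seq V)) :
  1 < size ps -> all (piece_ends_in (~: W)) ps -> uniq (flatten ps) ->
  size (flatten ps) + 2 * size ps < T ->
  size (flatten ps) + 3 * size ps + 2 * p + 1 < #|S0| ->
  3 * (m + p) < count (mem I0) (flatten ps) ->
  exists C, [/\ ucycle e C, 2 < size C, {in W, C =i flatten ps},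
    count (mem S0) C + count (mem I0) (flatten ps) + sumn (map S0_ends ps) =
    count (mem I0) C + count (mem S0) (flatten ps) + size ps
    & {subset S0 <= C} \/ {subset I0 <= C}].
Proof.
move=> sz gps ups lT lS big.
have [C [XI [XS [uC pC [aI zI] [aS zS]]]]] := link_cycle (ltnW sz) gps ups lT lS.
have [_ un] := andP uC.
have all_count (A B : {set V}) X : [disjoint A & B] -> all (mem A) X ->
    (count (mem A) X = size X) * (count (mem B) X = 0).
  move=> dis /allP aX; split; first by apply/eqP; rewrite -all_count; apply/allP.
  apply/eqP; rewrite -leqn0 leqNgt -has_count; apply/hasPn => x /aX xA.
  by rewrite /= (disjointFr dis xA).
have SI0' : [disjoint I0 & S0] by rewrite disjoint_sym.
have cI := permP pC (mem I0); rewrite !count_cat in cI.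
rewrite (all_count _ _ _ SI0' aI).1 (all_count _ _ _ SI0 aS).2 in cI.
have cS := permP pC (mem S0); rewrite !count_cat in cS.
rewrite (all_count _ _ _ SI0 aS).1 (all_count _ _ _ SI0' aI).2 in cS.
have sC : 2 < size C.
  have := perm_size pC; rewrite !size_cat.
  have := count_size (mem I0) (flatten ps); have := count_size (mem I0) C.
  have : size ps <= size (flatten ps).
    elim: (ps) gps => //= -[|y q] r IH //= /andP[_ /IH]; rewrite size_cat; gen_lia.
  move: sz aI zI zS big cI; gen_lia.
have bigC : 3 * (m + p) < #|[set x in I0 | x \in C]|.
  by rewrite card_mem_uniq // cI; move: big; gen_lia.
have [d [C' [u' s' w' S' I'] sub]] := augment_max uC sC bigC.
have [_ un'] := andP u'.
rewrite !card_mem_uniq // in S' I'.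
exists C'; split=> //.
- exact: leq_trans s'.
- move=> x xW; rewrite w' // (perm_mem pC) !mem_cat.
  have -> : (x \in XI) = false.
    by apply: contraNF (notin_I0_W xW) => /(allP aI).
  have -> : (x \in XS) = false.
    by apply: contraTF xW => /(allP aS) /= /notin_W_S0.
  by rewrite !orbF.
by rewrite S' I' cS cI zI zS; move: (sumn _) => ?; gen_lia.
Qed.

End Completion.

(** * Configurations *)

(** An edge of a configuration: first its group, naming the part of the graph that it stands for,
    then its two ends. Orientation does not matter; [nrm] forgets it. *)
Definition edge := ((nat * nat) * (nat * nat))%type.
Definition src (x : edge) := x.2.1.
Definition tgt (x : edge) := x.2.2.
Definition flip (x : edge) : edge := (x.1, (x.2.2, x.2.1)).
Definition nrm (x : edge) : edge := if src x <= tgt x then x else flip x.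

Definition deg (E : seq edge) u := count (fun x => src x == u) E + count (fun x => tgt x == u) E.

(* Every vertex touched by an edge of E is connected to r by edges of E. *)
Definition connected_to (r : nat) (E : seq edge) :=
  forall K : pred nat, {in E, forall x, K (src x) = K (tgt x)} -> K r = false ->
  {in E, forall x, K (src x) = false}.

Fixpoint walk a (t : seq edge) b :=
  if t is x :: t' then (src x == a) && walk (tgt x) t' b else a == b.

Definition trail r (t : seq edge) :=
  if t is x :: t' then walk r t r && all (fun y => src y != r) t' else false.

Lemma nrm_flip x : nrm (flip x) = nrm x.
Proof.
case: x => [g [u w]]; rewrite /nrm /flip /src /tgt /=.
by case: (ltngtP u w) => // ->.
Qed.

Lemma nrm_or x : nrm x = x \/ nrm x = flip x.
Proof. by rewrite /nrm; case: ifP; [left | right]. Qed.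

Lemma flipK x : flip (flip x) = x.
Proof. by case: x => [g [u w]]. Qed.

Lemma perm_sum (T : eqType) (f : T -> nat) (s1 s2 : seq T) :
  perm_eq s1 s2 -> sumn (map f s1) = sumn (map f s2).
Proof. by move=> /(perm_map f) /perm_sumn. Qed.

Lemma degE E u : deg E u = sumn [seq (src x == u) + (tgt x == u) | x <- E].
Proof. by rewrite /deg; elim: E => //= x E <-; lia. Qed.

Lemma deg_cat E F u : deg (E ++ F) u = deg E u + deg F u.
Proof. by rewrite !degE map_cat sumn_cat. Qed.

Lemma sum_nrm (f : edge -> nat) E : (forall x, f (flip x) = f x) ->
  sumn (map f (map nrm E)) = sumn (map f E).
Proof.
move=> ff; rewrite -map_comp; congr sumn; apply: eq_map => x /=.
by case: (nrm_or x) => ->.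
Qed.

Lemma sum_same (f : edge -> nat) E F : (forall x, f (flip x) = f x) ->
  perm_eq (map nrm E) (map nrm F) -> sumn (map f E) = sumn (map f F).
Proof. by move=> ff /(perm_sum f); rewrite !sum_nrm. Qed.

Lemma deg_same E F u : perm_eq (map nrm E) (map nrm F) -> deg E u = deg F u.
Proof. by rewrite !degE => /sum_same-> // x; rewrite addnC. Qed.

Lemma mem_same E F x : perm_eq (map nrm E) (map nrm F) -> x \in E ->
  x \in F \/ flip x \in F.
Proof.
move=> /perm_mem mEF /(map_f nrm); rewrite mEF => /mapP[y yF].
case: (nrm_or x) (nrm_or y) => -> [] -> E1.
- by left; rewrite E1.
- by right; rewrite E1 flipK.
- by right; rewrite E1.
- by left; rewrite -(flipK x) E1 flipK.
Qed.

Lemma connected_same r E F : perm_eq (map nrm E) (map nrm F) ->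
  connected_to r E -> connected_to r F.
Proof.
move=> pEF cE K cK Kr x xF.
have cK' : {in E, forall x, K (src x) = K (tgt x)}.
  by move=> y /(mem_same pEF) [] /cK.
have := mem_same (_ : perm_eq (map nrm F) (map nrm E)) xF; rewrite perm_sym => -[//|xE|xE].
  exact: cE.
by rewrite cK //; apply: (cE K cK' Kr _ xE).
Qed.

Lemma degP E u : reflect (exists2 x, x \in E & (src x == u) || (tgt x == u)) (0 < deg E u).
Proof.
rewrite /deg addn_gt0 -!has_count; apply: (iffP orP).
  by case=> /hasP[x xE xu]; exists x; rewrite ?xu ?orbT.
by case=> x xE /orP[xu|xu]; [left | right]; apply/hasP; exists x.
Qed.

Lemma walk_rcons a t x u : walk a t u -> src x = u -> walk a (rcons t x) (tgt x).
Proof.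
elim: t a => [|y t IH] a /=; first by move=> /eqP-> ->; rewrite !eqxx.
by case/andP=> -> wt xu /=; apply: IH.
Qed.

Lemma walk_balanced a t b u : walk a t b ->
  count (fun x => src x == u) t + (b == u) = count (fun x => tgt x == u) t + (a == u).
Proof.
elim: t a => [|x t IH] a /=; first by move=> /eqP->.
by case/andP=> /eqP <- /IH; lia.
Qed.

Lemma trails_balanced r ts u : all (trail r) ts ->
  count (fun x => src x == u) (flatten ts) = count (fun x => tgt x == u) (flatten ts).
Proof.
elim: ts => //= t ts IH /andP[tt /IH]; rewrite !count_cat => ->.
by case: t tt => // x t /andP[/(walk_balanced u)]; lia.
Qed.

(** * Decomposition of an edge set into trails at the root *)

Section Trails.
Variables (r : nat) (E0 : seq edge).
Hypothesis E0_deg : forall u, u != r -> deg E0 u = 0 \/ deg E0 u = 2.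
Hypothesis E0_loop : {in E0, forall x, src x != tgt x}.
Hypothesis E0_conn : connected_to r E0.

Let same F := perm_eq (map nrm E0) (map nrm F).

Lemma same_take_edge (F1 F2 E : seq edge) (u : nat) :
  same (F1 ++ F2 ++ E) -> 0 < deg E u ->
  exists x E', [/\ src x = u, same (F1 ++ rcons F2 x ++ E'), size E' < size E
    & tgt x != u].
Proof.
move=> sF /degP[x xE xu].
have pE := perm_to_rem xE.
have szE := perm_size pE.
have xloop : src x != tgt x.
  have xF : x \in F1 ++ F2 ++ E by rewrite !mem_cat xE !orbT.
  have sF' : perm_eq (map nrm (F1 ++ F2 ++ E)) (map nrm E0) by rewrite perm_sym.
  by case: (mem_same sF' xF) => /E0_loop; rewrite // eq_sym.
have sx y : nrm y = nrm x -> same (F1 ++ rcons F2 y ++ rem x E).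
  move=> yx; apply: (perm_trans sF); rewrite !map_cat perm_cat2l map_rcons cat_rcons perm_cat2l.
  by rewrite yx -map_cons perm_map.
have [xu'|xu'] := eqVneq (src x) u.
  exists x, (rem x E); split=> //; [exact: sx | by rewrite szE | by rewrite -xu' eq_sym].
exists (flip x), (rem x E); rewrite (negbTE xu') /= in xu.
split; [exact/eqP | by apply: sx; rewrite nrm_flip | by rewrite szE | ].
exact: xu'.
Qed.

Lemma trails_ind k E D cur u :
  size E < k -> same (flatten D ++ cur ++ E) -> all (trail r) D ->
  (cur == [::]) || [&& walk r cur u, u != r & all (fun x => src x != r) (behead cur)] ->
  exists2 ts, same (flatten ts) & all (trail r) ts.
Proof.
elim: k E D cur u => // k IH E D cur u ltk sF tD /orP[/eqP cur0|].
  rewrite cur0 /= in sF; have [degr|] := posnP (deg E r); last first.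
    move=> degr; have [x [E' [xr sF' lt tx]]] := @same_take_edge (flatten D) [::] E r sF degr.
    apply: (IH E' D [:: x] (tgt x)) => //; first exact: leq_trans lt _.
    by rewrite /= xr !eqxx tx.
  case: E sF degr ltk => [|x E] sF degr ltk; first by exists D; rewrite cats0 // in sF.
  exfalso; set E1 := x :: E in sF degr *.
  have cF := connected_same sF E0_conn.
  pose K v := 0 < deg E1 v.
  have KE y : y \in E1 -> K (src y) && K (tgt y).
    by move=> yE; apply/andP; split; apply/degP; exists y; rewrite ?eqxx ?orbT.
  have KD v : 0 < deg (flatten D) v -> K v = false.
    move=> dv; apply/negbTE; rewrite -leqNgt.
    have [->|vr] := eqVneq v r; first by rewrite degr.
    have dE : deg E0 v = deg (flatten D) v + deg E1 v by rewrite (deg_same _ sF) deg_cat.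
    have dD : deg (flatten D) v = 2 * count (fun y => src y == v) (flatten D).
      by rewrite /deg -(trails_balanced v tD) mul2n addnn.
    by have := E0_deg vr; lia.
  have cK : {in flatten D ++ E1, forall y, K (src y) = K (tgt y)}.
    move=> y; rewrite mem_cat => /orP[yD|/KE/andP[-> ->] //].
    by rewrite !KD //; apply/degP; exists y; rewrite ?eqxx ?orbT.
  have Kr : K r = false by rewrite /K degr.
  have xE : x \in E1 by rewrite mem_head.
  have := cF K cK Kr x; rewrite mem_cat xE orbT => /(_ isT).
  by have /andP[->] := KE x xE.
case/and3P=> wc ur sc; have curN : cur != [::] by case: cur wc {sF sc} => //= /eqP ru; rewrite -ru eqxx in ur.
have degE : 0 < deg E u.
  have dE : deg E0 u = deg (flatten D) u + (deg cur u + deg E u).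
    by rewrite (deg_same _ sF) !deg_cat.
  have dD : deg (flatten D) u = 2 * count (fun y => src y == u) (flatten D).
    by rewrite /deg -(trails_balanced u tD) mul2n addnn.
  have dc : deg cur u = 2 * count (fun y => src y == u) cur + 1.
    have := walk_balanced u wc; rewrite eqxx (eq_sym r) (negbTE ur) addn0 /deg => <-.
    by lia.
  by have := E0_deg ur; lia.
have [x [E' [xu sF' lt tx]]] := same_take_edge sF degE.
have wc' := walk_rcons wc xu.
have sc' : all (fun x => src x != r) (behead (rcons cur x)).
  by case: (cur) curN sc => //= y c _ sc; rewrite all_rcons sc xu ur.
have [txr|txr] := eqVneq (tgt x) r; last first.
  apply: (IH E' D (rcons cur x) (tgt x)) => //; first exact: leq_trans lt _.
  by rewrite wc' txr sc' orbT.
apply: (IH E' (rcons D (rcons cur x)) [::] u) => //; first exact: leq_trans lt _.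
  by rewrite flatten_rcons -catA.
rewrite all_rcons tD andbT; move: wc' sc'; rewrite txr.
by case: (cur) curN => //= y c _ -> ->.
Qed.

Lemma trails_exist :
  exists2 ts, perm_eq (map nrm E0) (map nrm (flatten ts)) & all (trail r) ts.
Proof. by apply: (@trails_ind (size E0).+1 E0 [::] [::] 0) => //; apply: perm_refl. Qed.

End Trails.

(** * From configurations to cycles and paths *)

Section Configurations.
Variables (n : nat) (eN : rel nat) (W S0 : pred nat).

(* The group (a, a) is the vertex a outside W, the group (a, b) with a <> b
   the edge ab inside W.  The label n stands for any vertex outside W. *)
Definition link a b u :=
  W u && (if a == b then ~~ W a && ((u == n) || eN a u)
          else [&& W a, W b, eN a b & (u == a) || (u == b)]).

Definition opt (x : edge) :=
  [&& x.1.1 < n, x.1.2 < n, src x <= n, tgt x <= n, src x != tgt x,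
      link x.1.1 x.1.2 (src x) & link x.1.1 x.1.2 (tgt x)].

(* The number of edges joining W to W or to S0 that x stands for. *)
Definition stat (x : edge) :=
  if x.1.1 == x.1.2 then S0 x.1.1 * ((src x < n) + (tgt x < n)) else 1.

Definition tau E := sumn (map stat E).

Definition cnt E := count (fun u => W u && (deg E u == 2)) (iota 0 n).

Definition config r E :=
  [/\ uniq (map fst E), all opt E,
      forall u, u < n -> W u -> deg E u = 0 \/ deg E u = 2 & connected_to r E].

Definition items (x : edge) := if x.1.1 == x.1.2 then [:: x.1.1] else [::].
(** The start of the walk is left out: a trail is closed, so its start reappears as the last target
    and would otherwise be listed twice. *)
Definition route (t : seq edge) := flatten [seq rcons (items x) (tgt x) | x <- t].

Definition real_route (t : seq edge) := [seq v <- route t | v != n].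

(** The virtual vertex is adjacent to everything, so that every walk spells out a path of this
    relation. *)
Definition eX : rel nat := fun a b => [|| a == n, b == n | eN a b].

Hypothesis eN_sym : symmetric eN.
Hypothesis eN_irr : irreflexive eN.
Hypothesis S0_W : forall a, S0 a -> ~~ W a.

Lemma opt_flip x : opt (flip x) = opt x.
Proof. by rewrite /opt /flip /src /tgt /=; do !bool_congr; rewrite eq_sym; do !bool_congr. Qed.

Lemma stat_flip x : stat (flip x) = stat x.
Proof. by rewrite /stat /flip /src /tgt /= addnC. Qed.

Lemma opt_nW x : opt x -> x.1.1 == x.1.2 -> ~~ W x.1.1.
Proof. by case/and5P=> _ _ _ _ /and3P[_ /andP[_ +] _] => /[swap] ->; case/andP. Qed.

Lemma opt_W x : opt x -> W (src x) && W (tgt x).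
Proof. by case/and5P=> _ _ _ _ /and3P[_ /andP[-> _] /andP[-> _]]. Qed.

Lemma opt_le x : opt x -> (src x <= n) && (tgt x <= n).
Proof. by case/and5P=> _ _ -> ->. Qed.

Lemma count_route p t : count p (route t) =
  count (fun x => p (tgt x)) t + count (fun x => (x.1.1 == x.1.2) && p x.1.1) t.
Proof.
elim: t => //= x t IH; rewrite /route /= count_cat -/(route t) IH -cats1 count_cat /items.
by case: ifP => _ /=; lia.
Qed.

Lemma route_cat t1 t2 : route (t1 ++ t2) = route t1 ++ route t2.
Proof. by rewrite /route map_cat flatten_cat. Qed.

Lemma path_route a t b : walk a t b -> all opt t -> path eX a (route t) /\ last a (route t) = b.
Proof.
elim: t a => [|x t IH] a /=; first by move=> /eqP.
case/andP=> /eqP <- wt /andP[ox ot]; have [pt lt] := IH _ wt ot.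
rewrite /route /= cat_path last_cat last_rcons; split=> //.
rewrite rcons_path -/(route t) pt andbT /items.
have := ox => /and5P[an bn sn tn /and3P[st]]; rewrite /link /eX.
case: (eqVneq x.1.1 x.1.2) => [E|ab] /andP[_ s1] /andP[_ s2] /=.
  case/andP: s1 => _ s1; case/andP: s2 => _ s2.
  by rewrite (eN_sym (src x)); case/orP: s1 => ->; case/orP: s2 => ->; rewrite ?orbT.
case/and4P: s1 => _ _ eab /orP[]/eqP E1; case/and4P: s2 => _ _ _ /orP[]/eqP E2.
- by rewrite E1 E2 eqxx in st.
- by rewrite E1 E2 eab !orbT.
- by rewrite E1 E2 eN_sym eab !orbT.
- by rewrite E1 E2 eqxx in st.
Qed.

Lemma deg_small r E u : config r E -> ~~ W u || (n < u) -> deg E u = 0.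
Proof.
case=> _ /allP oE _ _ h; apply/eqP; rewrite -leqn0 leqNgt.
apply/negP => /degP[x xE xu]; have := opt_W (oE x xE); have := opt_le (oE x xE).
by case/orP: xu => /eqP->; case/orP: h => h; move: h; case: (W u) => //; lia.
Qed.

Section Routes.
Variables (r : nat) (E : seq edge) (ts : seq (seq edge)).
Hypothesis cE : config r E.
Hypothesis pE : perm_eq (map nrm E) (map nrm (flatten ts)).
Hypothesis tts : all (trail r) ts.
Let F := flatten ts.

Lemma F_opt : all opt F.
Proof.
have [_ /allP oE _ _] := cE; apply/allP => x xF.
have pE' : perm_eq (map nrm F) (map nrm E) by rewrite perm_sym.
by case: (mem_same pE' xF) => /oE //; rewrite opt_flip.
Qed.

Lemma F_fst : uniq (map fst F).
Proof.
have [uE _ _ _] := cE; rewrite -(perm_uniq (_ : perm_eq (map fst E) _)) //.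
have fn x : (nrm x).1 = x.1 by case: (nrm_or x) => ->.
have mapE s : map fst s = map fst (map nrm s).
  by rewrite -map_comp; apply: eq_map => x /=; rewrite fn.
by rewrite (mapE E) (mapE F) perm_map.
Qed.

Lemma F_tau : tau F = tau E.
Proof. by rewrite /tau; apply/esym/sum_same => //; apply: stat_flip. Qed.

Lemma F_src_tgt u : count (fun x => src x == u) F = count (fun x => tgt x == u) F.
Proof. exact: trails_balanced tts. Qed.

(** Trails enter a vertex as often as they leave it, so a degree of 2 is one entry and one exit. *)
Lemma F_tgt u : u < n -> W u -> count (fun x => tgt x == u) F = (deg E u == 2).
Proof.
move=> un Wu; have [_ _ dE _] := cE.
have := dE u un Wu; rewrite (deg_same u pE) -/F /deg F_src_tgt.
by case; lia.
Qed.

(** A vertex of W is listed only as a target, hence at most once; a vertex outside W is listed once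
    per edge of its group, and groups are not repeated. *)
Lemma count_mem_route v : v < n -> count_mem v (route F) <= 1.
Proof.
move=> vn; rewrite count_route /=.
have oF := allP F_opt.
have [Wv|nWv] := boolP (W v).
  rewrite F_tgt // (_ : count _ F = 0) ?addn0; first by case: (_ == 2).
  apply/eqP; rewrite -leqn0 leqNgt -has_count; apply/hasPn => x /oF ox.
  by apply/negP => /andP[/(opt_nW ox) + /eqP E1]; rewrite E1 Wv.
rewrite (_ : count _ F = 0) ?add0n; last first.
  apply/eqP; rewrite -leqn0 leqNgt -has_count; apply/hasPn => x /oF ox.
  by apply: contraNneq nWv => <-; case/andP: (opt_W ox).
apply: leq_trans (_ : count_mem (v, v) (map fst F) <= _); last first.
  by rewrite count_uniq_mem ?F_fst //; case: (_ \in _).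
rewrite count_map; apply: sub_count => -[[a b] p] /=.
by case/andP=> /eqP -> /eqP ->.
Qed.

Lemma route_le v : v \in route F -> v <= n.
Proof.
move=> /flattenP[s /mapP[x xF ->]]; have ox := allP F_opt x xF.
rewrite mem_rcons inE => /orP[/eqP->|]; first by case/andP: (opt_le ox).
by rewrite /items; case: ifP => // _; rewrite inE => /eqP->; case/and5P: ox => /ltnW.
Qed.

Lemma uniq_real_route : uniq (real_route F).
Proof.
apply: count_mem_uniq => v; rewrite -has_pred1 has_count.
have le : count_mem v (real_route F) <= 1.
  have [vn|nv] := ltnP v n.
    apply: leq_trans (count_mem_route vn); rewrite count_filter.
    by apply: sub_count => x /andP[].
  apply: leq_trans (leq0n _); rewrite leqn0 -leqn0 leqNgt -has_count.
  apply/hasPn => x; rewrite mem_filter => /andP[xn /route_le xle].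
  by apply/negP => /eqP E1; rewrite E1 in xn xle; lia.
by move: le; case: (count_mem v _) => [|[|]].
Qed.

Lemma mem_real_route w : w < n -> W w -> (w \in real_route F) = (deg E w == 2).
Proof.
move=> wn Ww; rewrite mem_filter -has_pred1 has_count count_route /=.
have -> : (w != n) = true by rewrite neq_ltn wn.
rewrite F_tgt // (_ : count _ F = 0) ?addn0; first by case: (_ == 2).
apply/eqP; rewrite -leqn0 leqNgt -has_count; apply/hasPn => x /(allP F_opt) ox.
by apply/negP => /andP[/(opt_nW ox) + /eqP E1]; rewrite E1 Ww.
Qed.

(** Edges are counted by their targets: each vertex of W of degree 2 is the target of one edge, and
    every other target is [n]. *)
Lemma size_F : size F = cnt E + count (fun x => tgt x == n) F.
Proof.
rewrite -(count_predC (fun x => tgt x == n) F) addnC; congr (_ + _).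
set s := map tgt (filter (predC (fun x => tgt x == n)) F).
have -> : count (predC (fun x => tgt x == n)) F = size s by rewrite size_map size_filter.
rewrite /cnt -size_filter; apply/eqP; rewrite -uniq_size_uniq //.
- apply: count_mem_uniq => v; rewrite -has_pred1 has_count.
  have : count_mem v s <= 1.
    have [/hasP[x xs /eqP <-]|/negP] := boolP (has (pred1 v) s); last first.
      by rewrite has_count; case: (count _ _) => // c [].
    move: xs => /mapP[y]; rewrite mem_filter /= => /andP[yn yF] ->.
    have oy := allP F_opt y yF.
    have yn' : tgt y < n by rewrite ltn_neqAle yn; case/andP: (opt_le oy).
    rewrite /s count_map; apply: leq_trans (_ : count (fun x => tgt x == tgt y) F <= _).
      by rewrite count_filter; apply: sub_count => z /andP[].
    by rewrite F_tgt //; [case: (_ == 2) | case/andP: (opt_W oy)].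
  by case: (count_mem v s) => [|[|]].
- exact: filter_uniq (iota_uniq _ _).
move=> v; rewrite mem_filter mem_iota add0n andbC.
apply/andP/mapP => [[/= vn /andP[Wv dv]]|[x]].
  have := F_tgt vn Wv; rewrite dv => c1.
  have /hasP[x xF /eqP xv] : has (fun x => tgt x == v) F by rewrite has_count c1.
  by exists x => //; rewrite mem_filter /= xF xv neq_ltn vn.
rewrite mem_filter /= => /andP[xn xF] ->; have ox := allP F_opt x xF.
have xn' : tgt x < n by rewrite ltn_neqAle xn; case/andP: (opt_le ox).
have Wx : W (tgt x) by case/andP: (opt_W ox).
rewrite xn' Wx; split=> //; apply/eqP.
have := F_tgt xn' Wx; case: eqP => // _ /eqP.
by rewrite -leqn0 leqNgt -has_count => /hasPn/(_ x xF); rewrite eqxx.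
Qed.

End Routes.

Lemma config_trails r E : config r E ->
  (if r < n then W r && ~~ W n && (deg E r == 2) else (r == n) && W n) ->
  exists2 ts, perm_eq (map nrm E) (map nrm (flatten ts)) & all (trail r) ts.
Proof.
move=> cE r_ok; have [_ oE dE conn] := cE.
apply: trails_exist => //; last by move=> x /(allP oE) /and5P[_ _ _ _ /and3P[]].
move=> u ur; have [Wu|nWu] := boolP (W u); last by left; apply: (deg_small cE); apply/orP; left.
case: (ltngtP u n) => [un|nu|Eu]; first exact: dE.
  by left; apply: (deg_small cE); apply/orP; right.
move: r_ok; case: ifP => [_|_]; last by rewrite -Eu (eq_sym r) (negbTE ur).
by rewrite -Eu Wu andbF.
Qed.

(** The root has degree 2, so there is a single trail, and it spells out a cycle. It has [cnt E]
    edges, each of which contributes a further vertex outside W, except for the [tau E] edges inside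
    W. *)
Lemma config_cycle r E :
  r < n -> W r -> ~~ W n -> deg E r = 2 -> (forall a, S0 a = false) -> config r E ->
  exists c, [/\ uniq c, cycle eN c, all (fun a => a < n) c & size c + tau E = 2 * cnt E].
Proof.
move=> rn Wr nWn dr S00 cE.
have r_ok : if r < n then W r && ~~ W n && (deg E r == 2) else (r == n) && W n.
  by rewrite rn Wr nWn dr.
have [ts pE tts] := config_trails cE r_ok.
have oF := F_opt cE pE.
have tgtn x : x \in flatten ts -> tgt x < n.
  move=> /(allP oF) ox; case/andP: (opt_le ox) (opt_W ox) => _ + /andP[_].
  by rewrite leq_eqVlt => /orP[/eqP->|//]; rewrite (negbTE nWn).
have [t Et] : exists t, ts = [:: t].
  have := F_tgt cE pE tts rn Wr; rewrite dr -(F_src_tgt tts).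
  have le : forall us, all (trail r) us -> size us <= count (fun x => src x == r) (flatten us).
    elim=> //= -[//|x t] us IH /andP[/andP[/andP[/= xr _] _] /IH]; rewrite count_cat /= xr; lia.
  move=> c1; have := le ts tts; rewrite c1.
  by case: (ts) c1 => [|t [|t' us]] //= _ _; exists t.
have routen v : v \in route t -> v < n.
  move=> /flattenP[s /mapP[x xF ->]]; have xF' : x \in flatten ts by rewrite Et /= cats0.
  rewrite mem_rcons inE => /orP[/eqP->|]; first exact: tgtn.
  rewrite /items; case: ifP => // _; rewrite inE => /eqP->.
  by case/and5P: (allP oF x xF').
have Er : real_route (flatten ts) = route t.
  rewrite Et /= cats0; apply/all_filterP/allP => v /routen vn.
  by rewrite neq_ltn vn.
have ft : flatten ts = t by rewrite Et /= cats0.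
exists (route t); split.
- by rewrite -Er; apply: uniq_real_route cE pE tts.
- have wt : walk r t r by move: tts; rewrite Et /= andbT; case: (t) => // x t' /andP[].
  have [pt lt] : path eX r (route t) /\ last r (route t) = r.
    by apply: path_route => //; rewrite -ft.
  rewrite (cycle_path r) lt.
  have sub : {in [pred v | v < n] &, subrel eX eN}.
    by move=> a b; rewrite !inE /eX => an bn; rewrite (ltn_eqF an) (ltn_eqF bn).
  apply: (sub_in_path sub) pt => /=; rewrite rn; apply/allP => v vr.
  exact: routen.
- by apply/allP => v /routen.
have := size_F cE pE tts; rewrite ft (_ : count _ t = 0) ?addn0; last first.
  apply/eqP; rewrite -leqn0 leqNgt -has_count; apply/hasPn => x xt.
  by rewrite -ft in xt; rewrite neq_ltn tgtn.
rewrite -(F_tau pE) ft mul2n -addnn => <-.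
rewrite -count_predT count_route /= count_predT -addnA; congr (_ + _).
rewrite /tau; elim: (t) => //= x t' <-; rewrite {1}/stat S00.
by case: (_ == _) => /=; rewrite ?mul0n; lia.
Qed.

Definition piece_ok (q : seq nat) :=
  if q is v :: q' then [&& path eN v q', ~~ W v & ~~ W (last v q')] else false.

Definition piece_ends (q : seq nat) := if q is v :: q' then S0 v + S0 (last v q') else 0.

Lemma walk_rcons_inv a t x b : walk a (rcons t x) b -> walk a t (src x) /\ tgt x = b.
Proof.
elim: t a => [|y t IH] a /=; first by case/andP=> /eqP-> /eqP->.
by case/andP=> -> /IH.
Qed.

Lemma walk_avoid v a t b : walk a t b -> all (fun x => src x != v) t -> b != v ->
  (a != v) && all (fun x => tgt x != v) t.
Proof.
elim: t a => [|x t IH] a /=; first by move=> /eqP-> _ ->.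
by case/andP=> /eqP<- /IH H /andP[-> /H{}H] /H.
Qed.

Lemma opt_virtual x : opt x -> (src x == n) || (tgt x == n) -> x.1.1 == x.1.2.
Proof.
case/and5P=> an bn _ _ /and3P[_ /andP[_ s1] /andP[_ s2]].
case: ifP s1 s2 => // _ /and4P[_ _ _ s1] /and4P[_ _ _ s2].
by case/orP: s1 => /eqP E1; case/orP: s2 => /eqP E2; case/orP => /eqP E3; lia.
Qed.

(** Every edge balances by itself: an edge inside W adds 1 to the size and 1 to [tau], a vertex of
    S0 adds 1 + 1 on the left and 2 to [tau], and any other vertex outside W adds 1 to the size and
    1 on the right. *)
Lemma route_count t : all opt t -> all (fun x => (src x != n) && (tgt x != n)) t ->
  count S0 (route t) + size t = count (fun v => ~~ W v && ~~ S0 v) (route t) + tau t.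
Proof.
rewrite !count_route /tau; elim: t => //= x t IH /andP[ox /IH{}IH] /andP[/andP[s1 t1] /IH{}IH].
have /andP[_ Wt] := opt_W ox.
have /andP[sn tn] := opt_le ox.
have -> : S0 (tgt x) = false by apply: contraTF Wt; apply: S0_W.
rewrite Wt /= {1}/stat; have := opt_nW ox.
case: eqP => [_ /(_ isT) ->|_ _] /=; last by lia.
have -> : src x < n by rewrite ltn_neqAle s1.
have -> : tgt x < n by rewrite ltn_neqAle t1.
by case: (S0 x.1.1) => /=; lia.
Qed.

Lemma route_real t : all (fun x => tgt x != n) t -> all opt t -> real_route t = route t.
Proof.
move=> tt ot; apply/all_filterP/allP => v /flattenP[s /mapP[x xt ->]].
rewrite mem_rcons inE => /orP[/eqP->|]; first exact: (allP tt).
rewrite /items; case: ifP => // _; rewrite inE => /eqP->.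
by rewrite neq_ltn; case/and5P: (allP ot x xt) => ->.
Qed.

(** The first and the last edge have one virtual end each, so a vertex of S0 standing there adds
    only 1 to [tau]; [piece_ends] makes up for the difference from [route_count]. *)
Lemma trail_piece t : W n -> all opt t -> trail n t ->
  piece_ok (real_route t) /\
  count S0 (real_route t) + size t =
    count (fun v => ~~ W v && ~~ S0 v) (real_route t) + tau t + piece_ends (real_route t).
Proof.
move=> Wn ot tt.
have [pt _] : path eX n (route t) /\ last n (route t) = n.
  by apply: path_route => //; case: t tt ot => // x t /andP[].
case: t tt ot pt => // x t /andP[/= /andP[/eqP xn wt] st] /andP[ox ot].
case: (lastP t) wt st ot => [|t' y].
  by move=> /eqP tx; case/and5P: ox => _ _ _ _ /and3P[]; rewrite xn tx eqxx.
case/walk_rcons_inv => wt yn; rewrite !all_rcons => /andP[sy st] /andP[oy ot] pt.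
have /andP[tx tt] := walk_avoid wt st sy.
have ix : x.1.1 == x.1.2 by apply: (opt_virtual ox); rewrite xn eqxx.
have iy : y.1.1 == y.1.2 by apply: (opt_virtual oy); rewrite yn eqxx orbT.
have xl : x.1.1 < n by case/and5P: ox.
have yl : y.1.1 < n by case/and5P: oy.
have Er : route (x :: rcons t' y) = [:: x.1.1, tgt x & route t' ++ [:: y.1.1; n]].
  rewrite -cats1 -cat1s !route_cat /route /= cats0 /items ix iy /= yn; reflexivity.
have Rt := route_real tt ot.
have Err : real_route (x :: rcons t' y) = [:: x.1.1, tgt x & route t' ++ [:: y.1.1]].
  rewrite /real_route Er /= tx neq_ltn xl /= filter_cat -/(real_route t') Rt /=.
  by rewrite eqxx neq_ltn yl.
have c := route_count ot _.
split.
  rewrite Err /=; have /negbTE Wx := opt_nW ox ix; have /negbTE Wy := opt_nW oy iy.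
  rewrite Wx last_cat /= Wy !andbT.
  have sub : {in [pred v | v < n] &, subrel eX eN}.
    by move=> a b; rewrite !inE /eX => an bn; rewrite (ltn_eqF an) (ltn_eqF bn).
  have le v : v \in route (x :: rcons t' y) -> v <= n.
    move=> /flattenP[s /mapP[z zt ->]].
    have oz : opt z by move: zt; rewrite inE mem_rcons inE => /or3P[/eqP->|/eqP->|/(allP ot)].
    rewrite mem_rcons inE => /orP[/eqP->|]; first by case/andP: (opt_le oz).
    by rewrite /items; case: ifP => // _; rewrite inE => /eqP->; case/and5P: oz => /ltnW.
  have : path eX x.1.1 (tgt x :: route t' ++ [:: y.1.1]).
    move: pt; rewrite Er /= => /and3P[_ -> pt].
    by move: pt; rewrite -(cat1s y.1.1) catA cat_path => /andP[].
  apply: (sub_in_path sub); apply/allP => v vr.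
  have : v \in real_route (x :: rcons t' y) by rewrite Err.
  by rewrite mem_filter inE => /andP[vn /le]; rewrite ltn_neqAle vn.
have Wtx : W (tgt x) by case/andP: (opt_W ox).
have S0tx : S0 (tgt x) = false by apply: contraTF Wtx; apply: S0_W.
have : count S0 (route t') + size t' =
    count (fun v => ~~ W v && ~~ S0 v) (route t') + tau t'.
  apply: c; apply/allP => z zt; by rewrite (allP st) // (allP tt).
have txn : tgt x < n by rewrite ltn_neqAle tx; case/andP: (opt_le ox).
have syn : src y < n by rewrite ltn_neqAle sy; case/andP: (opt_le oy).
rewrite Err /= !count_cat /= last_cat /= S0tx Wtx (opt_nW ox ix) (opt_nW oy iy) /=.
rewrite /tau /= -cats1 map_cat sumn_cat /= size_cat /=.
rewrite {2}/stat ix xn ltnn txn {3}/stat iy yn ltnn syn.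
move: (S0 _) (S0 _) (count _ _) (count _ _) (sumn _) (size _).
by clear; case; case => /=; lia.
Qed.

(** Removing the virtual vertex turns each trail into a path with both ends outside W. A trail has
    at least two edges, while all trails together have [cnt E] edges plus one per trail; hence there
    are at most [cnt E] trails. *)
Lemma config_pieces E : W n -> config n E ->
  exists ps, [/\ all piece_ok ps, uniq (flatten ps) /\ all (fun v => v < n) (flatten ps),
    forall w, w < n -> W w -> (w \in flatten ps) = (deg E w == 2),
    count S0 (flatten ps) + cnt E + size ps =
      count (fun v => ~~ W v && ~~ S0 v) (flatten ps) + tau E + sumn (map piece_ends ps)
    & size (flatten ps) <= 2 * cnt E + size ps /\ size ps <= cnt E].
Proof.
move=> Wn cE.
have [|ts pE tts] := config_trails cE; first by rewrite ltnn eqxx Wn.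
have oF := F_opt cE pE.
have otts : all (all opt) ts 
  by move: oF; elim: (ts) => //= t us IH; rewrite all_cat => /andP[-> /IH].
have Eps : flatten (map real_route ts) = real_route (flatten ts).
  by elim: (ts) => //= t us IH; rewrite /real_route route_cat filter_cat IH.
have sizeF := size_F cE pE tts.
have ntgt : count (fun x => tgt x == n) (flatten ts) = size ts.
  rewrite -(F_src_tgt tts); elim: (ts) tts => //= -[//|x t] us IH /andP[/andP[/= /andP[xn _] st] /IH].
  rewrite count_cat /= xn => ->.
  by rewrite (_ : count _ t = 0) // -[RHS](count_pred0 t); apply: eq_in_count => y /(allP st) /negbTE.
exists (map real_route ts); rewrite Eps size_map; split.
- rewrite all_map; apply/allP => t tin.
  by case: (trail_piece Wn (allP otts t tin) (allP tts t tin)).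
- split; first exact: (uniq_real_route cE pE tts).
  apply/allP => v; rewrite mem_filter => /andP[vn /(route_le cE pE)].
  by rewrite ltn_neqAle vn.
- by move=> w wn Ww; apply: (mem_real_route cE pE tts).
- rewrite -addnA -ntgt -sizeF -(F_tau pE) -Eps.
  elim: (ts) tts otts => //= t us IH /andP[tt /IH{}IH] /andP[ot /IH{}IH].
  have [_] := trail_piece Wn ot tt; move: IH.
  rewrite !count_cat size_cat /tau map_cat sumn_cat; lia.
have two : 2 * size ts <= size (flatten ts).
  elim: (ts) tts otts => //= -[//|x [|y t]] us IH /andP[tt /IH{}IH] /andP[/= /andP[ox _] /IH{}IH].
    move: tt ox => /= /andP[/andP[/eqP xn /eqP tx] _] /and5P[_ _ _ _ /and3P[]].
    by rewrite xn tx eqxx.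
  by move: IH; rewrite /= size_cat; lia.
split; last by lia.
rewrite size_filter count_route.
have -> : count (fun x => tgt x != n) (flatten ts) = cnt E.
  have := count_predC (fun x => tgt x == n) (flatten ts).
  by rewrite sizeF addnC => /addIn.
apply: leq_trans (leq_add (leqnn _) (count_size _ _)) _.
by rewrite sizeF ntgt; lia.
Qed.

End Configurations.

Lemma tau_le n (S0 : pred nat) E : tau n S0 E <= 2 * size E.
Proof.
rewrite /tau; elim: E => //= y s IHs; rewrite mulnS leq_add //.
by rewrite /stat; case: ifP => // _; case: (S0 _); do 2!case: (_ < n).
Qed.

(** * From cycles to configurations *)

Section CycleConfig.
Variables (n : nat) (eN : rel nat) (W S0 : pred nat).
Hypothesis eN_sym : symmetric eN.
Hypothesis eN_irr : irreflexive eN.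
Hypothesis S0_W : forall a, S0 a -> ~~ W a.
Hypothesis indep : forall a b, eN a b -> ~~ W a -> ~~ S0 a -> ~~ W b -> S0 b.

Variables (r : nat) (c : seq nat).
Hypothesis c_cycle : ucycle eN c.
Hypothesis c_size : 2 < size c.
Hypothesis c_lt : all (fun a => a < n) c.
Hypothesis anchor :
  [/\ r = n, W n & exists2 y, y \in c & ~~ W y && ~~ W (next c y)]
  \/ [/\ W r, r \in c & forall a, S0 a = false].

Let cyc : cycle eN c. Proof. by case/andP: c_cycle. Qed.
Let un : uniq c. Proof. by case/andP: c_cycle. Qed.
Let I0 a := ~~ W a && ~~ S0 a.

Lemma perm_next : perm_eq (map (next c) c) c.
Proof.
apply: uniq_perm => //.
  by rewrite map_inj_uniq //; apply: can_inj (prev_next un).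
move=> a; apply/mapP/idP => [[b bc ->]|ac]; first by rewrite mem_next.
by exists (prev c a); rewrite ?mem_prev // next_prev.
Qed.

Lemma count_next p : count (fun a => p (next c a)) c = count p c.
Proof. by rewrite -(permP perm_next p) count_map. Qed.

Lemma count_prev p : count (fun a => p (prev c a)) c = count p c.
Proof. by rewrite -count_next; apply: eq_count => a /=; rewrite prev_next. Qed.

Lemma next_neq_prev a : a \in c -> next c a != prev c a.
Proof.
move=> ac; case: (rot_to ac) => i t E.
rewrite -(next_rot i un) -(prev_rot i un) E.
have := un; rewrite -(rot_uniq i) E.
have : 2 < size (a :: t) by rewrite -E size_rot.
case: t E => [|b [|d t]] //= E _; rewrite !inE /prev /= eqxx.
have aux (s : seq nat) x y : x \notin s -> prev_at x x y s = last y s.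
  elim: s y => //= [|z s IH] y; first by rewrite eqxx.
  by rewrite inE negb_or => /andP[/negbTE-> /IH].
rewrite !negb_or => /and3P[/and3P[/negbTE ab /negbTE ad aT] /andP[bd bT] _].
rewrite ab ad aux //; apply/eqP => E2.
by have := mem_last d t; rewrite -E2 inE (negbTE bd) (negbTE bT).
Qed.

Lemma next_neq a : a \in c -> next c a != a.
Proof. by move=> ac; apply: contraTneq (next_cycle cyc ac) => ->; rewrite eN_irr. Qed.

(** The trace of the cycle on W: everything outside W that precedes or follows a recorded vertex is
    merged into the virtual vertex [n]. *)
Let lab u := if W u then u else n.

Let item a := ~~ W a && (W (prev c a) || W (next c a)).
Let Eitem := [seq ((a, a), (lab (prev c a), lab (next c a))) | a <- c & item a].
Let Eedge := [seq ((a, next c a), (a, next c a)) | a <- c & W a && W (next c a)].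
Let E : seq edge := Eitem ++ Eedge.

Lemma c_n a : a \in c -> a < n.
Proof. exact: (allP c_lt). Qed.

Lemma EP x : x \in E ->
  (exists a, [/\ a \in c, item a & x = ((a, a), (lab (prev c a), lab (next c a)))]) \/
  (exists a, [/\ a \in c, W a && W (next c a) & x = ((a, next c a), (a, next c a))]).
Proof.
rewrite mem_cat => /orP[]/mapP[a]; rewrite mem_filter => /andP[h ac] ->; [left|right];
  by exists a.
Qed.

Lemma link_lab a b : a \in c -> b \in c -> ~~ W a -> eN a b -> link n eN W a a (lab b).
Proof.
move=> ac bc Wa ab; rewrite /link /lab eqxx Wa /=.
have [Wb|Wb] := boolP (W b); first by rewrite Wb ab orbT.
rewrite eqxx /= andbT; case: anchor => [[_ -> _] //|[_ _ S00]].
by have := indep ab Wa; rewrite !S00 Wb => /(_ isT isT).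
Qed.

Lemma E_opt : all (opt n eN W) E.
Proof.
apply/allP => x /EP[][a [ac h ->]]; rewrite /opt /src /tgt /=.
  have pc : prev c a \in c by rewrite mem_prev.
  have nc : next c a \in c by rewrite mem_next.
  case/andP: (h) => Wa Wpn.
  have le b : b \in c -> lab b <= n.
    by move=> bc; rewrite /lab; case: ifP => // _; apply/ltnW/c_n.
  rewrite c_n //= !le //=; apply/and3P; split.
  - rewrite /lab; case: ifP Wpn => Wp; case: ifP => Wn //= _.
    + by rewrite eq_sym next_neq_prev.
    + by rewrite ltn_eqF ?c_n.
    + by rewrite eq_sym ltn_eqF ?c_n.
  - by apply: link_lab => //; rewrite eN_sym; apply: prev_cycle.
  - by apply: link_lab => //; apply: next_cycle.
case/andP: h => Wa Wn; have nc : next c a \in c by rewrite mem_next.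
rewrite /link !c_n //= !(ltnW (c_n _)) //= [a == _]eq_sym (negbTE (next_neq ac)) Wa Wn /=.
by rewrite next_cycle // !eqxx.
Qed.

Lemma E_fst : uniq (map fst E).
Proof.
rewrite map_cat -!map_comp cat_uniq; apply/and3P; split.
- by rewrite map_inj_uniq ?filter_uniq // => a b [].
- apply/hasPn => p /mapP[a]; rewrite mem_filter => /andP[_ ac] -> /=.
  apply/negP => /mapP[b _ [Eab Enb]].
  by have := next_neq ac; rewrite Enb Eab eqxx.
by rewrite map_inj_uniq ?filter_uniq // => a b [].
Qed.

Lemma count1 (p : pred nat) u : count (fun a => (a == u) && p a) c = (u \in c) && p u.
Proof.
rewrite (eq_count (a2 := fun a => (a == u) && p u)); last by move=> a; case: eqP => // ->.
case: (p u); last by rewrite andbF (eq_count (a2 := pred0)) ?count_pred0 // => a; rewrite andbF.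
by rewrite andbT (eq_count (a2 := pred1 u)) ?count_uniq_mem // => a; rewrite andbT.
Qed.

(** A vertex of W on the cycle gets one edge towards each cycle neighbour, from [Eedge] if that
    neighbour is in W and from [Eitem] otherwise. *)
Lemma deg_E u : u < n -> W u -> deg E u = 2 * (u \in c).
Proof.
move=> ulen Wu; rewrite deg_cat /deg !count_map !count_filter.
have labE b : (lab b == u) = (b == u).
  rewrite /lab; case: ifP => // Wb; rewrite eq_sym ltn_eqF //.
  by apply/esym; apply: contraFF Wb => /eqP->.
have -> : count (predI (preim (fun a : nat => ((a, a), (lab (prev c a), lab (next c a))) : edge)
    (fun x => src x == u)) item) c = (u \in c) && ~~ W (next c u).
  rewrite -(count1 (fun b => ~~ W (next c b))) -[RHS]count_prev; apply: eq_in_count => a ac /=.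
  rewrite /src /= labE next_prev //; case: eqP => //= Ea.
  by rewrite /item Ea Wu /= andbT.
have -> : count (predI (preim (fun a : nat => ((a, a), (lab (prev c a), lab (next c a))) : edge)
    (fun x => tgt x == u)) item) c = (u \in c) && ~~ W (prev c u).
  rewrite -(count1 (fun b => ~~ W (prev c b))) -[RHS]count_next; apply: eq_in_count => a ac /=.
  rewrite /tgt /= labE prev_next //; case: eqP => //= Ea.
  by rewrite /item Ea Wu /= orbT andbT.
have -> : count (predI (preim (fun a : nat => ((a, next c a), (a, next c a)) : edge)
    (fun x => src x == u)) (fun a => W a && W (next c a))) c = (u \in c) && W (next c u).
  rewrite -(count1 (fun b => W (next c b))); apply: eq_in_count => a ac /=.
  by rewrite /src /=; case: eqP => //= ->; rewrite Wu.
have -> : count (predI (preim (fun a : nat => ((a, next c a), (a, next c a)) : edge)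
    (fun x => tgt x == u)) (fun a => W a && W (next c a))) c = (u \in c) && W (prev c u).
  rewrite -(count1 (fun b => W (prev c b))) -[RHS]count_next; apply: eq_in_count => a ac /=.
  by rewrite /tgt /= prev_next //; case: eqP => //= Ea; rewrite Ea Wu andbT.
by case: (u \in c); case: (W (next c u)); case: (W (prev c u)).
Qed.

Lemma cycle_all (P : nat -> Prop) u : u \in c -> P u ->
  (forall y, y \in c -> P y -> P (next c y)) -> forall y, y \in c -> P y.
Proof.
move=> uc Pu step y; case: (rot_to uc) => i t Et.
have : fcycle (next c) (u :: t) by rewrite -Et rot_cycle cycle_next.
rewrite -(mem_rot i) Et /= rcons_path => /andP[pt _].
elim: t (u) uc Pu pt {Et} => [|b t IH] a ac Pa /=; first by rewrite inE => _ /eqP->.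
case/andP=> /eqP nab pt; rewrite inE => /orP[/eqP->//|].
by apply: IH => //; rewrite -nab ?mem_next //; apply: step.
Qed.

Lemma E_connected : connected_to r E.
Proof.
move=> K cK Kr x xE; apply/negP => Kx.
have {x xE Kx} [u [uc Wu Ku]] : exists u, [/\ u \in c, W u & K u].
  have := cK x xE; rewrite Kx; case: (EP xE) => [[a [ac ia Ex]]|[a [ac ia Ex]]].
    move: Kx; rewrite Ex /src /tgt /= /lab.
    case: ifP => Wp Kp Kn; first by exists (prev c a); rewrite mem_prev.
    move: ia Kn; rewrite /item Wp /= => /andP[_ Wn]; rewrite Wn => Kn.
    by exists (next c a); rewrite mem_next.
  by exists a; case/andP: ia => Wa _; split=> //; move: Kx; rewrite Ex.
(* [P] spreads along the cycle; at a vertex outside W it says that the predecessor is in W and in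
   [K]. Passing two consecutive vertices outside W would put the virtual vertex, then the root, into
   [K]. So [P] would hold everywhere, but it fails at the place provided by [anchor]. *)
pose P y := if W y then K y : Prop else W (prev c y) && K (prev c y) : Prop.
have Pu : P u by rewrite /P Wu.
have lab_n y : y \in c -> ~~ W y -> ~~ W (next c y) -> r = n.
  move=> yc Wy Wn; case: anchor => [[]//|[_ _ S00]].
  by have := indep (next_cycle cyc yc) Wy; rewrite !S00 => /(_ isT Wn).
have stepP y : y \in c -> P y -> P (next c y).
  move=> yc; rewrite /P prev_next //; case: ifP => [Wy Ky|/negbT Wy /andP[Wp Kp]].
    case: ifP => [Wn|_]; last by rewrite Ky.
    rewrite -[K _]/(K (tgt ((y, next c y), (y, next c y)))) -cK //.
    rewrite mem_cat; apply/orP; right; apply/mapP; exists y => //.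
    by rewrite mem_filter Wy Wn.
  have Kl : K (lab (next c y)).
    rewrite -[lab _]/(tgt ((y, y), (lab (prev c y), lab (next c y)))) -cK.
      by rewrite /src /= /lab Wp.
    rewrite mem_cat; apply/orP; left; apply/mapP; exists y => //.
    by rewrite mem_filter /item Wy Wp.
  move: Kl; rewrite /lab; case: ifP => // Wn Kn.
  by rewrite -(lab_n y) // ?Wn // Kr in Kn.
have all_P := cycle_all uc Pu stepP.
case: anchor => [[Er Wn [y yc /andP[Wy Wny]]]|[Wr rc _]].
  have nyc : next c y \in c by rewrite mem_next.
  by have := all_P _ nyc; rewrite /P (negbTE Wny) prev_next // (negbTE Wy).
by have := all_P _ rc; rewrite /P Wr Kr.
Qed.

Lemma cnt_E : cnt n W E = count W c.
Proof.
rewrite /cnt -!size_filter; apply/eqP; rewrite eqn_leq; apply/andP; split; apply: uniq_leq_size.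
- exact: filter_uniq (iota_uniq _ _).
- move=> u; rewrite !mem_filter mem_iota => /andP[/andP[Wu +] /andP[_ un']].
  by rewrite deg_E // Wu; case: (u \in c).
- exact: filter_uniq.
move=> u; rewrite !mem_filter mem_iota => /andP[Wu uc]; rewrite Wu /= c_n //= andbT.
by rewrite deg_E ?uc // c_n.
Qed.

Let N (p q : pred nat) := count (fun a => p a && q (next c a)) c.

Lemma count_part (p : pred nat) (g : nat -> nat) s :
  count p s = count (fun a => p a && W (g a)) s + count (fun a => p a && S0 (g a)) s
    + count (fun a => p a && I0 (g a)) s.
Proof.
elim: s => //= a s ->; have := @S0_W (g a); rewrite /I0.
by case: (p a); case: (W _); case: (S0 _) => //= h; try (by have := h isT); gen_lia.
Qed.

Lemma count_split (p : pred nat) : count p c = N p W + N p S0 + N p I0.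
Proof. exact: count_part. Qed.

Lemma count_split_next (p : pred nat) : count p c = N W p + N S0 p + N I0 p.
Proof.
rewrite -count_next (count_part _ id).
by congr (_ + _ + _); apply: eq_count => a; rewrite andbC.
Qed.

Lemma sum_ends (f g : nat -> nat) s :
  count (fun a => W (f a) && S0 a) s + count (fun a => S0 a && W (g a)) s =
  sumn [seq S0 a * (W (f a) + W (g a)) | a <- s].
Proof.
by elim: s => //= a s <-; case: (S0 a); case: (W (f a)); case: (W (g a)) => /=; gen_lia.
Qed.

Lemma sum_items s : {subset s <= c} ->
  sumn [seq stat n S0 ((a, a), (lab (prev c a), lab (next c a))) | a <- s & item a] =
  sumn [seq S0 a * (W (prev c a) + W (next c a)) | a <- s].
Proof.
elim: s => //= a s IH sub.
have ac : a \in c by apply: sub; rewrite mem_head.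
have {}IH := IH (fun b bs => sub b (mem_behead (bs : b \in behead (a :: s)))).
have labn b : b \in c -> (lab b < n) = W b.
  by move=> bc; rewrite /lab; case: ifP => Wb; rewrite ?ltnn // c_n.
have pc : prev c a \in c by rewrite mem_prev.
have nc : next c a \in c by rewrite mem_next.
case: ifP => [ia|] /=; rewrite IH //.
  by rewrite /stat /= /src /tgt /= eqxx !labn.
rewrite /item; have := @S0_W a.
case: (S0 a); case: (W a) => //= h; first by have := h isT.
by case: (W (prev c a)); case: (W _).
Qed.

Lemma tau_E : tau n S0 E = N W S0 + N S0 W + N W W.
Proof.
rewrite /tau map_cat sumn_cat; congr (_ + _).
  rewrite -map_comp (sum_items (s := c)) // -sum_ends; congr (_ + _).
  by rewrite -count_next; apply: eq_in_count => a ac /=; rewrite prev_next.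
rewrite -map_comp /N -size_filter.
have : all (fun a => W a && W (next c a)) [seq a <- c | W a && W (next c a)] by apply: filter_all.
have sub : {subset [seq a <- c | W a && W (next c a)] <= c} by move=> a; rewrite mem_filter => /andP[].
elim: [seq a <- c | _] sub => //= a s IH sub /andP[_ /IH ->].
  have ac : a \in c by apply: sub; rewrite mem_head.
  by rewrite /stat /= [a == _]eq_sym (negbTE (next_neq ac)).
by move=> b bs; apply: sub; rewrite inE bs orbT.
Qed.

(** Every edge of the cycle meets W or S0, and those with both ends there are the [tau] edges and
    the [N S0 S0] edges. Counting edge ends, twice the number of cycle vertices in W and S0 is the
    length plus these edges. *)
Lemma cycle_config :
  exists F, [/\ config n eN W r F,
    forall u, u < n -> W u -> deg F u = 2 * (u \in c),
    count S0 c + cnt n W F = count I0 c + tau n S0 F + N S0 S0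
    & size c = cnt n W F + count S0 c + count I0 c].
Proof.
exists E; split.
- split; [exact: E_fst | exact: E_opt | | exact: E_connected].
  by move=> u ulen Wu; rewrite deg_E //; case: (u \in c); [right | left].
- exact: deg_E.
- have II : N I0 I0 = 0.
    apply/eqP; rewrite -leqn0 leqNgt -has_count; apply/hasPn => a ac.
    apply/negP => /andP[/andP[Wa Sa] /andP[Wn]].
    by rewrite (indep (next_cycle cyc ac) Wa Sa Wn).
  rewrite cnt_E tau_E.
  have := count_split S0; have := count_split_next S0.
  have := count_split I0; have := count_split_next I0.
  have := count_split W; have := count_split_next W.
  rewrite II; lia.
by rewrite cnt_E -count_predT (count_part _ id).
Qed.

End CycleConfig.

(** * Cut vectors *)

Section Digits.
Variables (W : pred nat) (b : nat).
Hypothesis b_gt0 : 0 < b.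

(* The digit of u in base b, digits being stored for the elements of W only. *)
Definition wt u := b ^ count W (iota 0 u).
Definition dig z u := (z %/ wt u) %% b.
Definition enc (d : nat -> nat) m := \sum_(0 <= u < m | W u) d u * wt u.

Lemma wtS u : wt u.+1 = wt u * (if W u then b else 1).
Proof.
rewrite /wt -addn1 iotaD count_cat /= addn0 expnD add0n.
by case: (W u); rewrite ?expn0 ?expn1.
Qed.

Lemma wt_gt0 u : 0 < wt u.
Proof. by rewrite expn_gt0 b_gt0. Qed.

Lemma encS d m : enc d m.+1 = enc d m + (if W m then d m * wt m else 0).
Proof.
rewrite /enc big_mkcond big_nat_recr //= -big_mkcond /=.
by case: ifP.
Qed.

Lemma wt_dvd u m : u < m -> W u -> b * wt u %| wt m.
Proof.
move=> um Wu; elim: m um => // m IH; rewrite ltnS leq_eqVlt => /orP[/eqP<-|/IH{}IH].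
  by rewrite wtS Wu mulnC.
by rewrite wtS dvdn_mulr.
Qed.

Lemma dig_add z q u m : u < m -> W u -> dig (z + q * wt m) u = dig z u.
Proof.
move=> um Wu; rewrite /dig; case/dvdnP: (wt_dvd um Wu) => k ->.
have -> : q * (k * (b * wt u)) = (q * k * b) * wt u by rewrite !mulnA.
by rewrite addnC divnMDl ?wt_gt0 // modnMDl.
Qed.

Lemma enc_lt d m : (forall u, u < m -> W u -> d u < b) -> enc d m < wt m.
Proof.
elim: m => [|m IH] dlt; first by rewrite /enc big_geq // wt_gt0.
have {}IH : enc d m < wt m by apply: IH => u um; apply: dlt; apply: ltnW.
rewrite encS wtS; case: ifP => Wm; last by rewrite addn0 muln1.
have := dlt m (leqnn _) Wm; nia.
Qed.

Lemma dig_enc d m u : (forall u, u < m -> W u -> d u < b) -> u < m -> W u ->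
  dig (enc d m) u = d u.
Proof.
elim: m => // m IH dlt; rewrite ltnS leq_eqVlt => /orP[/eqP->|um] Wu.
  rewrite encS Wu /dig addnC divnMDl ?wt_gt0 // divn_small ?addn0 ?modn_small //.
    exact: dlt.
  by apply: enc_lt => v vm; apply: dlt; apply: ltnW.
rewrite encS; case: ifP => _; last rewrite addn0; rewrite ?dig_add //; apply: IH => // v vm;
  by apply: dlt; apply: ltnW.
Qed.

Lemma enc_dig z m : z < wt m -> enc (dig z) m = z.
Proof.
elim: m z => [|m IH] z; first by rewrite /wt /= expn0 /enc big_geq //; case: z.
rewrite encS wtS => zlt.
have Ez : z = z %% wt m + (z %/ wt m) * wt m by rewrite addnC -divn_eq.
have -> : enc (dig z) m = enc (dig (z %% wt m)) m.
  rewrite /enc [LHS]big_nat_cond [RHS]big_nat_cond; apply: eq_bigr => u /andP[/andP[_ um] Wu].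
  by have := dig_add (z %% wt m) (z %/ wt m) um Wu; rewrite -Ez => ->.
rewrite IH ?ltn_mod ?wt_gt0 //; case: ifP zlt => Wm zlt.
  by rewrite /dig (@modn_small (z %/ _)) -?Ez // ltn_divLR ?wt_gt0 // mulnC.
by rewrite addn0 modn_small //; rewrite muln1 in zlt.
Qed.

Lemma encD d d' m : enc (fun u => d u + d' u) m = enc d m + enc d' m.
Proof. by rewrite /enc -big_split; apply: eq_bigr => u _; rewrite mulnDl. Qed.

Lemma enc1 v m : enc (fun u => v == u : nat) m = if W v && (v < m) then wt v else 0.
Proof.
elim: m => [|m IH]; first by rewrite /enc big_geq // andbF.
rewrite encS IH ltnS; case: (ltngtP v m) => [vm|vm|->].
- by rewrite mul0n if_same addn0.
- by rewrite mul0n if_same addn0.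
by rewrite andbF andbT add0n mul1n.
Qed.

End Digits.

Section Parity.
Variable M : nat.

(** The value at [v], over GF(2), of the linear functional that adds up the entries selected by
    [phi]. *)
Definition par (phi v : pred nat) := odd (count (fun z => phi z && v z) (iota 0 M)).

Lemma par_xor phi v w : par phi (fun z => v z (+) w z) = par phi v (+) par phi w.
Proof.
rewrite /par; elim: (iota 0 M) => //= z s IH; rewrite !oddD IH.
case: (phi z); case: (v z); case: (w z) => //=;
  by case: (odd _); case: (odd _).
Qed.

Lemma par_mask phi v m : par phi (fun z => v z && m z) = par (fun z => phi z && m z) v.
Proof.
by congr odd; apply: eq_count => z; case: (phi z); case: (v z); case: (m z).
Qed.

Lemma eq_par phi v w : (forall z, z < M -> v z = w z) -> par phi v = par phi w.
Proof.
move=> vw; congr odd; apply: eq_in_count => z.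
by rewrite mem_iota => /andP[_ zM]; rewrite vw.
Qed.

Lemma par0 phi v : (forall z, z < M -> v z = false) -> par phi v = false.
Proof.
move=> v0; rewrite (@eq_par phi v pred0) // /par.
by rewrite (eq_count (a2 := pred0)) ?count_pred0 // => z; rewrite andbF.
Qed.

Lemma eq_parl phi phi' v : (forall z, z < M -> phi z = phi' z) -> par phi v = par phi' v.
Proof.
move=> pp; congr odd; apply: eq_in_count => z.
by rewrite mem_iota => /andP[_ zM]; rewrite pp.
Qed.

End Parity.

(** * The dynamic program as a recursion, and connectivity by parity *)

Section Spec.
Variables (n : nat) (eN : rel nat) (W S0 : pred nat) (r TB : nat).

Let M2 := wt W 2 n.
Let M4 := wt W 4 n.
Definition table_size := TB * M4.
Let opt := opt n eN W.
Let stat := stat n S0.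

Definition bit z u := [&& W u, u < n & odd (z %/ wt W 2 u)].
Definition dgt s u := if W u && (u < n) then dig W 4 s u else 0.
Definition ad u := if W u && (u < n) then wt W 4 u else 0.
(** A state stores the degrees as digits in base 4 and [tau] above them. Degrees stay at most 2, so
    inserting an edge is an addition without carries. *)
Definition delta x := ad (src x) + ad (tgt x) + stat x * M4.

(** Only cuts that avoid the root are kept. The bit of the virtual vertex is always 0, so a virtual
    root lies outside every cut. *)
Definition init_vec z := ~~ bit z r.
Definition agree (x : edge) z := bit z (src x) == bit z (tgt x).

(* The span of the cut vectors is described by linear functionals: phi stands
   for the sum of the entries at the cuts z with phi z. *)
Fixpoint reach (gs : seq (nat * nat)) (s : nat) (phi : pred nat) : Prop :=
  if gs is g :: gs' then
    reach gs' s phi \/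
    exists s0 u w, [/\ [&& s0 < table_size, opt (g, (u, w)), dgt s0 u < 2 & dgt s0 w < 2],
      s = s0 + delta (g, (u, w)) & reach gs' s0 (fun z => phi z && agree (g, (u, w)) z)]
  else s = 0 /\ par M2 phi init_vec.

Definition code E := sumn (map delta E).
Definition vec E z := init_vec z && all (fun x => agree x z) E.

Lemma codeE E : code E = enc W 4 (deg E) n + tau n S0 E * M4.
Proof.
elim: E => [|x E IH].
  rewrite /code /tau mul0n addn0 /=; elim: n => [|m IHm]; first by rewrite /enc big_geq.
  by rewrite encS -IHm; case: ifP.
rewrite /code /= -/(code E) IH /tau /= mulnDl -/(tau n S0 E).
have -> : enc W 4 (deg (x :: E)) n = enc W 4 (deg E) n + (ad (src x) + ad (tgt x)).
  rewrite /ad -!enc1 -!encD; apply: eq_bigr => u _; rewrite /deg /=; lia.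
rewrite /delta /stat; lia.
Qed.

Lemma deg_code E u : (forall u, u < n -> W u -> deg E u < 4) -> dgt (code E) u =
  if W u && (u < n) then deg E u else 0.
Proof.
by move=> dlt; rewrite /dgt; case: ifP => // /andP[Wu un]; rewrite codeE dig_add // dig_enc.
Qed.

Hypothesis eN_sym : symmetric eN.

Lemma deg_cons x E u : deg (x :: E) u = (src x == u) + (tgt x == u) + deg E u.
Proof. by rewrite /deg /=; lia. Qed.

Ltac gen_deg := repeat match goal with |- context [deg ?E ?v] => move: (deg E v) => ? end;
  clear; lia.

Lemma code_perm E F : perm_eq E F -> code E = code F.
Proof. exact: perm_sum. Qed.

Lemma vec_perm E F : perm_eq E F -> vec E =1 vec F.
Proof. by move=> pEF z; rewrite /vec (perm_all _ pEF). Qed.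

Lemma deg_perm E F u : perm_eq E F -> deg E u = deg F u.
Proof. by move=> pEF; rewrite /deg !(permP pEF). Qed.

Lemma vec_cons x E z : vec (x :: E) z = vec E z && agree x z.
Proof. by rewrite /vec /= andbCA andbC. Qed.

Lemma par_vec_cons phi x E :
  par M2 phi (vec (x :: E)) = par M2 (fun z => phi z && agree x z) (vec E).
Proof. by rewrite -par_mask; apply: eq_par => z _; apply: vec_cons. Qed.

(** The requirement that both digits be below 2 keeps all degrees at most 2, so the state decodes to
    the true degrees. Each group is considered once, so none is used twice. *)
Lemma reach_config gs s phi : uniq gs -> reach gs s phi ->
  exists E, [/\ uniq (map fst E), {subset map fst E <= gs}, all opt E,
    forall u, u < n -> W u -> deg E u <= 2
    & s = code E /\ par M2 phi (vec E)].
Proof.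
elim: gs s phi => [|g gs IH] s phi /=.
  move=> _ [-> h]; exists [::]; split=> //; split=> //.
  by rewrite (@eq_par _ _ _ init_vec) // => z _; rewrite /vec andbT.
case/andP=> ggs ugs [/(IH _ _ ugs)[E [uE sE oE dE h]]|].
  by exists E; split=> // p /sE pgs; rewrite inE pgs orbT.
case=> s0 [u [w [/and4P[_ ouw du dw] Es /(IH _ _ ugs)[E [uE sE oE dE [Es0 h]]]]]].
exists ((g, (u, w)) :: E); split=> //=.
- by rewrite uE andbT; apply: contra ggs => /sE.
- move=> p; rewrite !inE => /orP[->//|/sE->]; exact: orbT.
- by rewrite ouw.
- move=> v vn Wv; have d4 v' : v' < n -> W v' -> deg E v' < 4.
    by move=> a b; apply: leq_ltn_trans (dE _ a b) _.
  have uw : u != w by case/and5P: ouw => _ _ _ _ /and3P[].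
  rewrite deg_cons /src /tgt /=; have := dE v vn Wv.
  move: du dw; rewrite Es0 !deg_code //.
  have [Euv|_] := eqVneq u v.
    rewrite Euv Wv vn /=; have /negbTE-> : w != v by rewrite eq_sym -Euv.
    by gen_deg.
  by have [->|_] := eqVneq w v; rewrite ?Wv ?vn /=; gen_deg.
split; first by rewrite Es Es0 /code /= addnC.
by rewrite par_vec_cons.
Qed.

(** The edge of the current group, if any, is taken off [E]. The remaining state is in the table
    because [tau] is at most twice the number of edges. *)
Lemma config_reach gs E phi :
  uniq (map fst E) -> {subset map fst E <= gs} -> all opt E ->
  (forall u, u < n -> W u -> deg E u <= 2) -> 2 * size gs < TB ->
  par M2 phi (vec E) -> reach gs (code E) phi.
Proof.
move=> + + + + szg; elim: gs E phi szg => [|g gs IH] E phi szg uE sE oE dE /=.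
  case: E sE {uE oE dE} => [|x E] sE; last by have := sE x.1 (mem_head _ _).
  by rewrite (@eq_par _ _ _ init_vec) // => z _; rewrite /vec andbT.
have szg' : 2 * size gs < TB by apply: leq_ltn_trans szg; rewrite leq_mul2l leqnSn.
have [/mapP[x xE gx]|gE] := boolP (g \in map fst E); last first.
  left; apply: IH => // p pE; have := sE p pE.
  by rewrite inE => /orP[/eqP Epg|//]; rewrite -Epg pE in gE.
have pE := perm_to_rem xE.
move: (perm_map fst pE) => /= pfE; rewrite (perm_uniq pfE) /= in uE.
case/andP: uE => xE' uE'.
rewrite (perm_all _ pE) /= in oE; case/andP: oE => ox oE'.
have dE' u : u < n -> W u -> (src x == u) + (tgt x == u) + deg (rem x E) u <= 2.
  by move=> un Wu; rewrite -deg_cons -(deg_perm _ pE); apply: dE.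
have sE' : {subset map fst (rem x E) <= gs}.
  move=> p pin; have /sE : p \in map fst E by rewrite (perm_mem pfE) in_cons pin orbT.
  by rewrite in_cons => /orP[/eqP Ep|//]; move: xE'; rewrite -gx -Ep pin.
have d4 v : v < n -> W v -> deg (rem x E) v < 4.
  by move=> vn Wv; have := dE' v vn Wv; lia.
rewrite (code_perm pE) (@eq_par _ _ _ (vec (x :: rem x E))); last first.
  by move=> z _; apply: vec_perm.
rewrite par_vec_cons.
move=> h; right; exists (code (rem x E)), (src x), (tgt x).
have Ex : (g, (src x, tgt x)) = x by rewrite gx /src /tgt; case: (x) => [? []].
rewrite Ex; split; [apply/and4P; split=> // | by rewrite /code /= addnC |
  by apply: IH => // u un Wu; apply: leq_trans (dE' u un Wu); apply: leq_addl].
- have szE : size (rem x E) <= size gs.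
    by rewrite -(size_map fst); apply: uniq_leq_size.
  rewrite codeE /table_size; have := enc_lt (b := 4) isT d4; rewrite -/M4.
  have := wt_gt0 W (isT : 0 < 4) n; rewrite -/M4 => M40 elt.
  have : (tau n S0 (rem x E)).+1 * M4 <= TB * M4 by rewrite leq_mul2r; apply/orP; right; apply: leq_trans szg'; rewrite ltnS; apply: leq_trans (tau_le _ _ _) _; rewrite leq_mul2l szE.
  by rewrite mulSn; lia.
- rewrite deg_code //; case: ifP => // /andP[Wu un].
  by have := dE' _ un Wu; rewrite eqxx; case: eqP => _; gen_deg.
rewrite deg_code //; case: ifP => // /andP[Wu un].
by have := dE' _ un Wu; rewrite eqxx; case: eqP => _; gen_deg.
Qed.

Definition uses_only E z := all (fun u => bit z u ==> (deg E u != 0)) (iota 0 n).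

Lemma bit_enc f u : bit (enc W 2 (fun v => nat_of_bool (f v)) n) u = [&& W u, u < n & f u].
Proof.
rewrite /bit; case: (boolP (W u)) => //= Wu; case: (ltnP u n) => //= un.
have := @dig_enc W 2 isT (fun v => nat_of_bool (f v)) n u _ un Wu.
rewrite /dig modn2 => E1; have /E1 : forall v, v < n -> W v -> f v < 2 by move=> v _ _; case: (f v).
by case: (odd _); case: (f u).
Qed.

Lemma enc_bit z : z < M2 -> enc W 2 (fun v => nat_of_bool (bit z v)) n = z.
Proof.
move=> zM; rewrite -[RHS](@enc_dig W 2 isT z n zM) /enc [LHS]big_nat_cond [RHS]big_nat_cond.
apply: eq_bigr => u /andP[/andP[_ un] Wu].
by rewrite /bit Wu un /= /dig modn2.
Qed.

Lemma bit_inj z z' : z < M2 -> z' < M2 -> bit z =1 bit z' -> z = z'.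
Proof.
move=> zM zM' zz; rewrite -(enc_bit zM) -(enc_bit zM').
by apply: eq_bigr => u _; rewrite zz.
Qed.

Lemma bit0 u : bit 0 u = false.
Proof. by rewrite /bit div0n !andbF. Qed.

Lemma M2_gt0 : 0 < M2.
Proof. exact: wt_gt0. Qed.

(* Shifting a cut by a component that misses r is a fixpoint-free involution;
   without such a component the empty cut is the only one left. *)
Lemma par_connected E : all opt E -> (W n -> r = n) ->
  reflect (connected_to r E) (par M2 (uses_only E) (vec E)).
Proof.
move=> oE Wn; pose good z := uses_only E z && vec E z.
apply: (iffP idP) => [odd_good K cK Kr x xE|conn]; last first.
  suff eq0 : {in iota 0 M2, good =1 pred1 0}.
    rewrite /par (eq_in_count eq0) count_uniq_mem ?iota_uniq //.
    by rewrite mem_iota /= add0n M2_gt0.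
  move=> z; rewrite mem_iota add0n => /andP[_ zM] /=.
  apply/idP/eqP => [/andP[/allP use /andP[zr /allP ag]]|->]; last first.
    rewrite /good /vec /init_vec bit0 /=; apply/andP; split.
      by apply/allP => u _; rewrite bit0.
    by apply/allP => y _; rewrite /agree !bit0.
  apply: bit_inj => //; first exact: M2_gt0.
  move=> u; rewrite bit0; apply/negP => zu.
  have un : u < n by case/and3P: zu.
  have := use u; rewrite mem_iota un zu /= => /(_ isT); rewrite -lt0n => /degP[y yE yu].
  have cz : {in E, forall x, bit z (src x) = bit z (tgt x)} by move=> w /ag /eqP.
  have := conn _ cz (negbTE zr) y yE => sy.
  by case/orP: yu => /eqP yu; move: zu; rewrite -yu ?sy // -cz // sy.
apply/negP => Kx; set u0 := src x in Kx.
have /andP[Wu0 _] := opt_W (allP oE x xE); have /andP[u0n _] := opt_le (allP oE x xE).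
have {u0n} u0n : u0 < n.
  rewrite ltn_neqAle u0n andbT; apply/eqP => Eu0.
  by move: Wu0 Kx; rewrite -/u0 Eu0 => /Wn <-; rewrite Kr.
(* The part of [K] that a cut can express, restricted to vertices of positive degree so that
   shifting by it preserves [uses_only]. It contains [u0], so the shift [fl] exchanges the good cuts
   with and without [u0]. *)
pose K' u := [&& K u, W u & (u < n) && (deg E u != 0)].
pose fl z := enc W 2 (fun u => nat_of_bool (bit z u (+) K' u)) n.
have fl_lt z : fl z < M2 by apply: enc_lt => // u _ _; case: (_ (+) _).
have bit_fl z u : bit (fl z) u = bit z u (+) K' u.
  rewrite bit_enc /K' /bit; case: (W u) => //=; last by rewrite andbF.
  by case: (u < n) => //=; rewrite andbF.
have flK z : z < M2 -> fl (fl z) = z.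
  by move=> zM; apply: bit_inj => // u; rewrite !bit_fl -addbA addbb addbF.
have K'E : {in E, forall y, K' (src y) = K' (tgt y)}.
  have K'K y u : y \in E -> (src y == u) || (tgt y == u) -> K' u = K u.
    move=> yE yu; rewrite /K'; have -> : deg E u != 0 by rewrite -lt0n; apply/degP; exists y.
    have [Wu ule] : W u /\ u <= n.
      have /andP[w1 w2] := opt_W (allP oE y yE); have /andP[l1 l2] := opt_le (allP oE y yE).
      by case/orP: yu => /eqP <-.
    rewrite Wu andbT /=; have [//|nu] := ltnP u n; first by rewrite andbT.
    have Eun : u = n by apply/eqP; rewrite eqn_leq ule.
    by rewrite andbF Eun; rewrite Eun in Wu; rewrite -(Wn Wu) Kr.
  move=> y yE; rewrite (K'K y) // ?eqxx // (K'K y (tgt y)) // ?eqxx ?orbT //; exact: cK.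
have K'r : K' r = false by rewrite /K' Kr.
have good_fl z : good z -> good (fl z).
  case/andP=> /allP use /andP[zr /allP ag]; apply/andP; split.
    apply/allP => u uin; rewrite bit_fl; apply/implyP.
    have := use u uin; case: (bit z u) => //=.
    by rewrite /K' => _ /and4P[].
  rewrite /vec {1}/init_vec bit_fl K'r addbF -/(init_vec z) zr /=; apply/allP => y yE.
  by rewrite /agree !bit_fl K'E // (eqP (ag y yE)).
pose A := [seq z <- iota 0 M2 | good z && bit z u0].
pose B := [seq z <- iota 0 M2 | good z && ~~ bit z u0].
have K'u0 : K' u0.
  by rewrite /K' Kx Wu0 u0n /= -lt0n; apply/degP; exists x; rewrite ?eqxx.
have leAB (p q : pred nat) : (forall z, z < M2 -> p z -> q (fl z)) ->
    size [seq z <- iota 0 M2 | p z] <= size [seq z <- iota 0 M2 | q z].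
  move=> pq; rewrite -(size_map fl); apply: uniq_leq_size.
    rewrite map_inj_in_uniq ?filter_uniq ?iota_uniq // => z z'.
    rewrite !mem_filter !mem_iota !add0n => /andP[_ /andP[_ zM]] /andP[_ /andP[_ zM']] E1.
    by rewrite -(flK z zM) E1 flK.
  move=> y /mapP[z]; rewrite mem_filter mem_iota add0n => /andP[pz /andP[_ zM]] ->.
  by rewrite mem_filter mem_iota add0n fl_lt pq.
have : size A = size B.
  apply/eqP; rewrite eqn_leq !leAB // => z _ /andP[gz bz]; rewrite good_fl // bit_fl K'u0.
    by rewrite (negbTE bz).
  by rewrite bz.
move: odd_good; rewrite /par -[count _ _]/(count good _).
have -> : count good (iota 0 M2) = size A + size B.
  rewrite !size_filter; elim: (iota 0 M2) => //= z s ->.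
  by case: (good z); case: (bit z u0) => /=; gen_lia.
by move=> + E1; rewrite E1 addnn odd_double.
Qed.

End Spec.

(* all_boot shadows the record field mem and the command Sub. *)
Import Pilot.Defs.

(** * A loop language and its compilation *)

(** [Times] multiplies by a variable only, so that it compiles to repeated addition with a bounded
    number of rounds. [Inp] reads the input word. *)
Inductive exp :=
| Cst (a : nat)
| Var (x : nat)
| Plus (e1 e2 : exp)
| Minus (e1 e2 : exp)
| Times (e : exp) (x : nat)
| Arr (a : nat) (e : exp)
| Inp (e : exp).

Inductive stm :=
| SSkip
| Asg (x : nat) (e : exp)
| Sto (a : nat) (e1 e2 : exp)
| SSeq (s1 s2 : stm)
| SIf (e : exp) (s1 s2 : stm)
| SFor (x y : nat) (s : stm).

Record store := Store { hv : nat -> nat; ha : nat -> nat -> nat }.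

Definition setv h x a := Store (upd (hv h) x a) (ha h).

Definition seta h a i b :=
  Store (hv h) (fun a' => if a' == a then upd (ha h a) i b else ha h a').

Section Semantics.
Variable inp : nat -> nat.

Fixpoint eval (h : store) (e : exp) : nat :=
  match e with
  | Cst a => a
  | Var x => hv h x
  | Plus e1 e2 => eval h e1 + eval h e2
  | Minus e1 e2 => eval h e1 - eval h e2
  | Times e x => eval h e * hv h x
  | Arr a e => ha h a (eval h e)
  | Inp e => inp (eval h e)
  end.

Fixpoint den (s : stm) (h : store) : store :=
  match s with
  | SSkip => h
  | Asg x e => setv h x (eval h e)
  | Sto a e1 e2 => seta h a (eval h e1) (eval h e2)
  | SSeq s1 s2 => den s2 (den s1 h)
  | SIf e s1 s2 => if eval h e != 0 then den s1 h else den s2 h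
  | SFor x y s => foldl (fun g i => den s (setv g x i)) h (iota 0 (hv h y))
  end.

End Semantics.

(* Variable 1 holds the size of the input. *)
Fixpoint ok_exp (bs : seq nat) (e : exp) : bool :=
  match e with
  | Cst _ | Var _ => true
  | Plus e1 e2 | Minus e1 e2 => ok_exp bs e1 && ok_exp bs e2
  | Times e x => (x \in bs) && ok_exp bs e
  | Arr a e => (a < 16) && ok_exp bs e
  | Inp e => ok_exp bs e
  end.

(** The variables in [bs] are never assigned, and they alone serve as loop bounds and multipliers;
    so a bound on their initial values bounds the running time. Arrays are numbered below 16 because
    they are interleaved with stride 16. *)
Fixpoint ok_stm (bs : seq nat) (s : stm) : bool :=
  match s with
  | SSkip => true
  | Asg x e => [&& x \notin bs, x != 1 & ok_exp bs e]
  | Sto a e1 e2 => [&& a < 16, ok_exp bs e1 & ok_exp bs e2]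
  | SSeq s1 s2 => ok_stm bs s1 && ok_stm bs s2
  | SIf e s1 s2 => [&& ok_exp bs e, ok_stm bs s1 & ok_stm bs s2]
  | SFor x y s => [&& x \notin bs, x != 1, y \in bs & ok_stm bs s]
  end.

(** Even registers hold the variables, odd ones a stack of temporaries. *)
Definition vr x := x.*2.
Definition tr d := d.*2.+1.
Arguments vr : simpl never.
Arguments tr : simpl never.

Definition copy_var r x := Seq (Const r 0) (Add r r (vr x)).
Definition dbl r := Add r r r.
(** Turns the index in [r] into an address: entry i of array [a] is stored at 16 i + a beyond the
    input, whose size is in variable 1. The four doublings multiply by 16. *)
Definition goto_cell a r r' :=
  Seq (Seq (Seq (dbl r) (dbl r)) (Seq (dbl r) (dbl r)))
    (Seq (Const r' a) (Seq (Add r r r') (Add r r (vr 1)))).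

Fixpoint comp_exp (e : exp) (d : nat) : cmd :=
  match e with
  | Cst a => Const (tr d) a
  | Var x => copy_var (tr d) x
  | Plus e1 e2 =>
      Seq (comp_exp e1 d) (Seq (comp_exp e2 d.+1) (Add (tr d) (tr d) (tr d.+1)))
  | Minus e1 e2 =>
      Seq (comp_exp e1 d) (Seq (comp_exp e2 d.+1) (Sub (tr d) (tr d) (tr d.+1)))
  | Times e x =>
      Seq (comp_exp e d.+1) (Seq (Const (tr d) 0)
        (Seq (copy_var (tr d.+2) x) (Seq (Const (tr d.+3) 1)
          (While (tr d.+2)
             (Seq (Add (tr d) (tr d) (tr d.+1))
                (Sub (tr d.+2) (tr d.+2) (tr d.+3)))))))
  | Arr a e =>
      Seq (comp_exp e d) (Seq (goto_cell a (tr d) (tr d.+1)) (Read (tr d) (tr d)))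
  | Inp e =>
      Seq (comp_exp e d) (Seq (Sub (tr d.+1) (vr 1) (tr d))
        (If (tr d.+1) (Read (tr d) (tr d)) (Const (tr d) 0)))
  end.

Fixpoint comp_stm (s : stm) (d : nat) : cmd :=
  match s with
  | SSkip => Skip
  | Asg x e => Seq (comp_exp e d) (Seq (Const (vr x) 0) (Add (vr x) (vr x) (tr d)))
  | Sto a e1 e2 =>
      Seq (comp_exp e1 d) (Seq (goto_cell a (tr d) (tr d.+1))
        (Seq (comp_exp e2 d.+1) (Write (tr d) (tr d.+1))))
  | SSeq s1 s2 => Seq (comp_stm s1 d) (comp_stm s2 d)
  | SIf e s1 s2 => Seq (comp_exp e d) (If (tr d) (comp_stm s1 d) (comp_stm s2 d))
  | SFor x y s =>
      Seq (copy_var (tr d) y) (Seq (Const (tr d.+1) 0) (Seq (Const (tr d.+2) 1)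
        (While (tr d)
           (Seq (Const (vr x) 0) (Seq (Add (vr x) (vr x) (tr d.+1))
             (Seq (comp_stm s d.+3) (Seq (Add (tr d.+1) (tr d.+1) (tr d.+2))
                (Sub (tr d) (tr d) (tr d.+2)))))))))
  end.

Fixpoint cost_exp (M : nat) (e : exp) : nat :=
  match e with
  | Cst _ => 1
  | Var _ => 2
  | Plus e1 e2 | Minus e1 e2 => cost_exp M e1 + cost_exp M e2 + 1
  | Times e _ => cost_exp M e + 3 * M + 5
  | Arr _ e => cost_exp M e + 8
  | Inp e => cost_exp M e + 3
  end.

Fixpoint cost (M : nat) (s : stm) : nat :=
  match s with
  | SSkip => 1
  | Asg _ e => cost_exp M e + 2
  | Sto _ e1 e2 => cost_exp M e1 + cost_exp M e2 + 8
  | SSeq s1 s2 => cost M s1 + cost M s2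
  | SIf e s1 s2 => cost_exp M e + cost M s1 + cost M s2 + 1
  | SFor _ _ s => (cost M s + 5) * M + 5
  end.

Fixpoint size_exp (e : exp) : nat :=
  match e with
  | Cst _ | Var _ => 2
  | Plus e1 e2 | Minus e1 e2 => size_exp e1 + size_exp e2 + 1
  | Times e _ | Arr _ e | Inp e => size_exp e + 8
  end.

Fixpoint size_stm (s : stm) : nat :=
  match s with
  | SSkip => 1
  | Asg _ e => size_exp e + 2
  | Sto _ e1 e2 => size_exp e1 + size_exp e2 + 8
  | SSeq s1 s2 => size_stm s1 + size_stm s2
  | SIf e s1 s2 => size_exp e + size_stm s1 + size_stm s2 + 1
  | SFor _ _ s => size_stm s + 10
  end.

Fixpoint depth (s : stm) : nat :=
  match s with
  | SSeq s1 s2 | SIf _ s1 s2 => maxn (depth s1) (depth s2)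
  | SFor _ _ s => (depth s).+1
  | _ => 1
  end.

Lemma cost_exp_le M e : cost_exp M e <= size_exp e * M.+1.
Proof. elim: e => //= *; nia. Qed.

Lemma depth_gt0 s : 0 < depth s.
Proof. by elim: s => //= *; rewrite leq_max; apply/orP; left. Qed.

(** Expressions cost O(M), because of multiplications, and each level of loop nesting contributes
    another factor M + 1. *)
Lemma cost_le M s : cost M s <= size_stm s * M.+1 ^ depth s.
Proof.
have expM s' d : depth s' <= d -> M.+1 ^ depth s' <= M.+1 ^ d.
  by move=> le; exact: leq_pexp2l.
elim: s => //=.
- move=> x e; have := cost_exp_le M e; rewrite expn1; nia.
- move=> a e1 e2; have := cost_exp_le M e1; have := cost_exp_le M e2.
  rewrite expn1; nia.
- move=> s1 IH1 s2 IH2.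
  have := @expM s1 _ (leq_maxl (depth s1) (depth s2)).
  have := @expM s2 _ (leq_maxr (depth s1) (depth s2)).
  rewrite mulnDl => le2 le1; apply: leq_add.
    by apply: leq_trans IH1 _; rewrite leq_mul2l le1 orbT.
  by apply: leq_trans IH2 _; rewrite leq_mul2l le2 orbT.
- move=> e s1 IH1 s2 IH2.
  have le1 := @expM s1 _ (leq_maxl (depth s1) (depth s2)).
  have le2 := @expM s2 _ (leq_maxr (depth s1) (depth s2)).
  have d0 : M.+1 <= M.+1 ^ maxn (depth s1) (depth s2).
    rewrite -{1}(expn1 M.+1); apply: leq_pexp2l => //.
    by rewrite leq_max depth_gt0.
  have := cost_exp_le M e.
  set X := M.+1 ^ maxn _ _ in le1 le2 d0 * => ce.
  have c1 : cost M s1 <= size_stm s1 * X.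
    by apply: leq_trans IH1 _; rewrite leq_mul2l le1 orbT.
  have c2 : cost M s2 <= size_stm s2 * X.
    by apply: leq_trans IH2 _; rewrite leq_mul2l le2 orbT.
  nia.
- move=> x y s IH; rewrite expnS.
  have X0 : 0 < M.+1 ^ depth s by rewrite expn_gt0.
  nia.
Qed.

(** * The machine simulates the loop language *)

Section Simulation.
Variables (inp : nat -> nat) (off : nat).
Hypothesis inp0 : forall i, off <= i -> inp i = 0.

Definition sim (h : store) (l : state) :=
  [/\ forall x, regs l (vr x) = hv h x,
      hv h 1 = off,
      forall i, i < off -> mem l i = inp i
    & forall a i, a < 16 -> mem l (16 * i + a + off) = ha h a i].

Definition bounded (bs : seq nat) (M : nat) (h : store) :=
  forall x, x \in bs -> hv h x <= M.

(** Code compiled at depth [d] may overwrite only the temporaries from [tr d] upwards; variables and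
    lower temporaries survive. *)
Definition keeps (d : nat) (l l' : state) :=
  forall r, (forall d', r = tr d' -> d' < d) -> regs l' r = regs l r.

Definition runs c l T l' := exists2 t, exec c l t l' & t <= T.

Lemma runs_seq c1 c2 l1 l2 l3 T1 T2 :
  runs c1 l1 T1 l2 -> runs c2 l2 T2 l3 -> runs (Seq c1 c2) l1 (T1 + T2) l3.
Proof.
move=> [t1 run1 le1] [t2 run2 le2]; exists (t1 + t2); last exact: leq_add.
exact: exec_Seq run1 run2.
Qed.

Lemma runs_le c l l' T1 T2 : T1 <= T2 -> runs c l T1 l' -> runs c l T2 l'.
Proof. by move=> le [t run le1]; exists t => //; apply: leq_trans le. Qed.

Lemma runs_skip l : runs Skip l 1 l.
Proof. by exists 1 => //; constructor. Qed.
Lemma runs_const l r a : runs (Const r a) l 1 (set_reg l r a).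
Proof. by exists 1 => //; constructor. Qed.
Lemma runs_add l r x y : runs (Add r x y) l 1 (set_reg l r (regs l x + regs l y)).
Proof. by exists 1 => //; constructor. Qed.
Lemma runs_sub l r x y : runs (Sub r x y) l 1 (set_reg l r (regs l x - regs l y)).
Proof. by exists 1 => //; constructor. Qed.
Lemma runs_read l r x : runs (Read r x) l 1 (set_reg l r (mem l (regs l x))).
Proof. by exists 1 => //; constructor. Qed.
Lemma runs_write l x y : runs (Write x y) l 1 (set_mem l (regs l x) (regs l y)).
Proof. by exists 1 => //; constructor. Qed.

Lemma tr_inj d d' : (tr d == tr d') = (d == d').
Proof. by rewrite /tr eqSS (inj_eq double_inj). Qed.
Lemma vr_inj x y : (vr x == vr y) = (x == y).
Proof. by rewrite /vr (inj_eq double_inj). Qed.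
Lemma vr_tr x d : (vr x == tr d) = false.
Proof. by rewrite /vr /tr; lia. Qed.
Lemma tr_vr x d : (tr d == vr x) = false.
Proof. by rewrite eq_sym vr_tr. Qed.

Lemma updE f i a j : upd f i a j = if j == i then a else f j.
Proof. by []. Qed.

Lemma neq_tr_le r d d' : (forall k, r = tr k -> k < d) -> d <= d' -> (r == tr d') = false.
Proof. by move=> lt le; apply/negbTE/eqP => /lt; rewrite ltnNge le. Qed.

Lemma neq_tr r d : (forall k, r = tr k -> k < d) ->
  ((r == tr d) = false) * ((r == tr d.+1) = false) *
  ((r == tr d.+2) = false) * ((r == tr d.+3) = false).
Proof. by move=> lt; rewrite !(neq_tr_le lt) //; lia. Qed.

Definition regE := (updE, tr_inj, vr_inj, vr_tr, tr_vr, eqxx).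

Lemma keeps_trans d d' l1 l2 l3 :
  d <= d' -> keeps d l1 l2 -> keeps d' l2 l3 -> keeps d l1 l3.
Proof.
move=> le k12 k23 r lt; rewrite k23 ?k12 // => k /lt; lia.
Qed.

Lemma keeps_sim h d l l' : sim h l -> keeps d l l' -> mem l' = mem l -> sim h l'.
Proof.
move=> [s1 s2 s3 s4] k m; split=> // [x|i|a i]; rewrite ?m; auto.
by rewrite k // => d' /eqP; rewrite vr_tr.
Qed.

Lemma keeps_vr d l l' x : keeps d l l' -> regs l' (vr x) = regs l (vr x).
Proof. by move=> k; apply: k => d' /eqP; rewrite vr_tr. Qed.
Lemma keeps_tr d l l' d' : d' < d -> keeps d l l' -> regs l' (tr d') = regs l (tr d').
Proof. by move=> lt k; apply: k => d2 /eqP; rewrite tr_inj => /eqP <-. Qed.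

Lemma runs_dbl2 d l :
  exists2 l', runs (Seq (dbl (tr d)) (dbl (tr d))) l 2 l' &
  [/\ regs l' (tr d) = 4 * regs l (tr d), keeps d l l' & mem l' = mem l].
Proof.
eexists; first by apply: (@runs_seq _ _ _ _ _ 1 1); exact: runs_add.
split=> //=; first by rewrite !regE; lia.
by move=> q lt /=; rewrite !regE !(neq_tr lt).
Qed.

Lemma runs_goto_cell a d l (r := tr d) (r' := tr d.+1) :
  exists2 l', runs (goto_cell a r r') l 7 l' &
  [/\ regs l' r = 16 * regs l r + a + regs l (vr 1), keeps d l l' & mem l' = mem l].
Proof.
have [l1 r1 [v1 k1 m1]] := runs_dbl2 d l.
have [l2 r2 [v2 k2 m2]] := runs_dbl2 d l1.
eexists.
  apply: (@runs_seq _ _ _ _ _ 4 3); first exact: runs_seq r1 r2.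
  apply: (@runs_seq _ _ _ _ _ 1 2); first exact: runs_const.
  by apply: (@runs_seq _ _ _ _ _ 1 1); exact: runs_add.
rewrite /r /r'; split=> /=; last by rewrite m2.
  have n1 : (d == d.+1) = false by lia.
  by rewrite !regE n1 (keeps_vr _ k2) (keeps_vr _ k1) v2 v1; lia.
by move=> q lt /=; rewrite !regE !(neq_tr lt) // k2 ?k1.
Qed.

Lemma runs_times_loop d l k :
  regs l (tr d.+2) = k -> regs l (tr d.+3) = 1 ->
  exists2 l', runs (While (tr d.+2)
             (Seq (Add (tr d) (tr d) (tr d.+1))
                (Sub (tr d.+2) (tr d.+2) (tr d.+3)))) l (3 * k + 1) l' &
  [/\ regs l' (tr d) = regs l (tr d) + regs l (tr d.+1) * k,
      keeps d l l' & mem l' = mem l].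
Proof.
elim: k l => [|k IH] l lk l1.
  exists l; last by split=> //; rewrite muln0 addn0.
  by exists 1 => //; apply: exec_While_false.
set l2 := set_reg l (tr d) (regs l (tr d) + regs l (tr d.+1)).
set l3 := set_reg l2 (tr d.+2) (regs l2 (tr d.+2) - regs l2 (tr d.+3)).
have run12 : runs (Seq (Add (tr d) (tr d) (tr d.+1))
                (Sub (tr d.+2) (tr d.+2) (tr d.+3))) l (1 + 1) l3.
  by apply: runs_seq; [exact: runs_add | exact: runs_sub].
have E3 i : regs l3 (tr i) =
    if i == d.+2 then k else
    if i == d then regs l (tr d) + regs l (tr d.+1) else regs l (tr i).
  rewrite /l3 /l2 /= !regE; case: ifP => // _.
  have -> : (d.+2 == d) = false by lia.
  have -> : (d.+3 == d) = false by lia.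
  by rewrite lk l1 subn1.
have [||l' [t run le] [e1 k1 m1]] := IH l3.
- by rewrite E3 eqxx.
- rewrite E3; have -> : (d.+3 == d.+2) = false by lia.
  by have -> : (d.+3 == d) = false by lia.
exists l'; last first.
  split=> //.
    rewrite e1 !E3 eqxx; have -> : (d == d.+2) = false by lia.
    have -> : (d.+1 == d.+2) = false by lia.
    have -> : (d.+1 == d) = false by lia.
    by rewrite mulnS addnA.
  by move=> r lt; rewrite k1 //= !regE !(neq_tr lt) //.
have [t12 r12 le12] := run12.
exists (t12 + t).+1; last lia.
by apply: exec_While_true r12 run; rewrite lk.
Qed.

Lemma comp_exp_sim bs M e d h l :
  sim h l -> bounded bs M h -> ok_exp bs e ->
  exists2 l', runs (comp_exp e d) l (cost_exp M e) l' &
  [/\ regs l' (tr d) = eval inp h e, keeps d l l' & mem l' = mem l].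
Proof.
move=> + bd; elim: e d l => /=.
- move=> a d l S _; eexists; first exact: runs_const.
  split=> /=; [by rewrite !regE | | by []].
  by move=> r lt /=; rewrite !regE !(neq_tr lt).
- move=> x d l S _; eexists.
    by apply: (@runs_seq _ _ _ _ _ 1 1); [exact: runs_const | exact: runs_add].
  split=> /=; [by rewrite !regE; case: S => -> | | by []].
  by move=> r lt /=; rewrite !regE !(neq_tr lt).
- move=> e1 IH1 e2 IH2 d l S /andP[ok1 ok2].
  have [l1 r1 [v1 k1 m1]] := IH1 d l S ok1.
  have S1 := keeps_sim S k1 m1.
  have [l2 r2 [v2 k2 m2]] := IH2 d.+1 l1 S1 ok2.
  eexists.
    rewrite -addnA; apply: runs_seq; first exact: r1.
    by apply: runs_seq; [exact: r2 | exact: runs_add].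
  split=> /=; [ | |by rewrite m2].
    by rewrite !regE v2 (keeps_tr _ k2) // v1.
  move=> r lt /=; rewrite !regE (neq_tr lt) //.
  exact: (keeps_trans (leqnSn d) k1 k2).
- move=> e1 IH1 e2 IH2 d l S /andP[ok1 ok2].
  have [l1 r1 [v1 k1 m1]] := IH1 d l S ok1.
  have S1 := keeps_sim S k1 m1.
  have [l2 r2 [v2 k2 m2]] := IH2 d.+1 l1 S1 ok2.
  eexists.
    rewrite -addnA; apply: runs_seq; first exact: r1.
    by apply: runs_seq; [exact: r2 | exact: runs_sub].
  split=> /=; [ | |by rewrite m2].
    by rewrite !regE v2 (keeps_tr _ k2) // v1.
  move=> r lt /=; rewrite !regE (neq_tr lt) //.
  exact: (keeps_trans (leqnSn d) k1 k2).
- move=> e IH x d l S /andP[xb oke].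
  have [l1 r1 [v1 k1 m1]] := IH d.+1 l S oke.
  have S1 := keeps_sim S k1 m1.
  set l2 := set_reg l1 (tr d) 0.
  set l3 := set_reg l2 (tr d.+2) 0.
  set l4 := set_reg l3 (tr d.+2) (regs l3 (tr d.+2) + regs l3 (vr x)).
  set l5 := set_reg l4 (tr d.+3) 1.
  have n1 : (d.+1 == d.+3) = false by lia.
  have n2 : (d.+1 == d.+2) = false by lia.
  have n3 : (d.+1 == d) = false by lia.
  have n4 : (d == d.+3) = false by lia.
  have n5 : (d == d.+2) = false by lia.
  have n6 : (d.+2 == d.+3) = false by lia.
  have h5 : regs l5 (tr d.+2) = hv h x.
    by rewrite /= !regE n6 add0n; case: S1.
  have one5 : regs l5 (tr d.+3) = 1 by rewrite /= !regE.
  have [l6 r6 [v6 k6 m6]] := runs_times_loop h5 one5.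
  exists l6.
    have bx := bd x xb.
    apply: (@runs_le _ _ _ (cost_exp M e + (1 + (1 + 1 + (1 + (3 * hv h x + 1)))))); first lia.
    apply: runs_seq; first exact: r1.
    apply: runs_seq; first exact: runs_const.
    apply: runs_seq; first by apply: runs_seq; [exact: runs_const | exact: runs_add].
    by apply: runs_seq; first exact: runs_const.
  split=> //; last by rewrite m6 -m1.
    by rewrite v6 /= !regE n1 n2 n3 n4 n5 v1.
  move=> r lt; rewrite k6 //= !regE !(neq_tr lt) //.
  by apply: k1 => k /lt; lia.
- move=> a e IH d l S /andP[a16 oke].
  have [l1 r1 [v1 k1 m1]] := IH d l S oke.
  have S1 := keeps_sim S k1 m1.
  have [l2 r2 [v2 k2 m2]] := runs_goto_cell a d l1.
  eexists.
    rewrite (_ : _ + 8 = cost_exp M e + (7 + 1)) //.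
    by apply: runs_seq r1 _; apply: runs_seq; [exact: r2 | exact: runs_read].
  split=> /=; [ | |by rewrite m2].
    rewrite !regE v2 v1 m2; have [-> -> _ ->//] := S1.
  move=> r lt /=; rewrite !regE (neq_tr lt) // k2 ?k1 //.
- move=> e IH d l S oke.
  have [l1 r1 [v1 k1 m1]] := IH d l S oke.
  have S1 := keeps_sim S k1 m1.
  have [rg h1 mi _] := S1.
  set l2 := set_reg l1 (tr d.+1) (regs l1 (vr 1) - regs l1 (tr d)).
  have n1 : (d == d.+1) = false by lia.
  have [lt|ge] := ltnP (eval inp h e) off.
    exists (set_reg l2 (tr d) (mem l2 (regs l2 (tr d)))).
      rewrite (_ : _ + 3 = cost_exp M e + (1 + 2)) //.
      apply: runs_seq r1 _; apply: runs_seq; first exact: runs_sub.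
      exists 2 => //; apply: exec_If_true; last by constructor.
      by rewrite /= !regE v1 rg h1; lia.
    split=> //=; first by rewrite !regE n1 v1 mi.
    move=> r lt' /=; rewrite !regE !(neq_tr lt') // k1 //.
  exists (set_reg l2 (tr d) 0).
    rewrite (_ : _ + 3 = cost_exp M e + (1 + 2)) //.
    apply: runs_seq r1 _; apply: runs_seq; first exact: runs_sub.
    exists 2 => //; apply: exec_If_false; last by constructor.
    by rewrite /= !regE v1 rg h1; lia.
  split=> //=; first by rewrite !regE inp0.
  move=> r lt' /=; rewrite !regE !(neq_tr lt') // k1 //.
Qed.

Lemma den_bound bs s h x : x \in bs -> ok_stm bs s -> hv (den inp s h) x = hv h x.
Proof.
move=> xb; elim: s h => //=.
- by move=> y e h /and3P[yb _ _]; rewrite updE; case: eqP => // xy; rewrite -xy xb in yb.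
- by move=> s1 IH1 s2 IH2 h /andP[ok1 ok2]; rewrite IH2 ?IH1.
- by move=> e s1 IH1 s2 IH2 h /and3P[_ ok1 ok2]; case: ifP; rewrite (IH1, IH2).
move=> y z s IH h /and4P[yb _ _ oks].
move: (iota _ _) => r; elim: r h => //= i r IHr h; rewrite IHr IH //= updE.
by case: eqP => // xy; rewrite -xy xb in yb.
Qed.

Lemma bounded_den bs M s h :
  ok_stm bs s -> bounded bs M h -> bounded bs M (den inp s h).
Proof. by move=> ok bd x xb; rewrite (den_bound _ xb ok) bd. Qed.

(** The temporaries below [d] hold the counters of the enclosing loops; hence the last claim, which
    the induction needs in the body of a loop. *)
Lemma comp_stm_sim bs M s d h l :
  sim h l -> bounded bs M h -> ok_stm bs s ->
  exists2 l', runs (comp_stm s d) l (cost M s) l' &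
  sim (den inp s h) l' /\ forall d', d' < d -> regs l' (tr d') = regs l (tr d').
Proof.
elim: s d h l => /=.
- by move=> d h l S _ _; exists l; [exact: runs_skip|].
- move=> x e d h l S bd /and3P[xb x1 oke].
  have [l1 r1 [v1 k1 m1]] := comp_exp_sim d S bd oke.
  have S1 := keeps_sim S k1 m1.
  eexists.
    rewrite (_ : _ + 2 = cost_exp M e + (1 + 1)) //.
    apply: runs_seq r1 _.
    by apply: runs_seq; [exact: runs_const | exact: runs_add].
  have [s1 s2 s3 s4] := S1.
  split; last by move=> d' lt; rewrite /= !regE (keeps_tr lt k1).
  split=> //=.
    by move=> y; rewrite !regE v1; case: eqP => // _; apply: s1.
  by rewrite updE eq_sym (negbTE x1).
- move=> a e1 e2 d h l S bd /and3P[a16 ok1 ok2].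
  have [l1 r1 [v1 k1 m1]] := comp_exp_sim d S bd ok1.
  have S1 := keeps_sim S k1 m1.
  have [l2 r2 [v2 k2 m2]] := runs_goto_cell a d l1.
  have S2 := keeps_sim S1 k2 m2.
  have [l3 r3 [v3 k3 m3]] := comp_exp_sim d.+1 S2 bd ok2.
  have [s1 s2 s3 s4] := keeps_sim S2 k3 m3.
  eexists.
    rewrite (_ : _ + 8 = cost_exp M e1 + (7 + (cost_exp M e2 + 1))); last lia.
    apply: runs_seq r1 _; apply: runs_seq r2 _; apply: runs_seq r3 _.
    exact: runs_write.
  have addr : regs l3 (tr d) = 16 * eval inp h e1 + a + off.
    by rewrite (keeps_tr _ k3) // v2 v1; case: S1 => -> ->.
  split; last first.
    move=> d' lt /=; rewrite (keeps_tr _ k3); last lia.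
    by rewrite (keeps_tr lt k2) (keeps_tr lt k1).
  split=> //=.
    move=> i lt; rewrite updE addr; case: eqP; last by auto.
    by move=> ?; lia.
  move=> a' i a16'; rewrite updE addr v3.
  case: eqP => [E|NE].
    have -> : a' = a by lia.
    have -> : i = eval inp h e1 by lia.
    by rewrite eqxx updE eqxx.
  rewrite s4 //; case: eqP => // Ea; rewrite -Ea updE; case: eqP => // Ei.
  by case: NE; rewrite Ea Ei.
- move=> s1 IH1 s2 IH2 d h l S bd /andP[ok1 ok2].
  have [l1 r1 [S1 k1]] := IH1 d h l S bd ok1.
  have [l2 r2 [S2 k2]] := IH2 d _ l1 S1 (bounded_den ok1 bd) ok2.
  exists l2; first exact: runs_seq r1 r2.
  by split=> // d' lt; rewrite k2 ?k1.
- move=> e s1 IH1 s2 IH2 d h l S bd /and3P[oke ok1 ok2].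
  have [l1 r1 [v1 k1 m1]] := comp_exp_sim d S bd oke.
  have S1 := keeps_sim S k1 m1.
  case: ifP => te.
    have [l2 [t r2 le2] [S2 k2]] := IH1 d _ l1 S1 bd ok1.
    exists l2; last by split=> // d' lt; rewrite k2 // (keeps_tr lt k1).
    apply: (@runs_le _ _ _ (cost_exp M e + (cost M s1).+1)); first lia.
    apply: runs_seq r1 _; exists t.+1 => //; apply: exec_If_true r2.
    by rewrite v1.
  have [l2 [t r2 le2] [S2 k2]] := IH2 d _ l1 S1 bd ok2.
  exists l2; last by split=> // d' lt; rewrite k2 // (keeps_tr lt k1).
  apply: (@runs_le _ _ _ (cost_exp M e + (cost M s2).+1)); first lia.
  apply: runs_seq r1 _; exists t.+1 => //; apply: exec_If_false r2.
  by rewrite v1; apply/eqP; move/negbT: te; rewrite negbK.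
move=> x y s IH d h l S bd /and4P[xb x1 yb oks].
set body := (Seq (Const (vr x) 0) _).
(* [k] rounds remain and [i] is the next index: [tr d] counts down, [tr d.+1] counts up, and
   [tr d.+2] holds the constant 1. *)
have loop k i h' l' : sim h' l' -> bounded bs M h' ->
    regs l' (tr d) = k -> regs l' (tr d.+1) = i -> regs l' (tr d.+2) = 1 ->
    exists2 l'', runs (While (tr d) body) l' ((cost M s + 5) * k + 1) l'' &
      sim (foldl (fun g j => den inp s (setv g x j)) h' (iota i k)) l'' /\
      forall d', d' < d -> regs l'' (tr d') = regs l' (tr d').
  elim: k i h' l' => [|k IHk] i h' l' S' bd' vk vi v1.
    exists l'; last by [].
    by exists 1; [apply: exec_While_false | rewrite addn1].
  set l1 := set_reg l' (vr x) 0.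
  set l2 := set_reg l1 (vr x) (regs l1 (vr x) + regs l1 (tr d.+1)).
  have S2 : sim (setv h' x i) l2.
    have [s1 s2 s3 s4] := S'; split=> //=.
      by move=> z; rewrite !regE vi; case: eqP => // _; apply: s1.
    by rewrite updE eq_sym (negbTE x1).
  have bd2 : bounded bs M (setv h' x i).
    move=> z zb; rewrite /= updE; case: eqP => [zx|_]; last exact: bd'.
    by rewrite -zx zb in xb.
  have [l3 r3 [S3 k3]] := IH d.+3 _ l2 S2 bd2 oks.
  set l4 := set_reg l3 (tr d.+1) (regs l3 (tr d.+1) + regs l3 (tr d.+2)).
  set l5 := set_reg l4 (tr d) (regs l4 (tr d) - regs l4 (tr d.+2)).
  have T3 d' : d' < d.+3 -> regs l3 (tr d') = regs l' (tr d').
    by move=> lt; rewrite k3 //= !regE.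
  have n1 : (d.+1 == d) = false by lia.
  have n2 : (d == d.+1) = false by lia.
  have n3 : (d.+2 == d) = false by lia.
  have n4 : (d.+2 == d.+1) = false by lia.
  have S5 : sim (den inp s (setv h' x i)) l5.
    apply: (@keeps_sim _ d l3) => // r lt /=.
    by rewrite !regE !(neq_tr lt).
  have [|||l6 r6 [S6 k6]] := IHk i.+1 _ l5 S5 (bounded_den oks bd2).
  - by rewrite /= !regE n2 n4 !T3 ?vk ?v1 ?subn1 //; lia.
  - by rewrite /= !regE n1 !T3 ?vi ?v1 ?addn1 //; lia.
  - by rewrite /= !regE n3 n4 !T3 //; lia.
  exists l6; last first.
    split=> // d' lt; rewrite k6 //= !regE.
    have -> : (d' == d) = false by lia.
    have -> : (d' == d.+1) = false by lia.
    by rewrite T3 //; lia.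
  have [t [r5 le5]] : exists t, exec body l' t l5 /\ t <= cost M s + 4.
    have [t r5 le] : runs body l' (1 + (1 + (cost M s + (1 + 1)))) l5.
      apply: runs_seq; first exact: runs_const.
      apply: runs_seq; first exact: runs_add.
      apply: runs_seq r3 _.
      by apply: runs_seq; [exact: runs_add | exact: runs_sub].
    by exists t; split=> //; lia.
  case: r6 => t6 r6 le6; exists (t + t6).+1; last by nia.
  by apply: exec_While_true r5 r6; rewrite vk.
set l1 := set_reg l (tr d) 0.
set l2 := set_reg l1 (tr d) (regs l1 (tr d) + regs l1 (vr y)).
set l3 := set_reg l2 (tr d.+1) 0.
set l4 := set_reg l3 (tr d.+2) 1.
have S4 : sim h l4.
  apply: (@keeps_sim _ d _ _ S) => // r lt /=.
  by rewrite !regE !(neq_tr (d := d) lt).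
have n1 : (d == d.+2) = false by lia.
have n2 : (d == d.+1) = false by lia.
have n3 : (d.+1 == d.+2) = false by lia.
have [|||l5 r5 [S5 k5]] := loop (hv h y) 0 h l4 S4 bd.
- by rewrite /= !regE n1 n2 add0n; case: S => ->.
- by rewrite /= !regE n3.
- by rewrite /= !regE.
exists l5.
  have le := bd y yb.
  apply: (@runs_le _ _ _ (1 + 1 + (1 + (1 + ((cost M s + 5) * hv h y + 1))))).
    nia.
  apply: runs_seq; first by apply: runs_seq; [exact: runs_const | exact: runs_add].
  apply: runs_seq; first exact: runs_const.
  by apply: runs_seq r5; exact: runs_const.
split=> // d' lt; rewrite k5 //= !regE.
have -> : (d' == d.+2) = false by lia.
have -> : (d' == d.+1) = false by lia.
by have -> : (d' == d) = false by lia.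
Qed.

End Simulation.

(** * The program *)

Fixpoint mods (s : stm) : seq nat :=
  match s with
  | SSkip | Sto _ _ _ => [::]
  | Asg x _ => [:: x]
  | SSeq s1 s2 | SIf _ s1 s2 => mods s1 ++ mods s2
  | SFor x _ s => x :: mods s
  end.

Fixpoint wrs (s : stm) : seq nat :=
  match s with
  | SSkip | Asg _ _ => [::]
  | Sto a _ _ => [:: a]
  | SSeq s1 s2 | SIf _ s1 s2 => wrs s1 ++ wrs s2
  | SFor _ _ s => wrs s
  end.

Section Frame.
Variable inp : nat -> nat.

Lemma frame_v s h x : x \notin mods s -> hv (den inp s h) x = hv h x.
Proof.
elim: s h => //=.
- by move=> y e h; rewrite inE updE => /negbTE->.
- by move=> s1 IH1 s2 IH2 h; rewrite mem_cat negb_or => /andP[m1 m2]; rewrite IH2 ?IH1.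
- by move=> e s1 IH1 s2 IH2 h; rewrite mem_cat negb_or => /andP[m1 m2]; case: ifP; rewrite (IH1, IH2).
move=> y z s IH h; rewrite inE negb_or => /andP[/negbTE xy ms].
by move: (iota _ _) => r; elim: r h => //= i r IHr h; rewrite IHr IH //= updE xy.
Qed.

Lemma frame_a s h a : a \notin wrs s -> ha (den inp s h) a = ha h a.
Proof.
elim: s h => //=.
- by move=> b e1 e2 h; rewrite inE => /negbTE->.
- by move=> s1 IH1 s2 IH2 h; rewrite mem_cat negb_or => /andP[m1 m2]; rewrite IH2 ?IH1.
- by move=> e s1 IH1 s2 IH2 h; rewrite mem_cat negb_or => /andP[m1 m2]; case: ifP; rewrite (IH1, IH2).
move=> y z s IH h ms.
by move: (iota _ _) => r; elim: r h => //= i r IHr h; rewrite IHr IH.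
Qed.

Lemma den_for (I : nat -> store -> Prop) x y s h :
  I 0 h -> (forall i g, i < hv h y -> I i g -> I i.+1 (den inp s (setv g x i))) ->
  I (hv h y) (den inp (SFor x y s) h).
Proof.
move=> I0 step /=.
have aux m i g : i + m <= hv h y -> I i g ->
    I (i + m) (foldl (fun g i => den inp s (setv g x i)) g (iota i m)).
  elim: m i g => [|m IH] i g le Ii; first by rewrite addn0.
  by rewrite /= -addSnnS; apply: IH; [rewrite addSnnS | apply: step => //; lia].
by have := aux (hv h y) 0 h (leqnn _) I0.
Qed.

End Frame.

Notation "s1 ;; s2" := (SSeq s1 s2) (at level 60, right associativity).
Notation "x <:- e" := (Asg x e) (at level 55).
Definition When e s := SIf e s SSkip.
(** Truth values are 0 and 1; truncated subtraction then yields all connectives and comparisons. *)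
Definition Not e := Minus (Cst 1) e.
Definition Leq a b := Minus (Cst 1) (Minus a b).
Definition Lt a b := Leq (Plus a (Cst 1)) b.
Definition Eqn a b := Minus (Cst 1) (Plus (Minus a b) (Minus b a)).
Definition And a b := Minus (Plus a b) (Cst 1).
Definition Or a b := Not (Minus (Not a) b).
Definition Dbl e := Plus e e.

Notation r_out := 0.
Notation r_n := 2.
Notation r_k := 3.
Notation r_n1 := 4.
Notation r_delta := 5.
Notation r_v := 6.
Notation r_u := 7.
Notation r_d := 8.
Notation r_s := 9.
Notation r_b := 10.
Notation r_D := 11.
Notation r_D8 := 12.
Notation r_T := 13.
Notation r_L := 14.
Notation r_small := 15.
Notation r_rej := 16.
Notation r_gap := 17.
Notation r_mc := 18.
Notation r_S0 := 19.
Notation r_I0 := 20.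
Notation r_m2 := 21.
Notation r_m4 := 22.
Notation r_TB := 23.
Notation r_TM := 24.
Notation r_c := 25.
Notation r_x := 26.
Notation r_a := 27.
Notation r_a' := 28.
Notation r_t := 29.
Notation r_st := 30.
Notation r_s' := 31.
Notation r_w := 32.
Notation r_r := 33.
Notation r_z := 34.
Notation r_ok := 35.
Notation r_cnt := 36.
Notation r_par := 37.
Notation r_use := 38.

Notation a_W := 0.
Notation a_root := 1.
Notation a_I := 2.
Notation a_M := 3.
Notation a_S0 := 4.
Notation a_q2 := 5.
Notation a_q4 := 6.
Notation a_dig := 7.
Notation a_bit := 8.
Notation a_T := 9.
Notation a_V := 10.
Notation a_link := 11.

Coercion Var : nat >-> exp.

Definition inp_B (v : exp) := Inp (Plus (Cst 2) v).
Definition inp_S (v : exp) := Inp (Plus (Plus (Cst 2) r_n) v).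
Definition inp_adj (u v : exp) :=
  Inp (Plus (Plus (Plus (Plus (Cst 2) r_n) r_n) (Times u r_n)) v).

Definition read_sizes :=
  r_n <:- Inp (Cst 0) ;; r_n1 <:- Plus r_n (Cst 1) ;; r_k <:- Inp (Cst 1).

Definition count_loop (x y : nat) (e : exp) :=
  y <:- Cst 0 ;; SFor x r_n (y <:- Plus y e).

Definition compute_delta :=
  count_loop r_v r_delta (Not (inp_B r_v)) ;;
  SFor r_v r_n
    (When (Not (inp_B r_v))
       (count_loop r_u r_d (And (inp_adj r_v r_u) (Not (inp_B r_u))) ;;
        When (Lt r_d r_delta) (r_delta <:- r_d))).

(** The goal [r_L] is raised to at least 3, the length of a shortest cycle, so that a cyclic
    sequence of length [r_L] is a genuine cycle. *)
Definition compute_params :=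
  count_loop r_v r_s (inp_S r_v) ;;
  count_loop r_v r_b (inp_B r_v) ;;
  r_D <:- Plus (Plus (Minus r_s r_delta) r_b) (Cst 1) ;;
  r_D8 <:- Dbl (Dbl (Dbl r_D)) ;;
  r_T <:- Dbl (Dbl (Dbl (Dbl (Dbl (Dbl r_D8))))) ;;
  r_L <:- Plus (Dbl r_delta) r_k ;;
  When (Lt r_L (Cst 3)) (r_L <:- Cst 3) ;;
  r_small <:- Leq r_delta (Dbl (Dbl r_T)).

Definition setup_small :=
  SFor r_v r_n (Sto a_W r_v (inp_S r_v) ;; Sto a_root r_v (inp_S r_v)).

(** If I0 has fewer than 2 T = 1024 D vertices, there is no long cycle ([cycle_not_rejected]); this
    part of W is then empty, which keeps the tables small. Otherwise, I0 being twice as large as the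
    degree threshold T, few vertices of S fall below it ([few_bound]). *)
Definition compute_W0 :=
  SFor r_v r_n (Sto a_I r_v (And (Not (inp_S r_v)) (Not (inp_B r_v)))) ;;
  count_loop r_v r_I0 (Arr a_I r_v) ;;
  r_rej <:- Lt r_I0 (Dbl r_T) ;;
  SFor r_v r_n
    (count_loop r_u r_d (And (Arr a_I r_u) (inp_adj r_v r_u)) ;;
     Sto a_W r_v (And (Not r_rej) (Or (inp_B r_v) (And (inp_S r_v) (Lt r_d r_T))))).

Definition free_S v := And (And (inp_S v) (Not (Arr a_W v))) (Not (Arr a_M v)).

(** The matching stops at 8 D edges. A smaller one is maximal, and moving its ends to W makes S0
    independent; one of 8 D edges supplies as many edges inside S0 as are ever needed. *)
Definition greedy_matching :=
  r_mc <:- Cst 0 ;;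
  SFor r_v r_n (SFor r_u r_n
    (When (And (And (free_S r_v) (free_S r_u)) (And (inp_adj r_v r_u) (Lt r_mc r_D8)))
       (Sto a_M r_v (Cst 1) ;; Sto a_M r_u (Cst 1) ;; r_mc <:- Plus r_mc (Cst 1)))).

Definition setup_large :=
  compute_W0 ;; greedy_matching ;;
  SIf (Lt r_mc r_D8)
    (SFor r_v r_n (Sto a_W r_v (Or (Arr a_W r_v) (Arr a_M r_v))))
    (r_gap <:- r_n) ;;
  SFor r_v r_n (Sto a_S0 r_v (And (inp_S r_v) (Not (Arr a_W r_v)))) ;;
  Sto a_W r_n (Cst 1) ;; Sto a_root r_n (Cst 1).

Definition compute_weights :=
  count_loop r_v r_S0 (Arr a_S0 r_v) ;;
  count_loop r_v r_I0 (Not (Plus (Arr a_W r_v) (Arr a_S0 r_v))) ;;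
  r_m2 <:- Cst 1 ;; r_m4 <:- Cst 1 ;;
  SFor r_v r_n (When (Arr a_W r_v)
    (Sto a_q2 r_v r_m2 ;; Sto a_q4 r_v r_m4 ;;
     r_m2 <:- Dbl r_m2 ;; r_m4 <:- Dbl (Dbl r_m4))) ;;
  r_TB <:- Plus (Dbl (Times r_n r_n)) (Cst 1).

Definition preprocess :=
  compute_delta ;; compute_params ;; SIf r_small setup_small setup_large ;;
  compute_weights.

Definition compute_TM := r_TM <:- Times r_TB r_m4.

(** There is no division, so the digits are found by counting: for argument t, [r_c] is the
    remainder of t modulo the weight of the digit and [r_d] is the digit. *)
Definition digit_table (a q size base : nat) :=
  SFor r_u r_n (When (Arr a_W r_u)
    (r_c <:- Cst 0 ;; r_d <:- Cst 0 ;;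
     SFor r_t size
       (Sto a (Plus (Times r_u size) r_t) r_d ;;
        r_c <:- Plus r_c (Cst 1) ;;
        When (Eqn r_c (Arr q r_u))
          (r_c <:- Cst 0 ;; r_d <:- Plus r_d (Cst 1) ;;
           When (Eqn r_d (Cst base)) (r_d <:- Cst 0))))).

Definition cellT (s r z : exp) := Plus (Times (Plus (Times s r_m2) r) r_m2) z.
Definition digit (u s : exp) := Arr a_dig (Plus (Times u r_TM) s).
Definition bitz (u z : exp) := Arr a_bit (Plus (Times u r_m2) z).

(* One step of Gaussian elimination; row c is zero or has its leading entry at c. *)
Definition insert_row :=
  SFor r_c r_m2 (When (Arr a_V r_c)
    (SIf (Arr a_T (cellT r_s' r_c r_c))
       (SFor r_z r_m2
          (Sto a_V r_z (Plus (Minus (Arr a_V r_z) (Arr a_T (cellT r_s' r_c r_z)))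
                             (Minus (Arr a_T (cellT r_s' r_c r_z)) (Arr a_V r_z)))))
       (SFor r_z r_m2
          (Sto a_T (cellT r_s' r_c r_z) (Arr a_V r_z) ;; Sto a_V r_z (Cst 0))))).

Definition compute_link :=
  SFor r_u r_n1
    (SIf (Eqn r_a r_a')
       (Sto a_link r_u (And (Arr a_W r_u)
          (And (Not (Arr a_W r_a)) (Or (Eqn r_u r_n) (inp_adj r_a r_u)))))
       (Sto a_link r_u (And (And (Arr a_W r_u) (Arr a_W r_a))
          (And (And (Arr a_W r_a') (inp_adj r_a r_a'))
             (Or (Eqn r_u r_a) (Eqn r_u r_a')))))).

Definition try_option :=
  SIf (Eqn r_a r_a')
    (r_st <:- Cst 0 ;; When (Arr a_S0 r_a) (r_st <:- Plus (Lt r_u r_n) (Lt r_w r_n)))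
    (r_st <:- Cst 1) ;;
  r_s' <:- Plus (Plus r_s (Plus (Arr a_q4 r_u) (Arr a_q4 r_w))) (Times r_st r_m4) ;;
  When (Lt r_s' r_TM)
    (SFor r_r r_m2
      (SFor r_z r_m2
        (Sto a_V r_z (And (Arr a_T (cellT r_s r_r r_z)) (Eqn (bitz r_u r_z) (bitz r_w r_z)))) ;;
       insert_row)).

(* States are visited downwards, so that the table can be updated in place:
   adding an edge increases the state. *)
Definition process_group :=
  compute_link ;;
  SFor r_t r_TM
    (r_s <:- Minus (Minus r_TM (Cst 1)) r_t ;;
     SFor r_u r_n1 (SFor r_w r_n1
       (When (And (And (Not (Eqn r_u r_w)) (And (Arr a_link r_u) (Arr a_link r_w)))
               (And (Lt (digit r_u r_s) (Cst 2)) (Lt (digit r_w r_s) (Cst 2))))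
          try_option))).

Definition init_table :=
  SFor r_s' r_TM (SFor r_r r_m2 (SFor r_z r_m2
    (Sto a_T (cellT r_s' r_r r_z) (Cst 0)))) ;;
  SFor r_z r_m2 (Sto a_V r_z (Not (bitz r_x r_z))) ;;
  r_s' <:- Cst 0 ;; insert_row.

Definition count_digits :=
  r_ok <:- Cst 1 ;; r_cnt <:- Cst 0 ;;
  SFor r_u r_n (When (Arr a_W r_u)
    (SIf (Eqn (digit r_u r_s) (Cst 2)) (r_cnt <:- Plus r_cnt (Cst 1))
       (When (digit r_u r_s) (r_ok <:- Cst 0)))) ;;
  When (And r_small (Not (Eqn (digit r_x r_s) (Cst 2)))) (r_ok <:- Cst 0).

(* The three inequalities say that for some g <= r_gap both 2 * (S0 + cnt) - tau - g
   and 2 * I0 + tau + g are at least L; these are the lengths of the cycles with g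
   edges inside S0 that exhaust S0 and I0, respectively. *)
Definition acceptable :=
  And (Leq (Plus r_L r_t) (Dbl (Plus r_S0 r_cnt)))
    (And (Leq r_L (Plus (Dbl r_I0) (Plus r_t r_gap)))
       (Leq (Dbl r_L) (Plus (Dbl (Plus r_S0 r_cnt)) (Dbl r_I0)))).

(* r_par is the number modulo 2 of the cuts left by row r_r whose elements all
   have degree 2 in the state r_s. *)
Definition test_rows :=
  SFor r_r r_m2
    (r_par <:- Cst 0 ;;
     SFor r_z r_m2 (When (Arr a_T (cellT r_s r_r r_z))
       (r_use <:- Cst 1 ;;
        SFor r_u r_n (When (And (Arr a_W r_u) (And (bitz r_u r_z) (Eqn (digit r_u r_s) (Cst 0))))
          (r_use <:- Cst 0)) ;;
        When r_use (r_par <:- Not r_par))) ;;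
     When r_par (r_out <:- Cst 1)).

Definition check_states :=
  SFor r_t r_TB (SFor r_a r_m4
    (r_s <:- Plus (Times r_t r_m4) r_a ;;
     count_digits ;; When (And r_ok acceptable) test_rows)).

Definition solve :=
  init_table ;;
  SFor r_a r_n (SFor r_a' r_n process_group) ;;
  check_states.

Definition search :=
  digit_table a_dig a_q4 r_TM 4 ;; digit_table a_bit a_q2 r_m2 2 ;;
  When (Not r_rej) (SFor r_x r_n1 (When (Arr a_root r_x) solve)).

(** Loop bounds may not be assigned, so the program is checked in segments; a size joins the list
    once the segment that computes it is over. *)
Definition bounds1 := [:: r_n; r_n1].
Definition bounds2 := [:: r_n; r_n1; r_m2; r_m4; r_TB].
Definition bounds3 := [:: r_n; r_n1; r_m2; r_m4; r_TB; r_TM].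

Lemma ok_segments :
  [&& ok_stm [::] read_sizes, ok_stm bounds1 preprocess,
      ok_stm bounds2 compute_TM & ok_stm bounds3 search].
Proof. by vm_compute. Qed.

(** * The dynamic program *)

Definition framed (s : stm) (g h : store) :=
  (forall x, x \notin mods s -> hv g x = hv h x) /\
  (forall a, a \notin wrs s -> ha g a = ha h a).

Lemma framed_den inp s h : framed s (den inp s h) h.
Proof. by split=> [x|a]; [apply: frame_v | apply: frame_a]. Qed.

Lemma fv s g h x : framed s g h -> x \notin mods s -> hv g x = hv h x.
Proof. by case=> + _; apply. Qed.

Lemma fa s g h a : framed s g h -> a \notin wrs s -> ha g a = ha h a.
Proof. by case=> _; apply. Qed.

(** The loop rule with the frame built in: in the step, whatever the loop does not touch still has
    its initial value. *)
Lemma den_loop inp (I : nat -> store -> Prop) x y s h :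
  I 0 h ->
  (forall i g, i < hv h y -> framed (SFor x y s) g h -> I i g ->
    I i.+1 (den inp s (setv g x i))) ->
  I (hv h y) (den inp (SFor x y s) h).
Proof.
move=> I0 step.
suff [] : framed (SFor x y s) (den inp (SFor x y s) h) h /\
    I (hv h y) (den inp (SFor x y s) h) by [].
apply: (@den_for inp (fun i g => framed (SFor x y s) g h /\ I i g)); first by do !split.
move=> i g lt [F Ii]; split; last exact: step.
split=> [z|a] /= zN.
  move: (zN); rewrite inE negb_or => /andP[/negbTE zx zs].
  by rewrite frame_v //= /upd zx (fv F).
by rewrite frame_a //= (fa F).
Qed.

Lemma b2n_not (b : bool) : 1 - b = ~~ b. Proof. by case: b. Qed.
Lemma b2n_and (a b : bool) : a + b - 1 = a && b. Proof. by case: a; case: b. Qed.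
Lemma b2n_or (a b : bool) : 1 - (1 - a - b) = a || b. Proof. by case: a; case: b. Qed.
Lemma b2n_leq x y : 1 - (x - y) = (x <= y).
Proof. by rewrite -subn_eq0; case: (x - y). Qed.
Lemma b2n_lt x y : 1 - (x + 1 - y) = (x < y).
Proof. by rewrite b2n_leq addn1. Qed.
Lemma b2n_eq x y : 1 - (x - y + (y - x)) = (x == y).
Proof. by rewrite eqn_leq -!subn_eq0 -addn_eq0; case: (_ + _). Qed.
Lemma b2n_neq0 (b : bool) : (nat_of_bool b != 0) = b. Proof. by case: b. Qed.
Lemma b2n_xor (a b : bool) : a - b + (b - a) = a (+) b. Proof. by case: a; case: b. Qed.

Definition b2nE := (b2n_or, b2n_not, b2n_and, b2n_eq, b2n_lt, b2n_xor, b2n_neq0).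

Lemma mulD_inj k a b c d : b < k -> d < k -> a * k + b = c * k + d -> a = c /\ b = d.
Proof.
move=> bk dk E; have k0 : 0 < k by apply: leq_ltn_trans bk.
have : (a * k + b) %/ k = (c * k + d) %/ k by rewrite E.
rewrite !divnMDl // !divn_small // !addn0 => Ea.
by split=> //; move: E; rewrite Ea => /addnI.
Qed.

Arguments den : simpl never.

Lemma den_seq inp s1 s2 h : den inp (s1 ;; s2) h = den inp s2 (den inp s1 h).
Proof. by []. Qed.
Lemma den_asg inp x e h : den inp (x <:- e) h = setv h x (eval inp h e).
Proof. by []. Qed.
Lemma den_sto inp a e1 e2 h : den inp (Sto a e1 e2) h = seta h a (eval inp h e1) (eval inp h e2).
Proof. by []. Qed.
Lemma den_if inp e s1 s2 h :
  den inp (SIf e s1 s2) h = if eval inp h e != 0 then den inp s1 h else den inp s2 h.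
Proof. by []. Qed.
Lemma den_when inp e s h : den inp (When e s) h = if eval inp h e != 0 then den inp s h else h.
Proof. by []. Qed.

(** * The table: elimination, insertion of edges, final test *)

Section Core.
Variables (inp : nat -> nat) (n : nat) (eN : rel nat) (W S0 : pred nat) (TB : nat).

Let M2 := wt W 2 n.
Let M4 := wt W 4 n.
Let TM := TB * M4.

Definition cell s r z := (s * M2 + r) * M2 + z.
Definition tab h s r z : bool := ha h a_T (cell s r z) != 0.

Lemma cell_inj s r z s' r' z' : r < M2 -> z < M2 -> r' < M2 -> z' < M2 ->
  (cell s r z == cell s' r' z') = [&& s == s', r == r' & z == z'].
Proof.
move=> rM zM rM' zM'; apply/eqP/idP => [/(mulD_inj zM zM')[/(mulD_inj rM rM')[-> ->] ->]|].
  by rewrite !eqxx.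
by case/and3P=> /eqP-> /eqP-> /eqP->.
Qed.

Definition env_v := [:: r_n; r_n1; r_m2; r_m4; r_TB; r_TM; r_small; r_L; r_S0; r_I0; r_gap; r_rej].
Definition env_a := [:: a_W; a_S0; a_q4; a_dig; a_bit; a_root].

Definition same_env g h :=
  {in env_v, forall x, hv g x = hv h x} /\ {in env_a, forall a, ha g a = ha h a}.

Record env (h : store) : Prop := Env {
  env_n : hv h r_n = n;
  env_n1 : hv h r_n1 = n.+1;
  env_m2 : hv h r_m2 = M2;
  env_m4 : hv h r_m4 = M4;
  env_TB : hv h r_TB = TB;
  env_TM : hv h r_TM = TM;
  env_W : forall u, u <= n -> ha h a_W u = W u;
  env_S0 : forall u, u < n -> ha h a_S0 u = S0 u;
  env_q4 : forall u, u <= n -> ha h a_q4 u = ad n W u;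
  env_dig : forall u s, u <= n -> s < TM -> ha h a_dig (u * TM + s) = dgt n W s u;
  env_bit : forall u z, u <= n -> z < M2 -> ha h a_bit (u * M2 + z) = bit n W z u
}.

Lemma env_same g h : same_env g h -> env h -> env g.
Proof.
by case=> sv sa []; split; rewrite ?sv // => *; rewrite sa //; auto.
Qed.

Lemma framed_same s g h : all (fun x => x \notin mods s) env_v ->
  all (fun a => a \notin wrs s) env_a -> framed s g h -> same_env g h.
Proof.
by move=> /allP mv /allP ma F; split=> x xin; [rewrite (fv F) ?mv | rewrite (fa F) ?ma].
Qed.

Lemma setv_same g x i : x \notin env_v -> same_env (setv g x i) g.
Proof.
by move=> xN; split=> // y yin /=; rewrite /upd; case: eqP => // yx; rewrite -yx yin in xN.
Qed.

(** Echelon form with each row stored at the index of its pivot and zero rows at the other indices,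
    so that a vector is reduced in one pass over the positions. *)
Definition wf h s :=
  [/\ forall r z, r < M2 -> z < M2 -> ha h a_T (cell s r z) <= 1,
      forall r z, r < M2 -> z < r -> tab h s r z = false
    & forall r z, r < M2 -> z < M2 -> tab h s r r = false -> tab h s r z = false].

(** A functional is nonzero somewhere on the span of the rows iff it is nonzero on a row. Taken over
    all [phi], this predicate determines the span. *)
Definition sem h s phi := exists2 r, r < M2 & par M2 phi (tab h s r).

Lemma tab_val h s r z : wf h s -> r < M2 -> z < M2 -> ha h a_T (cell s r z) = tab h s r z.
Proof. by case=> le1 _ _ rM zM; rewrite /tab; case: (ha h a_T _) (le1 r z rM zM) => [|[|]]. Qed.

Lemma eq_wf h g s : (forall r z, r < M2 -> z < M2 -> ha g a_T (cell s r z) = ha h a_T (cell s r z)) ->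
  wf h s -> wf g s.
Proof.
move=> E [w1 w2 w3]; split.
- by move=> r z rM zM; rewrite E // w1.
- by move=> r z rM zr; rewrite /tab E ?(ltn_trans zr) //; apply: w2.
by move=> r z rM zM; rewrite /tab !E //; apply: w3.
Qed.

Lemma eq_sem h g s phi :
  (forall r z, r < M2 -> z < M2 -> ha g a_T (cell s r z) = ha h a_T (cell s r z)) ->
  sem h s phi -> sem g s phi.
Proof.
move=> E [r rM pr]; exists r => //; move: pr.
by rewrite (@eq_par _ _ _ (tab g s r)) // => z zM; rewrite /tab E.
Qed.

Definition xor_loop := SFor r_z r_m2
  (Sto a_V r_z (Plus (Minus (Arr a_V r_z) (Arr a_T (cellT r_s' r_c r_z)))
                     (Minus (Arr a_T (cellT r_s' r_c r_z)) (Arr a_V r_z)))).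

Definition store_loop := SFor r_z r_m2
  (Sto a_T (cellT r_s' r_c r_z) (Arr a_V r_z) ;; Sto a_V r_z (Cst 0)).

Lemma xor_loopP h (v : pred nat) s c :
  hv h r_m2 = M2 -> hv h r_s' = s -> hv h r_c = c -> c < M2 -> wf h s ->
  (forall z, z < M2 -> ha h a_V z = v z) ->
  forall z, z < M2 -> ha (den inp xor_loop h) a_V z = v z (+) tab h s c z.
Proof.
move=> hm hs hc cM wfs hV.
pose I i g := forall z, z < M2 -> ha g a_V z = if z < i then v z (+) tab h s c z else v z.
have : I (hv h r_m2) (den inp xor_loop h).
  apply: den_loop => [z zM|i g]; first by rewrite hV.
  rewrite hm => iM F Ig z zM; rewrite den_sto /= /upd /=.
  rewrite !(fv F (x := r_s')) // !(fv F (x := r_c)) // !(fv F (x := r_m2)) //.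
  rewrite hs hc hm !(fa F (a := a_T)) // tab_val // Ig //.
  rewrite ltnS; case: (ltngtP z i) => [zi|iz|->]; rewrite ?Ig // ?ltnn ?b2nE //.
    by rewrite zi.
  by rewrite ltnNge (ltnW iz).
by rewrite hm => Ie z zM; rewrite Ie // zM.
Qed.

Lemma store_loopP h (v : pred nat) s c :
  hv h r_m2 = M2 -> hv h r_s' = s -> hv h r_c = c -> c < M2 ->
  (forall z, z < M2 -> ha h a_V z = v z) ->
  [/\ forall z, z < M2 -> ha (den inp store_loop h) a_V z = 0,
      forall z, z < M2 -> ha (den inp store_loop h) a_T (cell s c z) = v z
    & forall s' r z, r < M2 -> z < M2 -> (s' != s) || (r != c) ->
        ha (den inp store_loop h) a_T (cell s' r z) = ha h a_T (cell s' r z)].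
Proof.
move=> hm hs hc cM hV.
pose I i g := [/\ forall z, z < M2 -> ha g a_V z = if z < i then 0 else v z,
      forall z, z < i -> ha g a_T (cell s c z) = v z
    & forall s' r z, r < M2 -> z < M2 -> (s' != s) || (r != c) ->
        ha g a_T (cell s' r z) = ha h a_T (cell s' r z)].
have : I (hv h r_m2) (den inp store_loop h).
  apply: den_loop => [|i g]; first by split.
  rewrite hm => iM F [I1 I2 I3]; rewrite den_seq !den_sto /= /upd /=.
  have Ec z : (hv g r_s' * hv g r_m2 + hv g r_c) * hv g r_m2 + z = cell s c z.
    by rewrite (fv F (x := r_s')) // (fv F (x := r_c)) // (fv F (x := r_m2)) // hs hc hm.
  rewrite Ec; split=> /=.
  - move=> z zM; rewrite updE ltnS; case: (ltngtP z i) => [zi|iz|//]; rewrite I1 ?zi //.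
    by rewrite ltnNge (ltnW iz).
  - move=> z; rewrite updE ltnS => zi; have zM := leq_ltn_trans zi iM.
    rewrite cell_inj // !eqxx /=; case: eqP => [->|/eqP zNi]; first by rewrite I1 // ltnn.
    by apply: I2; rewrite ltn_neqAle zNi.
  move=> s' r z rM zM ne; rewrite updE cell_inj // -negb_and in ne *.
  by rewrite andbA (negbTE ne); apply: I3; rewrite // -negb_and.
by rewrite hm => -[I1 I2 I3]; split=> // z zM; rewrite ?I1 ?I2 // zM.
Qed.

Definition same_T_but (s : nat) (g h : store) :=
  forall s' r z, r < M2 -> z < M2 -> s' != s -> ha g a_T (cell s' r z) = ha h a_T (cell s' r z).

Lemma insert_rowP h (v : pred nat) s :
  hv h r_m2 = M2 -> hv h r_s' = s -> wf h s ->
  (forall z, z < M2 -> ha h a_V z = v z) ->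
  let h' := den inp insert_row h in
  [/\ wf h' s, same_T_but s h' h
    & forall phi, sem h' s phi <-> sem h s phi \/ par M2 phi v].
Proof.
move=> hm hs wfs hV /=.
(* [w] is what is left of [v] after reduction by the pivots below [c]; together with the rows it
   spans the same space as [v] with the original rows. It becomes zero when it is stored as a new
   row. *)
pose I c g := exists w : pred nat,
  [/\ forall z, z < M2 -> ha g a_V z = w z, forall z, z < c -> z < M2 -> w z = false,
     wf g s, same_T_but s g h
   & forall phi, (sem g s phi \/ par M2 phi w) <-> (sem h s phi \/ par M2 phi v)].
have : I (hv h r_m2) (den inp insert_row h).
  apply: den_loop => [|c g]; first by exists v; split.
  rewrite hm => cM F [w [gV w0 wfg others eqv]].
  set g1 := setv g r_c c.
  have g1m : hv g1 r_m2 = M2 by rewrite /= /upd /= (fv F).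
  have g1s : hv g1 r_s' = s by rewrite /= /upd /= (fv F).
  have g1c : hv g1 r_c = c by [].
  have wfg1 : wf g1 s by [].
  have g1V z : z < M2 -> ha g1 a_V z = w z by apply: gV.
  have le_c z : z <= c -> w c = false -> z < M2 -> w z = false.
    by rewrite leq_eqVlt => /orP[/eqP->|zc] // _ zM; apply: w0.
  rewrite den_when den_if -/xor_loop -/store_loop /= /upd /= gV // b2n_neq0.
  have -> : (hv g r_s' * hv g r_m2 + c) * hv g r_m2 + c = cell s c c.
    by rewrite (fv F (x := r_s')) // (fv F (x := r_m2)) // hs hm.
  case: ifP => wc; last first.
    by exists w; split=> // z; rewrite ltnS => zc; apply: le_c.
  rewrite -/(tab g s c c).
  have [piv|npiv] := boolP (tab g s c c).
    have xV := xor_loopP g1m g1s g1c cM wfg1 g1V.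
    exists (fun z => w z (+) tab g s c z); split=> //.
    - move=> z; rewrite ltnS leq_eqVlt => /orP[/eqP->|zc] zM; first by rewrite wc piv.
      by rewrite w0 //; case: wfg => _ -> .
    - by apply: eq_wf wfg => r z rM zM; rewrite frame_a.
    - by move=> s' r z rM zM ne; rewrite frame_a //; apply: others.
    move=> phi; rewrite -eqv par_xor; split.
      case=> [sg|]; first by left; apply: eq_sem sg => r z rM zM; rewrite frame_a.
      case: (boolP (par M2 phi w)) => pw; first by right.
      by rewrite /= => pc; left; exists c.
    case=> [sg|->]; first by left; apply: eq_sem sg => r z rM zM; rewrite frame_a.
    case: (boolP (par M2 phi (tab g s c))) => pc; last by right.
    by left; exists c => //; rewrite (@eq_par _ _ _ (tab g s c)) // => z _; rewrite /tab frame_a.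
  have [V0 Tc To] := store_loopP g1m g1s g1c cM g1V.
  have row0 z : z < M2 -> tab g s c z = false.
    by move=> zM; case: wfg => _ _; apply=> //; apply/negbTE.
  have tabc z : z < M2 -> tab (den inp store_loop g1) s c z = w z.
    by move=> zM; rewrite /tab Tc // b2n_neq0.
  have tabo r z : r < M2 -> z < M2 -> r != c -> tab (den inp store_loop g1) s r z = tab g s r z.
    by move=> rM zM rc; rewrite /tab To // rc orbT.
  exists pred0; split=> //.
  - case: wfg => wa wb wd; split.
    + move=> r z rM zM; case: (eqVneq r c) => [->|rc]; first by rewrite Tc //; case: (w z).
      by rewrite To ?rc ?orbT // wa.
    + move=> r z rM zr; have zM := ltn_trans zr rM.
      case: (eqVneq r c) => [Er|rc]; last by rewrite tabo // wb.
      by rewrite Er tabc // w0 // -Er.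
    move=> r z rM zM; case: (eqVneq r c) => [->|rc]; first by rewrite tabc // wc.
    by rewrite !tabo //; apply: wd.
  - by move=> s' r z rM zM ne; rewrite To ?ne //; apply: others.
  move=> phi; rewrite -eqv; split.
    case=> [[r rM]|]; last by rewrite par0.
    case: (eqVneq r c) => [->|rc]; first by rewrite (eq_par _ tabc); right.
    by rewrite (@eq_par _ _ _ (tab g s r)) => [pr|z zM]; [left; exists r | apply: tabo].
  case=> [[r rM pr]|pw]; left; last by exists c => //; rewrite (eq_par _ tabc).
  case: (eqVneq r c) pr => [->|rc pr]; first by rewrite par0.
  by exists r => //; rewrite (@eq_par _ _ _ (tab g s r)) // => z zM; apply: tabo.
rewrite hm => -[w [_ w0 wfe oe eqv]]; split=> // phi; rewrite -eqv.
by rewrite (@par0 _ _ w) => [|z zM]; [split=> [|[]//]; left | apply: w0].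
Qed.

Lemma same_T_sem s g h s' phi : same_T_but s g h -> s' != s -> sem g s' phi <-> sem h s' phi.
Proof. by move=> E ne; split; apply: eq_sem => r z rM zM; rewrite E. Qed.

Lemma same_T_wf s g h s' : same_T_but s g h -> s' != s -> wf h s' -> wf g s'.
Proof. by move=> E ne; apply: eq_wf => r z rM zM; rewrite E. Qed.

Variables (r : nat).
Hypothesis r_le : r <= n.
Let reach := reach n eN W S0 r TB.

Definition represents gs h :=
  forall s, s < TM -> wf h s /\ forall phi, sem h s phi <-> reach gs s phi.

Definition zero_T := SFor r_s' r_TM (SFor r_r r_m2 (SFor r_z r_m2
    (Sto a_T (cellT r_s' r_r r_z) (Cst 0)))).

Lemma zero_TP h : hv h r_m2 = M2 -> hv h r_TM = TM ->
  forall s r z, s < TM -> r < M2 -> z < M2 -> ha (den inp zero_T h) a_T (cell s r z) = 0.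
Proof.
move=> hm ht.
pose I i g := forall s r z, s < i -> r < M2 -> z < M2 -> ha g a_T (cell s r z) = 0.
have : I (hv h r_TM) (den inp zero_T h).
  apply: den_loop => // i g _ F Ii; set g1 := setv g r_s' i.
  have m1 : hv g1 r_m2 = M2 by rewrite /= /upd /= (fv F).
  pose J j k := I i k /\ forall r z, r < j -> z < M2 -> ha k a_T (cell i r z) = 0.
  have [] : J (hv g1 r_m2) (den inp (SFor r_r r_m2 (SFor r_z r_m2
      (Sto a_T (cellT r_s' r_r r_z) (Cst 0)))) g1).
    apply: den_loop => // j k jM F1 [Ik Jk]; rewrite m1 in jM; set k1 := setv k r_r j.
    have m2 : hv k1 r_m2 = M2 by rewrite /= /upd /= (fv F1).
    pose K l k' := J j k' /\ forall z, z < l -> ha k' a_T (cell i j z) = 0.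
    have [] : K (hv k1 r_m2) (den inp (SFor r_z r_m2 (Sto a_T (cellT r_s' r_r r_z) (Cst 0))) k1).
      apply: den_loop => // l k' lM F2 [[Ik' Jk'] Kk']; rewrite m2 in lM.
      rewrite den_sto /= /upd /=.
      have -> : (hv k' r_s' * hv k' r_m2 + hv k' r_r) * hv k' r_m2 + l = cell i j l.
        rewrite !(fv F2 (x := r_s')) // !(fv F2 (x := r_m2)) // !(fv F2 (x := r_r)) // m2.
        by rewrite /= /upd /= (fv F1).
      split; [split|] => [s r0 z|r0 z|z]; rewrite ?updE => *; rewrite /= updE; case: eqP => // ne;
        [by apply: Ik' | by apply: Jk' | apply: Kk'].
      rewrite ltn_neqAle -ltnS; apply/andP; split=> //.
      by apply/eqP => Ezl; rewrite Ezl in ne.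
    rewrite m2 => -[Ij Jj] Kj; split=> // r0 z; rewrite ltnS leq_eqVlt => /orP[/eqP->|r0j] zM.
      exact: Kj.
    exact: Jj.
  rewrite m1 => Ii' Ji' s r0 z; rewrite ltnS leq_eqVlt => /orP[/eqP->|si] r0M zM; first exact: Ji'.
  exact: Ii'.
by rewrite ht.
Qed.

Lemma init_tableP h : env h -> hv h r_x = r -> represents [::] (den inp init_table h).
Proof.
move=> eh hx; rewrite /init_table !den_seq -/zero_T.
set h1 := den inp zero_T h.
have F1 := framed_den inp zero_T h; rewrite -/h1 in F1.
have z1 := zero_TP (env_m2 eh) (env_TM eh); rewrite -/h1 in z1.
set h2 := den inp (SFor r_z _ _) h1.
have F2 : framed _ h2 h1 := framed_den inp _ h1.
have eh1 : env h1 by apply: env_same eh; apply: framed_same F1.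
have hx1 : hv h1 r_x = r by rewrite (fv F1).
have V2 : forall z, z < M2 -> ha h2 a_V z = init_vec n W r z.
  pose I i g := forall z, z < i -> z < M2 -> ha g a_V z = init_vec n W r z.
  suff : I (hv h1 r_m2) h2 by rewrite (env_m2 eh1) => I2 z zM; apply: I2.
  apply: den_loop => // i g iM F Ii; rewrite (env_m2 eh1) in iM; rewrite den_sto /= /upd /=.
  have eg : env g by apply: env_same eh1; apply: framed_same F.
  rewrite (fv F (x := r_x)) // hx1 (env_m2 eg) (env_bit eg) // b2n_not.
  move=> z; rewrite /= updE ltnS leq_eqVlt => /orP[/eqP->|zi] zM; first by rewrite eqxx.
  by rewrite ltn_eqF // Ii.
rewrite den_asg; set h3 := setv h2 r_s' _.
have eh3 : env h3.
  apply: (env_same (h := h2)); first exact: setv_same.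
  by apply: env_same eh1; apply: framed_same F2.
have cell3 s r0 z : s < TM -> r0 < M2 -> z < M2 -> ha h3 a_T (cell s r0 z) = 0.
  by move=> *; rewrite /= (fa F2) // z1.
have wf3 s : s < TM -> wf h3 s.
  move=> sM; split=> [r0 z rM zM|r0 z rM zr|r0 z rM zM _]; rewrite /tab cell3 //.
  exact: ltn_trans rM.
have sem3 s phi : s < TM -> ~ sem h3 s phi.
  move=> sM [r0 rM]; rewrite par0 // => z zM; by rewrite /tab cell3.
have V3 z : z < M2 -> ha h3 a_V z = init_vec n W r z by apply: V2.
move=> s sM; have T0 : 0 < TM by apply: leq_ltn_trans sM.
have [w4 o4 e4] := insert_rowP (s := 0) (env_m2 eh3) erefl (wf3 0 T0) V3.
case: (eqVneq s 0) => [Es|s0].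
  rewrite Es; split=> // phi; rewrite e4; split=> [[/(sem3 0 _ T0)//|]|[_]]; first by split.
  by right.
split; first exact: same_T_wf o4 s0 (wf3 s sM).
move=> phi; rewrite (same_T_sem _ o4 s0); split=> [/(sem3 s _ sM)//|[Es]].
by rewrite Es eqxx in s0.
Qed.

Hypothesis inp_adjE : forall u v, u < n -> v < n -> inp (2 + n + n + u * n + v) = eN u v.

Lemma compute_linkP h a b : env h -> hv h r_a = a -> hv h r_a' = b -> a < n -> b < n ->
  forall u, u <= n -> ha (den inp compute_link h) a_link u = link n eN W a b u.
Proof.
move=> eh Ha Hb an bn.
pose I i g := forall u, u < i -> ha g a_link u = link n eN W a b u.
suff : I (hv h r_n1) (den inp compute_link h).
  by rewrite (env_n1 eh) => H u un; apply: H.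
apply: den_loop => // i g; rewrite (env_n1 eh) ltnS => iN F Ii.
have eg : env g by apply: env_same eh; apply: framed_same F.
rewrite den_if !den_sto /= /upd /= (fv F (x := r_a)) // (fv F (x := r_a')) // Ha Hb.
rewrite !(env_n eg) b2n_eq b2n_neq0 (env_W eg) // (env_W eg) ?(ltnW an) // (env_W eg) ?(ltnW bn) //.
have -> : (if a == b then seta (setv g 7 i) 11 i (W i + (1 - W a + (1 - (1 - (1 - (i - n + (n - i))) - inp (2 + n + n + a * n + i))) - 1) - 1)
   else seta (setv g 7 i) 11 i (W i + W a - 1 + (W b + inp (2 + n + n + a * n + b) - 1 + (1 - (1 - (1 - (i - a + (a - i))) - (1 - (i - b + (b - i))))) - 1) - 1))
   = seta (setv g 7 i) 11 i (link n eN W a b i).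
  rewrite /link; case: ifP => ab; congr seta.
    have [iln|iNn] := ltnP i n.
      by rewrite inp_adjE // b2n_eq b2n_or b2n_not !b2n_and.
    have -> : i = n by apply/eqP; rewrite eqn_leq iN.
    by rewrite b2n_eq eqxx subnn sub0n subn0 orTb b2n_not (b2n_and _ true) b2n_and.
  by rewrite inp_adjE // !b2n_eq b2n_or !b2n_and -!andbA.
move=> u; rewrite /= updE ltnS leq_eqVlt => /orP[/eqP->|ui]; first by rewrite eqxx.
by rewrite ltn_eqF // Ii.
Qed.

Definition mask_loop := SFor r_z r_m2
  (Sto a_V r_z (And (Arr a_T (cellT r_s r_r r_z)) (Eqn (bitz r_u r_z) (bitz r_w r_z)))).

Lemma mask_loopP h s j u w : env h -> hv h r_s = s -> hv h r_r = j -> hv h r_u = u -> hv h r_w = w ->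
  j < M2 -> u <= n -> w <= n -> wf h s ->
  forall z, z < M2 -> ha (den inp mask_loop h) a_V z = tab h s j z && (bit n W z u == bit n W z w).
Proof.
move=> eh hs hj hu hw jM un wn wfs.
pose I i g := forall z, z < i -> z < M2 -> ha g a_V z = tab h s j z && (bit n W z u == bit n W z w).
suff : I (hv h r_m2) (den inp mask_loop h).
  by rewrite (env_m2 eh) => H z zM; apply: H.
apply: den_loop => // i g; rewrite (env_m2 eh) => iM F Ii.
have eg : env g by apply: env_same eh; apply: framed_same F.
rewrite den_sto /= /upd /= (fv F (x := r_s)) // (fv F (x := r_r)) // (fv F (x := r_u)) //.
rewrite (fv F (x := r_w)) // hs hj hu hw (env_m2 eg) !(env_bit eg) //.
rewrite (fa F (a := a_T)) // (tab_val wfs) // b2n_eq b2n_and.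
have eqb (x y : bool) : ((x : nat) == y) = (x == y) by case: x; case: y.
move=> z; rewrite /= updE ltnS leq_eqVlt => /orP[/eqP->|zi] zM; first by rewrite eqxx eqb.
by rewrite ltn_eqF // Ii.
Qed.

(** A positive [delta] makes the target state differ from [s], so the rows of [s] that are read do
    not change while rows are inserted. *)
Lemma try_optionP k s a b u w (x : edge := ((a, b), (u, w))) : env k ->
  hv k r_s = s -> hv k r_u = u -> hv k r_w = w -> hv k r_a = a -> hv k r_a' = b ->
  s < TM -> u <= n -> w <= n -> a < n -> b < n -> 0 < delta n W S0 x ->
  (forall d, d < TM -> wf k d) ->
  let k' := den inp try_option k in
  (forall d, d < TM -> wf k' d) /\
  forall d phi, d < TM -> (sem k' d phi <->
    sem k d phi \/ (d = s + delta n W S0 x /\ sem k s (fun z => phi z && agree n W x z))).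
Proof.
move=> ek hs hu hw Ha Hb sM un wn an bn dpos wfk /=.
set s1 := s + delta n W S0 x.
rewrite /try_option !den_seq.
set k1 := den inp (SIf _ _ _) k.
have k1T : hv k1 r_st = stat n S0 x /\ framed (r_st <:- Cst 0) k1 k.
  rewrite /k1 den_if den_seq den_when !den_asg /= /upd /= Ha Hb b2n_eq b2n_neq0 /stat /= /src /tgt /=.
  case: ifP => ab; last by split=> //; split=> // y yN /=; rewrite updE; move: yN; rewrite inE => /negbTE->.
  rewrite (env_S0 ek) // b2n_neq0; case: ifP => Sa /=.
    rewrite updE hu hw (env_n ek) !b2n_lt mul1n; split=> //; split=> // y yN /=.
    by move: yN; rewrite !updE inE => /negbTE->.
  by rewrite mul0n; split=> //; split=> // y yN /=; rewrite updE; move: yN; rewrite inE => /negbTE->.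
case: k1T => k1st F1.
rewrite den_asg; set k2 := setv k1 r_s' _.
have k2s' : hv k2 r_s' = s1.
  rewrite /k2 /= /upd /= k1st !(fv F1) // !(fa F1) // hs hu hw (env_m4 ek) !(env_q4 ek) //.
  by rewrite -addnA.
have F2 : framed (r_st <:- Cst 0 ;; r_s' <:- Cst 0) k2 k.
  split=> [y yN|c cN] /=; last by rewrite (fa F1).
  by rewrite /= !inE negb_or in yN; case/andP: yN => y1 y2; rewrite updE (negbTE y2) (fv F1) // inE.
have e2 : env k2 by apply: env_same ek; apply: framed_same F2.
have T2 : ha k2 a_T = ha k a_T by rewrite (fa F2).
have wf2 d : d < TM -> wf k2 d.
  by move=> dM; apply: eq_wf (wfk d dM) => r0 z _ _; rewrite T2.
have sem2 d phi : sem k2 d phi <-> sem k d phi.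
  by split; apply: eq_sem => r0 z _ _; rewrite T2.
rewrite den_when; have -> : (eval inp k2 (Lt r_s' r_TM) != 0) = (s1 < TM).
  by rewrite -[eval _ _ _]/(1 - (hv k2 r_s' + 1 - hv k2 r_TM)) k2s' (env_TM e2) b2n_lt b2n_neq0.
case: ifP => s1M; last first.
  split=> [d /wf2//|d phi dM]; rewrite sem2; split=> [|[//|[Ed _]]]; first by left.
  by rewrite -Ed dM in s1M.
pose I j g := [/\ forall d, d < TM -> wf g d, same_T_but s1 g k2
  & forall phi, sem g s1 phi <-> sem k s1 phi \/
      exists2 r0, r0 < j & r0 < M2 /\ par M2 (fun z => phi z && agree n W x z) (tab k s r0)].
have ss1 : s != s1 by rewrite /s1; lia.
have : I (hv k2 r_m2) (den inp (SFor r_r r_m2 (mask_loop ;; insert_row)) k2).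
  apply: den_loop => [|j g].
    by split=> // phi; rewrite sem2; split=> [|[//|[]//]]; left.
  rewrite (env_m2 e2) => jM F [I1 I2 I3]; rewrite den_seq.
  have eg : env (setv g r_r j).
    apply: (env_same (h := g)); first exact: setv_same.
    by apply: env_same e2; apply: framed_same F.
  set g1 := setv g r_r j in eg *.
  have wg1 d : d < TM -> wf g1 d by apply: I1.
  have gv y : y \notin mods (SFor r_r r_m2 (mask_loop ;; insert_row)) ->
      y \notin [:: r_st; r_s'; r_r] -> hv g1 y = hv k y.
    move=> yN; rewrite !inE !negb_or => /and3P[y1 y2 y3].
    by rewrite /= updE (negbTE y3) (fv F) // (fv F2) //= !inE negb_or y1.
  have := mask_loopP eg (gv r_s isT isT) erefl (gv r_u isT isT) (gv r_w isT isT).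
  rewrite hs hu hw => /(_ jM un wn (wg1 s sM)); set g2 := den inp mask_loop g1 => V2.
  have F3 : framed mask_loop g2 g1 := framed_den inp mask_loop g1.
  have e3 : env g2 by apply: env_same eg; apply: framed_same F3.
  have T3 : ha g2 a_T = ha g a_T by rewrite (fa F3).
  have s3 : hv g2 r_s' = s1 by rewrite (fv F3) //= /upd /= (fv F).
  have w3 d : d < TM -> wf g2 d.
    by move=> dM; apply: eq_wf (I1 d dM) => r0 z _ _; rewrite T3.
  have [w4 o4 e4] := insert_rowP (env_m2 e3) s3 (w3 _ s1M) V2.
  split.
  - move=> d dM; case: (eqVneq d s1) => [->//|ds1]; exact: same_T_wf o4 ds1 (w3 d dM).
  - by move=> s' r0 z r0M zM ne; rewrite o4 // T3 I2.
  move=> phi; rewrite e4.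
  have -> : sem g2 s1 phi <-> sem g s1 phi by split; apply: eq_sem => r0 z _ _; rewrite T3.
  have tabE z : z < M2 -> tab g1 s j z = tab k s j z by move=> zM; rewrite /tab /= I2 // T2.
  rewrite I3 (@eq_par _ _ _ (fun z => tab k s j z && agree n W x z)); last first.
    by move=> z zM; rewrite tabE.
  rewrite par_mask; split.
    case=> [[h|[r0 r0j h]]|h]; [by left | right | right].
      by exists r0 => //; apply: ltnW.
    by exists j.
  case=> [h|[r0 + [r0M h]]]; first by left; left.
  by rewrite ltnS leq_eqVlt => /orP[/eqP<-|r0j]; [right | left; right; exists r0].
rewrite (env_m2 e2) => -[I1 I2 I3]; split=> // d phi dM.
case: (eqVneq d s1) => [->|ds1].
  rewrite I3; split.
    by case=> [h|[r0 r0M [_ h]]]; [left | right; split=> //; exists r0].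
  by case=> [h|[_ [r0 r0M h]]]; [left | right; exists r0].
rewrite (same_T_sem _ I2 ds1) sem2; split=> [|[//|[Ed _]]]; first by left.
by rewrite Ed eqxx in ds1.
Qed.

Lemma delta_gt0 x : opt n eN W x -> 0 < delta n W S0 x.
Proof.
move=> ox; have /andP[sl tl] := opt_le ox; have /andP[Ws Wt] := opt_W ox.
have ne : src x != tgt x by case/and5P: ox => _ _ _ _ /and3P[].
have adp u : u < n -> W u -> 0 < ad n W u by move=> un Wu; rewrite /ad Wu un wt_gt0.
rewrite /delta; have [sn|ns] := ltnP (src x) n; first by have := adp _ sn Ws; lia.
have [tn|nt] := ltnP (tgt x) n; first by have := adp _ tn Wt; lia.
by case/eqP: ne; apply/eqP; rewrite eqn_leq; lia.
Qed.

Definition valid a b s u w :=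
  opt n eN W ((a, b), (u, w)) && (dgt n W s u < 2) && (dgt n W s w < 2).

Definition pair_loop := SFor r_u r_n1 (SFor r_w r_n1
  (When (And (And (Not (Eqn r_u r_w)) (And (Arr a_link r_u) (Arr a_link r_w)))
          (And (Lt (digit r_u r_s) (Cst 2)) (Lt (digit r_w r_s) (Cst 2))))
     try_option)).

Lemma pair_loopP h a b s : env h -> hv h r_a = a -> hv h r_a' = b -> a < n -> b < n ->
  hv h r_s = s -> s < TM -> (forall d, d < TM -> wf h d) ->
  (forall u, u <= n -> ha h a_link u = link n eN W a b u) ->
  let h' := den inp pair_loop h in
  (forall d, d < TM -> wf h' d) /\
  forall d phi, d < TM -> (sem h' d phi <-> sem h d phi \/
    exists u w, [/\ valid a b s u w, d = s + delta n W S0 ((a, b), (u, w))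
      & sem h s (fun z => phi z && agree n W ((a, b), (u, w)) z)]).
Proof.
move=> eh Ha Hb an bn hs sM wfh linkE /=.
pose St g := [/\ env g, hv g r_a = a /\ hv g r_a' = b, hv g r_s = s
  & forall u, u <= n -> ha g a_link u = link n eN W a b u].
pose Done i j u w := (u < i) || (u == i) && (w < j).
pose Extra i j d phi := exists u w, [/\ Done i j u w, valid a b s u w,
  d = s + delta n W S0 ((a, b), (u, w))
  & sem h s (fun z => phi z && agree n W ((a, b), (u, w)) z)].
pose K i j g := [/\ St g, forall d, d < TM -> wf g d &
  forall d phi, d < TM -> (sem g d phi <-> sem h d phi \/ Extra i j d phi)].
have St_setv g x i : x \notin [:: r_a; r_a'; r_s] ++ env_v -> St g -> St (setv g x i).
  move=> xN [e1 [e2 e3] e4 e5].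
  rewrite mem_cat negb_or in xN; case/andP: xN => x1 x2.
  have upx y : y \in [:: r_a; r_a'; r_s] -> hv (setv g x i) y = hv g y.
    by move=> yin /=; rewrite updE; case: eqP => // Eyx; rewrite -Eyx yin in x1.
  split; rewrite ?upx //; apply: env_same e1; exact: setv_same.
have K_ext i j i' j' g : (forall u w, w <= n -> Done i j u w = Done i' j' u w) ->
    K i j g -> K i' j' g.
  move=> D12 [k1 k2 k3]; split=> // d phi dM; rewrite k3 //.
  have wle u w : valid a b s u w -> w <= n.
    by case/andP=> /andP[/opt_le/andP[_]].
  split=> -[|[u [w [D v E H]]]]; try (by left); right; exists u, w; split=> //.
    by rewrite -D12 // (wle _ _ v).
  by rewrite D12 // (wle _ _ v).
(* Each insertion goes to a state above [s], so the source is intact for all pairs of ends. *)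
have sem_s i j g : K i j g -> forall phi, sem g s phi <-> sem h s phi.
  case=> _ _ k3 phi; rewrite k3 //; split=> [[//|[u [w [_ v E _]]]]|]; last by left.
  by case/andP: v => /andP[/delta_gt0 pos _] _; lia.
have step i j g : i <= n -> j <= n -> K i j g -> hv g r_u = i -> hv g r_w = j ->
    K i j.+1 (den inp (When (And (And (Not (Eqn r_u r_w)) (And (Arr a_link r_u) (Arr a_link r_w)))
          (And (Lt (digit r_u r_s) (Cst 2)) (Lt (digit r_w r_s) (Cst 2)))) try_option) g).
  move=> iN jN Kg gu gw; have [[eg [ga gb] gs gl] wg sg] := Kg.
  rewrite den_when /= gu gw gs (env_TM eg) !gl // !(env_dig eg) //.
  rewrite !b2n_eq !b2n_not !b2n_lt !b2n_and b2n_neq0.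
  have -> : [&& ~~ (i == j) && (link n eN W a b i && link n eN W a b j) &
      (dgt n W s i < 2) && (dgt n W s j < 2)] = valid a b s i j.
    by rewrite /valid /opt /src /tgt /= an bn iN jN /= !andbA.
  case: ifP => v; last first.
    split=> // d phi dM; rewrite sg //; split=> -[|[u [w [D V E H]]]]; try (by left);
      right; exists u, w; split=> //.
      by move: D; rewrite /Done => /orP[->//|/andP[-> wj]]; rewrite ltnS (ltnW wj) orbT.
    move: D; rewrite /Done ltnS => /orP[->//|/andP[/eqP Eu]].
    rewrite leq_eqVlt => /orP[/eqP Ew|->]; last by rewrite Eu eqxx orbT.
    by rewrite Eu Ew v in V.
  have dpos : 0 < delta n W S0 (a, b, (i, j)) by case/andP: v => /andP[/delta_gt0].
  have [w' s'] := try_optionP eg gs gu gw ga gb sM iN jN an bn dpos wg.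
  have F' := framed_den inp try_option g.
  split=> //.
    split; rewrite ?(fv F') //; first by apply: env_same eg; apply: framed_same F'.
    by move=> u un; rewrite (fa F') // gl.
  move=> d phi dM; rewrite s' // sg // (sem_s _ _ _ Kg); split.
    case=> [[|[u [w [D V E H]]]]|[E H]]; first by left.
      right; exists u, w; split=> //.
      by move: D; rewrite /Done => /orP[->//|/andP[-> wj]]; rewrite ltnS (ltnW wj) orbT.
    by right; exists i, j; split=> //; rewrite /Done eqxx ltnSn orbT.
  case=> [|[u [w [D V E H]]]]; first by left; left.
  move: D; rewrite /Done ltnS => /orP[ui|/andP[/eqP Eu]].
    by left; right; exists u, w; split=> //; rewrite /Done ui.
  rewrite leq_eqVlt => /orP[/eqP Ew|wj].
    by right; rewrite -Eu -Ew.
  by left; right; exists u, w; split=> //; rewrite /Done Eu eqxx wj orbT.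
have : K (hv h r_n1) 0 (den inp pair_loop h).
  apply: (@den_loop inp (fun i => K i 0)).
    by split=> // d phi dM; split=> [|[//|[u [w []]]]]; [left | rewrite /Done andbF].
  move=> i g; rewrite (env_n1 eh) ltnS => iN F [k1 k2 k3].
  set g1 := setv g r_u i.
  have K1 : K i 0 g1 by split=> //; apply: St_setv.
  have [[e1 _ _ _] _ _] := K1.
  apply: (@K_ext i n.+1).
    move=> u w wn; rewrite /Done !ltnS wn andbT andbF orbF.
    by rewrite [in RHS]leq_eqVlt orbC.
  rewrite -(env_n1 e1).
  apply: (@den_loop inp (fun j => K i j)) => // j g2; rewrite (env_n1 e1) ltnS => jN F2 K2.
  apply: step => //; last by rewrite /= updE (fv F2).
  by case: K2 => k1' k2' k3'; split=> //; apply: St_setv.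
rewrite (env_n1 eh) => -[_ k2 k3]; split=> // d phi dM; rewrite k3 //.
split=> -[|[u [w H]]]; try (by left); right; exists u, w.
  by case: H.
have uN : u <= n by case: H => /andP[/andP[/opt_le/andP[]]].
by case: H => V E H; split=> //; rewrite /Done ltnS uN.
Qed.

Lemma process_groupP h a b gs : env h -> hv h r_a = a -> hv h r_a' = b -> a < n -> b < n ->
  represents gs h -> represents ((a, b) :: gs) (den inp process_group h).
Proof.
move=> eh Ha Hb an bn rep; rewrite /process_group den_seq -/pair_loop.
set h1 := den inp compute_link h.
have F1 := framed_den inp compute_link h; rewrite -/h1 in F1.
have L1 := compute_linkP eh Ha Hb an bn; rewrite -/h1 in L1.
have e1 : env h1 by apply: env_same eh; apply: framed_same F1.
(* The sources from [TM - t] on have been treated. A state receives vectors only from smaller ones,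
   so when its turn as a source comes it still represents [gs] without the new group; hence the
   group is used at most once. *)
pose J t g := [/\ env g /\ (hv g r_a = a /\ hv g r_a' = b),
  forall u, u <= n -> ha g a_link u = link n eN W a b u, forall d, d < TM -> wf g d &
  forall d phi, d < TM -> (sem g d phi <-> reach gs d phi \/ exists s0 u w,
    [/\ TM - t <= s0, s0 < TM, valid a b s0 u w, d = s0 + delta n W S0 ((a, b), (u, w))
      & reach gs s0 (fun z => phi z && agree n W ((a, b), (u, w)) z)])].
have : J (hv h1 r_TM) (den inp (SFor r_t r_TM
    (r_s <:- Minus (Minus r_TM (Cst 1)) r_t ;; pair_loop)) h1).
  apply: den_loop.
    have Th : ha h1 a_T = ha h a_T by rewrite (fa F1).
    split=> //; first by rewrite !(fv F1).
      by move=> d /rep[wd _]; apply: eq_wf wd => r0 z _ _; rewrite Th.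
    move=> d phi dM; have [_ rd] := rep d dM; rewrite -rd; split.
      by move=> sd; left; apply: eq_sem sd => r0 z _ _; rewrite Th.
    case=> [sd|[s0 [u [w [le lt]]]]]; last by lia.
    by apply: eq_sem sd => r0 z _ _; rewrite Th.
  move=> t g; rewrite (env_TM e1) => tM F [[eg [ga gb]] gl wg sg].
  rewrite den_seq den_asg; set g1 := setv _ r_s _.
  set s := TM - t.+1; have sM : s < TM by rewrite /s; lia.
  have g1s : hv g1 r_s = s by rewrite /g1 /= /upd /= (env_TM eg) /s; lia.
  have e2 : env g1.
    by apply: (env_same (h := setv g r_t t)); [apply: setv_same | apply: (env_same (h := g)); [apply: setv_same|]].
  have [w2 s2] := pair_loopP e2 (ga : hv g1 r_a = a) (gb : hv g1 r_a' = b) an bn g1s sM wg gl.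
  have F2 := framed_den inp pair_loop g1.
  split.
  - split; first by apply: env_same e2; apply: framed_same F2.
    by rewrite !(fv F2).
  - by move=> u un; rewrite (fa F2) // gl.
  - exact: w2.
  move=> d phi dM; rewrite s2 //.
  have sgs psi : sem g1 s psi <-> reach gs s psi.
    rewrite -[sem g1 s psi]/(sem g s psi) sg //; split=> [[//|[s0 [u [w [le lt v E _]]]]]|]; last by left.
    by case/andP: v => /andP[/delta_gt0 pos _] _; rewrite /s in E; lia.
  rewrite -[sem g1 d phi]/(sem g d phi) sg //; split.
    case=> [[|[s0 [u [w [le lt v E H]]]]]|[u [w [v E H]]]]; first by left.
      by right; exists s0, u, w; split=> //; lia.
    by right; exists s, u, w; split=> //; apply/sgs.
  case=> [|[s0 [u [w [le lt v E H]]]]]; first by left; left.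
  have [Es|ns] := eqVneq s0 s.
    by rewrite Es in v E H; right; exists u, w; split=> //; apply/sgs.
  by left; right; exists s0, u, w; split=> //; rewrite /s in le ns *; lia.
rewrite (env_TM e1) => -[_ _ wJ sJ] d dM; split; first exact: wJ.
move=> phi; rewrite sJ //= subnn; split.
  case=> [|[s0 [u [w [_ lt /andP[/andP[o d1] d2] E H]]]]]; first by left.
  by right; exists s0, u, w; split=> //; apply/and4P.
case=> [|[s0 [u [w [/and4P[lt o d1 d2] E H]]]]]; first by left.
by right; exists s0, u, w; split=> //; rewrite /valid o d1 d2.
Qed.

Definition full_groups gs := uniq gs /\ forall a b, ((a, b) \in gs) = (a < n) && (b < n).

Lemma groups_loopP h : env h -> represents [::] h ->
  exists2 gs, full_groups gs &
    represents gs (den inp (SFor r_a r_n (SFor r_a' r_n process_group)) h).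
Proof.
move=> eh rep0.
pose done i j a b := ((a < i) || (a == i) && (b < j)) && (b < n).
pose I i j g := env g /\ exists gs, [/\ uniq gs,
  forall a b, ((a, b) \in gs) = done i j a b & represents gs g].
suff [_ [gs [ugs mgs rep]]] : I (hv h r_n) 0 (den inp (SFor r_a r_n (SFor r_a' r_n process_group)) h).
  exists gs => //; split=> // a b; rewrite mgs /done (env_n eh) andbF orbF //.
apply: (@den_loop inp (fun i => I i 0)).
  by split=> //; exists [::]; split=> // a b; rewrite /done andbF.
move=> i g; rewrite (env_n eh) => iN F [eg [gs [ugs mgs rep]]].
set g1 := setv g r_a i.
have e1 : env g1 by apply: (env_same (h := g)) => //; apply: setv_same.
suff [e2 [gs2 [ugs2 mgs2 rep2]]] : I i (hv g1 r_n) (den inp (SFor r_a' r_n process_group) g1).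
  split=> //; exists gs2; split=> // a b; rewrite mgs2 /done (env_n e1) andbF orbF ltnS [in RHS]leq_eqVlt orbC.
  by case: (b < n); rewrite ?andbT ?andbF.
apply: (@den_loop inp (fun j => I i j)) => [|j g2].
  split=> //; exists gs; split=> //.
rewrite (env_n e1) => jN F2 [e2 [gs2 [ugs2 mgs2 rep2]]].
set g3 := setv g2 r_a' j.
have e3 : env g3 by apply: (env_same (h := g2)) => //; apply: setv_same.
split.
  apply: env_same e3; apply: framed_same (framed_den inp process_group g3) => //.
exists ((i, j) :: gs2); split.
- by rewrite /= ugs2 mgs2 /done ltnn eqxx ltnn.
- move=> a b; rewrite inE mgs2 /done ltnS xpair_eqE.
  case: (ltngtP a i) => //= _; rewrite [in RHS]leq_eqVlt.
  by case: (eqVneq b j) => [->|_]; rewrite ?jN.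
apply: process_groupP => //.
by rewrite /= updE (fv F2).
Qed.

Variables (small : bool) (L s0 i0 gap : nat).

Record env2 h : Prop := Env2 {
  env2_env : env h;
  env2_small : hv h r_small = small;
  env2_L : hv h r_L = L;
  env2_S0 : hv h r_S0 = s0;
  env2_I0 : hv h r_I0 = i0;
  env2_gap : hv h r_gap = gap
}.

Lemma env2_same g h : same_env g h -> env2 h -> env2 g.
Proof.
move=> sgh [eh h1 h2 h3 h4 h5]; split; first exact: env_same sgh eh.
all: by case: sgh => sv _; rewrite sv.
Qed.

Definition digits_ok s := all (fun u => W u ==> (dgt n W s u == 0) || (dgt n W s u == 2)) (iota 0 n)
  && (small ==> (dgt n W s r == 2)).
Definition digits_cnt s := count (fun u => W u && (dgt n W s u == 2)) (iota 0 n).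
Definition accepts t c := [&& L + t <= 2 * (s0 + c), L <= 2 * i0 + (t + gap)
  & 2 * L <= 2 * (s0 + c) + 2 * i0].
Definition within s z := all (fun u => ~~ [&& W u, bit n W z u & dgt n W s u == 0]) (iota 0 n).

Lemma iotaS i : iota 0 i.+1 = rcons (iota 0 i) i.
Proof. by rewrite -addn1 iotaD add0n cats1. Qed.

Lemma count_digitsP h s : env2 h -> hv h r_s = s -> hv h r_x = r -> s < TM ->
  let h' := den inp count_digits h in
  hv h' r_ok = digits_ok s /\ hv h' r_cnt = digits_cnt s.
Proof.
move=> e2 hs hx sM /=; have eh := env2_env e2.
rewrite /count_digits !den_seq !den_asg; set h2 := setv (setv h r_ok _) r_cnt _.
have e3 : env2 h2.
  by apply: (env2_same (h := setv h r_ok 1)); [apply: setv_same | apply: (env2_same (h := h)) => //; apply: setv_same].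
have eh2 := env2_env e3.
set P := fun u => W u ==> (dgt n W s u == 0) || (dgt n W s u == 2).
set Q := fun u => W u && (dgt n W s u == 2).
pose I i g := hv g r_ok = all P (iota 0 i) /\ hv g r_cnt = count Q (iota 0 i).
set loop := SFor r_u r_n _; set h3 := den inp loop h2.
have F3 : framed loop h3 h2 := framed_den inp loop h2.
have : I n h3.
  rewrite -(env_n eh2); apply: den_loop => // i g; rewrite (env_n eh2) => iN F [I1 I2].
  have eg : env g by apply: env_same eh2; apply: framed_same F.
  rewrite den_when den_if den_when !den_asg /= /upd /= (env_W eg) ?(ltnW iN) // b2n_neq0.
  rewrite (fv F (x := r_s)) // [hv h2 r_s]hs (env_TM eg) (env_dig eg) ?(ltnW iN) // b2n_eq b2n_neq0.
  rewrite /I iotaS all_rcons -cats1 count_cat /= addn0 /P /Q.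
  case: (W i) => /=; last by rewrite addn0.
  have [_|ne2] := eqVneq (dgt n W s i) 2; first by rewrite orbT /= /upd /= I1 I2.
  rewrite orbF; have [_|ne0] := eqVneq (dgt n W s i) 0; first by rewrite /= /upd /= I1 I2 addn0.
  by rewrite /= /upd /= I2 addn0.
case=> I1 I2; have e4 : env2 h3 by apply: env2_same e3; apply: framed_same F3.
have eh4 := env2_env e4.
rewrite den_when den_asg /= (env2_small e4) (fv F3 (x := r_x)) // (fv F3 (x := r_s)) //.
rewrite [hv h2 r_x]hx [hv h2 r_s]hs (env_TM eh4) (env_dig eh4) // b2n_eq b2n_not b2n_and b2n_neq0.
rewrite /digits_ok -/P -/Q; case: small => /=; last by rewrite I1 andbT.
by case: (_ == 2); rewrite /= ?updE /= ?I1 ?andbT ?andbF.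
Qed.

Lemma test_rowsP h s : env h -> hv h r_s = s -> s < TM -> wf h s ->
  (hv (den inp test_rows h) r_out != 0) <-> (hv h r_out != 0) \/ sem h s (within s).
Proof.
move=> eh hs sM wfs.
pose I i g := (hv g r_out != 0) <->
  (hv h r_out != 0) \/ exists2 q, q < i & par M2 (within s) (tab h s q).
have : I (hv h r_m2) (den inp test_rows h); last by rewrite (env_m2 eh).
apply: den_loop => [|q g]; first by split=> [|[//|[]//]]; left.
rewrite (env_m2 eh) => qM F Ig; rewrite !den_seq den_asg.
set g1 := setv (setv g r_r q) r_par 0.
set loop := SFor r_z r_m2 _; set g2 := den inp loop g1.
have F2 : framed loop g2 g1 := framed_den inp loop g1.
have eg : env g by apply: env_same eh; apply: framed_same F.
have e1 : env g1.
  by apply: (env_same (h := setv g r_r q)); [apply: setv_same | apply: (env_same (h := g)) => //; apply: setv_same].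
have g1v x : x \notin [:: r_r; r_par] -> x \notin mods test_rows -> hv g1 x = hv h x.
  move=> x12 xm; move: x12; rewrite !inE negb_or => /andP[x1 x2].
  by rewrite /= !updE (negbTE x1) (negbTE x2) (fv F xm).
have g1a a : a \notin wrs test_rows -> ha g1 a = ha h a by move=> am; rewrite -(fa F).
have par2 : hv g2 r_par = par M2 (within s) (tab h s q).
  pose J i k := hv k r_par = odd (count (fun z => within s z && tab h s q z) (iota 0 i)).
  suff : J (hv g1 r_m2) g2 by rewrite (env_m2 e1).
  apply: den_loop => // i k; rewrite (env_m2 e1) => iM Fk Jk.
  have ek : env k by apply: env_same e1; apply: framed_same Fk.
  set k1 := setv k r_z i.
  have ek1 : env k1 by apply: (env_same (h := k)) => //; apply: setv_same.
  have k1s : hv k1 r_s = s by rewrite /= /upd /= (fv Fk) // g1v.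
  rewrite den_when !den_seq den_asg.
  have -> : (eval inp k1 (Arr a_T (cellT r_s r_r r_z)) != 0) = tab h s q i.
    rewrite /tab -[eval _ _ _]/(ha k a_T ((hv k1 r_s * hv k1 r_m2 + hv k1 r_r) * hv k1 r_m2 + i)).
    by rewrite k1s (env_m2 ek1) [hv k1 r_r](fv Fk) // (fa Fk) // g1a.
  rewrite /J iotaS -cats1 count_cat /= addn0 oddD oddb.
  case: ifP => Ti; last by rewrite andbF addbF.
  rewrite andbT; set k2 := setv k1 r_use 1.
  set loop3 := SFor r_u r_n _; set k3 := den inp loop3 k2.
  have F3 : framed loop3 k3 k2 := framed_den inp loop3 k2.
  have ek2 : env k2 by apply: (env_same (h := k1)) => //; apply: setv_same.
  have use3 : hv k3 r_use = within s i.
    pose U j l := hv l r_use = all (fun u => ~~ [&& W u, bit n W i u & dgt n W s u == 0]) (iota 0 j).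
    suff : U (hv k2 r_n) k3 by rewrite (env_n ek2).
    apply: den_loop => // j l; rewrite (env_n ek2) => jN Fl Ul.
    have el : env l by apply: env_same ek2; apply: framed_same Fl.
    rewrite den_when den_asg /= /upd /= (fv Fl (x := r_z)) // (fv Fl (x := r_s)) //.
    rewrite [hv k2 r_s]k1s [hv k2 r_z]/= (env_m2 el) (env_TM el) (env_W el) ?(ltnW jN) //.
    rewrite (env_bit el) ?(ltnW jN) // (env_dig el) ?(ltnW jN) // b2n_eq !b2n_and b2n_neq0.
    rewrite /U iotaS all_rcons; case: ifP => _ //=.
  rewrite den_when den_asg -[eval inp k3 (Var _)]/(hv k3 r_use) use3 b2n_neq0.
  have k3par : hv k3 r_par = hv k r_par by rewrite (fv F3).
  by case: (within s i); rewrite /= ?updE /= ?addbF k3par Jk ?b2n_not ?addbT.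
rewrite den_when den_asg -[eval inp g2 (Var _)]/(hv g2 r_par) par2 b2n_neq0.
have out2 : hv g2 r_out = hv g r_out by rewrite (fv F2).
case: ifP => pq /=.
  by split=> // _; right; exists q.
rewrite /I in Ig *; rewrite out2 Ig; split.
  by case=> [|[q' q'q h']]; [left | right; exists q' => //; apply: ltnW].
case=> [|[q' + h']]; first by left.
rewrite ltnS leq_eqVlt => /orP[/eqP Eq|q'q]; last by right; exists q'.
by rewrite Eq pq in h'.
Qed.

Lemma check_statesP h : env2 h -> hv h r_x = r -> (forall s, s < TM -> wf h s) ->
  (hv (den inp check_states h) r_out != 0) <-> (hv h r_out != 0) \/
    exists t c, [/\ t < TB, c < M4, digits_ok (t * M4 + c),
      accepts t (digits_cnt (t * M4 + c)) & sem h (t * M4 + c) (within (t * M4 + c))].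
Proof.
move=> e2 hx wfh; have eh := env2_env e2.
pose good t c := [/\ digits_ok (t * M4 + c),
      accepts t (digits_cnt (t * M4 + c)) & sem h (t * M4 + c) (within (t * M4 + c))].
pose I i j g := [/\ env2 g, hv g r_x = r, ha g a_T = ha h a_T & (hv g r_out != 0) <->
  (hv h r_out != 0) \/ exists t c, [/\ (t < i) || (t == i) && (c < j), c < M4 & good t c]].
suff : I (hv h r_TB) 0 (den inp check_states h).
  rewrite (env_TB eh) => -[_ _ _ ->]; split=> -[|[t [c]]]; try (by left).
    by case; rewrite andbF orbF => tT cM [? ? ?]; right; exists t, c.
  by case=> tT cM h1 h2 h3; right; exists t, c; rewrite tT.
apply: (@den_loop inp (fun i => I i 0)).
  by split=> //; split=> [|[//|[t [c []]]]]; [left | rewrite andbF].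
move=> t g; rewrite (env_TB eh) => tT F [eg gx gT gout].
set g1 := setv g r_t t.
have e1 : env2 g1 by apply: (env2_same (h := g)) => //; apply: setv_same.
suff [e3 x3 T3 o3] : I t (hv g1 r_m4) (den inp (SFor r_a r_m4 (r_s <:- Plus (Times r_t r_m4) r_a ;;
     count_digits ;; When (And r_ok acceptable) test_rows)) g1).
  split=> //; rewrite o3 (env_m4 (env2_env e1)); split=> -[|[t' [c [D cM gd]]]]; try (by left);
    right; exists t', c; split=> //.
    by rewrite andbF orbF ltnS leq_eqVlt orbC; move: D; rewrite cM andbT.
  by rewrite cM andbT orbC -leq_eqVlt -ltnS; move: D; rewrite andbF orbF.
apply: (@den_loop inp (fun j => I t j)) => // c k.
rewrite (env_m4 (env2_env e1)) => cM Fk [ek kx kT kout].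
set s := t * M4 + c.
have sM : s < TM.
  apply: leq_trans (_ : t.+1 * M4 <= _); first by rewrite mulSn /s addnC ltn_add2r.
  by rewrite leq_mul2r tT orbT.
rewrite den_seq den_asg; set k1 := setv (setv k r_a c) r_s _.
rewrite den_seq.
have ek1 : env2 k1.
  by apply: (env2_same (h := setv k r_a c)); [apply: setv_same | apply: (env2_same (h := k)) => //; apply: setv_same].
have k1s : hv k1 r_s = s.
  by rewrite /k1 /= /upd /= (fv Fk (x := r_t)) // (env_m4 (env2_env ek)).
have [ok2 cnt2] := count_digitsP ek1 k1s kx sM.
set k2 := den inp count_digits k1 in ok2 cnt2 *.
have F2 : framed count_digits k2 k1 := framed_den inp count_digits k1.
have ek2 : env2 k2 by apply: env2_same ek1; apply: framed_same F2.
have eE := env2_env ek2.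
have T2 : ha k2 a_T = ha h a_T by rewrite (fa F2).
have out2 : hv k2 r_out = hv k r_out by rewrite (fv F2).
have sem2 phi : sem k2 s phi <-> sem h s phi.
  by split; apply: eq_sem => r0 z _ _; rewrite T2.
have wf2 : wf k2 s by apply: eq_wf (wfh s sM) => r0 z _ _; rewrite T2.
have t2 : hv k2 r_t = t by rewrite (fv F2) //= /upd /= (fv Fk).
rewrite den_when.
have -> : (eval inp k2 (And r_ok acceptable) != 0) = digits_ok s && accepts t (digits_cnt s).
  rewrite /= ok2 cnt2 t2 (env2_L ek2) (env2_S0 ek2) (env2_I0 ek2) (env2_gap ek2).
  by rewrite !b2n_leq !b2n_and b2n_neq0 /accepts !mul2n -!addnn.
have kgood g' : (hv g' r_out != 0) <-> (hv k r_out != 0) \/ good t c ->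
    (hv g' r_out != 0) <-> hv h r_out != 0 \/ exists t' c', [/\ (t' < t) || (t' == t) && (c' < c.+1), c' < M4 & good t' c'].
  move=> ->; rewrite kout; split.
    case=> [[|[t' [c' [D c'M gd]]]]|gd]; first by left.
      right; exists t', c'; split=> //; case/orP: D => [->//|/andP[-> c'c]].
      by rewrite ltnS (ltnW c'c) orbT.
    by right; exists t, c; rewrite eqxx ltnSn orbT.
  case=> [|[t' [c' [D c'M gd]]]]; first by left; left.
  case/orP: D => [t't|/andP[/eqP Et]]; first by left; right; exists t', c'; rewrite t't.
  rewrite ltnS leq_eqVlt => /orP[/eqP Ec|c'c]; first by right; rewrite Et Ec in gd.
  by left; right; exists t', c'; split=> //; rewrite Et eqxx c'c orbT.
case: ifP => acc.
  have F3 := framed_den inp test_rows k2.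
  split.
  - by apply: env2_same ek2; apply: framed_same F3.
  - by rewrite (fv F3) // (fv F2) //= /upd /= kx.
  - by rewrite (fa F3).
  have k2s : hv k2 r_s = s by rewrite (fv F2).
  apply: kgood; rewrite (test_rowsP eE k2s sM wf2) out2 sem2; case/andP: acc => a1 a2.
  by split=> -[|]; try (by left); [move=> h'; right | case=> _ _ h'; right].
split=> //; first by rewrite (fv F2) //= /upd /= kx.
apply: kgood; rewrite out2; split=> [|[//|[a1 a2 _]]]; first by left.
by rewrite /s a1 a2 in acc.
Qed.

Lemma solveP h : env2 h -> hv h r_x = r ->
  exists2 gs, full_groups gs & (hv (den inp solve h) r_out != 0) <-> (hv h r_out != 0) \/
    exists t c, [/\ t < TB, c < M4, digits_ok (t * M4 + c),
      accepts t (digits_cnt (t * M4 + c)) & reach gs (t * M4 + c) (within (t * M4 + c))].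
Proof.
move=> e2 hx; rewrite /solve den_seq den_seq.
have rep1 := init_tableP (env2_env e2) hx.
set h1 := den inp init_table h in rep1 *.
have F1 : framed init_table h1 h := framed_den inp init_table h.
have e1 : env2 h1 by apply: env2_same e2; apply: framed_same F1.
have [gs fgs rep2] := groups_loopP (env2_env e1) rep1.
set loop := SFor r_a _ _ in rep2 *; set h2 := den inp loop h1 in rep2 *.
have F2 : framed loop h2 h1 := framed_den inp loop h1.
have e3 : env2 h2 by apply: env2_same e1; apply: framed_same F2.
exists gs => //; rewrite check_statesP //.
- have -> : hv h2 r_out = hv h r_out by rewrite (fv F2) // (fv F1).
  have sT t c : t < TB -> c < M4 -> t * M4 + c < TM.
    move=> tT cM; apply: leq_trans (_ : t.+1 * M4 <= _); first by rewrite mulSn addnC ltn_add2r.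
    by rewrite leq_mul2r tT orbT.
  split=> -[|[t [c [tT cM d1 d2 d3]]]]; try (by left); right; exists t, c; split=> //.
    by have [_ <-] := rep2 _ (sT t c tT cM).
  by have [_ ->] := rep2 _ (sT t c tT cM).
- by rewrite (fv F2) // (fv F1).
by move=> s /rep2[].
Qed.

End Core.

Lemma digit_tableP inp n (W : pred nat) a q size base h Sz :
  a != a_W -> a != q -> size \notin [:: r_u; r_c; r_d; r_t] -> 1 < base ->
  hv h r_n = n -> hv h size = Sz -> (forall u, u <= n -> ha h a_W u = W u) ->
  (forall u, u < n -> W u -> ha h q u = wt W base u) -> (forall i, ha h a i = 0) ->
  forall u s, u <= n -> s < Sz ->
  ha (den inp (digit_table a q size base) h) a (u * Sz + s) =
    if W u && (u < n) then dig W base s u else 0.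
Proof.
move=> aW aq sz b1 hn hs hW hq h0.
have b0 : 0 < base by apply: ltnW.
pose I i g := forall u s, u <= n -> s < Sz ->
  ha g a (u * Sz + s) = if W u && (u < i) then dig W base s u else 0.
suff : I (hv h r_n) (den inp (digit_table a q size base) h) by rewrite hn.
apply: den_loop => [u s _ _|u g]; first by rewrite andbF h0.
rewrite hn => uN F Ig; rewrite den_when -[eval _ _ _]/(ha g a_W u) (fa F); last first.
  by rewrite /= inE eq_sym.
rewrite hW ?(ltnW uN) // b2n_neq0; case: ifP => Wu; last first.
  move=> u' s u'n sS; rewrite [LHS](Ig u' s u'n sS) ltnS [in RHS]leq_eqVlt.
  by case: (eqVneq u' u) => [->|] //=; rewrite Wu.
rewrite den_seq den_seq !den_asg; set g1 := setv (setv (setv g r_u u) r_c 0) r_d 0.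
have sN : size \notin mods (digit_table a q size base).
  by move: sz; rewrite /= !inE !negb_or => /and4P[-> -> -> ->].
have P0 := wt_gt0 W b0 u.
pose J t k := [/\ hv k r_c = t %% wt W base u, hv k r_d = (t %/ wt W base u) %% base &
  forall u' s, u' <= n -> s < Sz -> ha k a (u' * Sz + s) =
    if W u' && ((u' < u) || (u' == u) && (s < t)) then dig W base s u' else 0].
have g1s : hv g1 size = Sz.
  move: sz; rewrite !inE !negb_or => /and4P[/negbTE s1 /negbTE s2 /negbTE s3 _].
  by rewrite /= !updE s1 s2 s3 (fv F).
have : J (hv g1 size) (den inp (SFor r_t size
       (Sto a (Plus (Times r_u size) r_t) r_d ;;
        r_c <:- Plus r_c (Cst 1) ;;
        When (Eqn r_c (Arr q r_u))
          (r_c <:- Cst 0 ;; r_d <:- Plus r_d (Cst 1) ;;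
           When (Eqn r_d (Cst base)) (r_d <:- Cst 0)))) g1).
  apply: den_loop => [|t k].
    split=> //; first by rewrite mod0n.
      by rewrite div0n mod0n.
    move=> u' s u'n sS; rewrite ltn0 andbF orbF; exact: Ig.
  rewrite g1s => tS Fk [k1 k2 k3].
  rewrite den_seq den_sto den_seq den_asg.
  have ku : hv k r_u = u by rewrite (fv Fk).
  have ks : hv k size = Sz.
    rewrite (fv Fk) ?g1s //; move: sz; rewrite /= !inE !negb_or.
    by case/and4P=> _ -> -> ->.
  have st : (size == r_t) = false.
    by move: sz; rewrite !inE !negb_or => /and4P[_ _ _ /negbTE].
  set k4 := setv (seta _ a _ _) r_c _.
  have k4q : ha k4 q u = wt W base u.
    rewrite /k4 /= eq_sym (negbTE aq) (fa Fk) /= ?inE 1?eq_sym // (fa F) /= ?inE 1?eq_sym //.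
    exact: hq.
  have k4a u' s : u' <= n -> s < Sz -> ha k4 a (u' * Sz + s) =
      if W u' && ((u' < u) || (u' == u) && (s < t.+1)) then dig W base s u' else 0.
    move=> u'n sS; rewrite /k4 /= eqxx /upd /= st ku ks.
    case: eqP => [/mulD_inj[//|//|-> ->]|ne].
      by rewrite k2 Wu eqxx ltnSn orbT.
    rewrite k3 // (_ : (s < t.+1) = (s == t) || (s < t)) 1?ltnS 1?leq_eqVlt //.
    case: (u' =P u) => // Eu; case: (s =P t) => // Est.
    by case: ne; rewrite Eu Est.
  have k4c : hv k4 r_c = (t %% wt W base u).+1 by rewrite /k4 /= /upd /= k1 addn1.
  have k4d : hv k4 r_d = (t %/ wt W base u) %% base by rewrite /k4 /= /upd /= k2.
  have k4u : hv k4 r_u = u by rewrite /k4 /= /upd /=.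
  have dvdE : (wt W base u %| t.+1) = ((t %% wt W base u).+1 == wt W base u).
    rewrite /dvdn -addn1 -modnDml addn1.
    have := ltn_pmod t P0; rewrite leq_eqVlt => /orP[/eqP->|lt].
      by rewrite modnn !eqxx.
    by rewrite modn_small // (ltn_eqF lt).
  rewrite den_when -[eval _ _ _]/(1 - (hv k4 r_c - ha k4 q (hv k4 r_u) + (ha k4 q (hv k4 r_u) - hv k4 r_c))).
  rewrite k4u k4q k4c b2n_eq b2n_neq0 -dvdE.
  case: ifP => dv; last first.
    split; first by rewrite k4c modnS dv.
      by rewrite k4d divnS // dv.
    exact: k4a.
  clearbody k4.
  rewrite !den_seq !den_asg den_when den_asg /= /upd /= k4d b2n_eq b2n_neq0.
  have dS : (t.+1 %/ wt W base u) %% base =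
      if (t %/ wt W base u) %% base + 1 == base then 0 else (t %/ wt W base u) %% base + 1.
    rewrite divnS // dv add1n -addn1 -modnDml.
    have := ltn_pmod (t %/ wt W base u) b0; rewrite -addn1 leq_eqVlt => /orP[/eqP->|lt].
      by rewrite eqxx modnn.
    by rewrite modn_small // (ltn_eqF lt).
  case: ifP => E1; split; rewrite /= ?updE /= ?dS ?E1 ?modnS ?dv //; exact: k4a.
rewrite g1s => -[_ _ kS] u' s u'n sS; rewrite kS // sS andbT ltnS [in RHS]leq_eqVlt orbC.
by [].
Qed.

(** * The search over all roots *)

Section Search.
Variables (inp : nat -> nat) (n : nat) (eN : rel nat) (W S0 Rt : pred nat) (TB : nat).
Variables (small rej : bool) (L s0 i0 gap : nat).
Hypothesis inp_adjE : forall u v, u < n -> v < n -> inp (2 + n + n + u * n + v) = eN u v.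

Let M2 := wt W 2 n.
Let M4 := wt W 4 n.

Record ready (h : store) : Prop := Ready {
  ready_n : hv h r_n = n;
  ready_n1 : hv h r_n1 = n.+1;
  ready_m2 : hv h r_m2 = M2;
  ready_m4 : hv h r_m4 = M4;
  ready_TB : hv h r_TB = TB;
  ready_TM : hv h r_TM = TB * M4;
  ready_small : hv h r_small = small;
  ready_rej : hv h r_rej = rej;
  ready_L : hv h r_L = L;
  ready_s0 : hv h r_S0 = s0;
  ready_i0 : hv h r_I0 = i0;
  ready_gap : hv h r_gap = gap;
  ready_out : hv h r_out = 0;
  ready_W : forall u, u <= n -> ha h a_W u = W u;
  ready_S0 : forall u, u < n -> ha h a_S0 u = S0 u;
  ready_root : forall u, u <= n -> ha h a_root u = Rt u;
  ready_q2 : forall u, u < n -> W u -> ha h a_q2 u = wt W 2 u;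
  ready_q4 : forall u, u <= n -> ha h a_q4 u = ad n W u;
  ready_dig : forall i, ha h a_dig i = 0;
  ready_bit : forall i, ha h a_bit i = 0
}.

Definition found x gs := exists t c, [/\ t < TB, c < M4, digits_ok n W x small (t * M4 + c),
  accepts L s0 i0 gap t (digits_cnt n W (t * M4 + c))
  & reach n eN W S0 x TB gs (t * M4 + c) (within n W (t * M4 + c))].

(** The order of the groups is hidden: a positive answer provides some order, while completeness is
    claimed for facts that hold in every order. *)
Lemma searchP h : ready h ->
  let out := hv (den inp search h) r_out != 0 in
  (out -> ~~ rej /\ exists x gs, [/\ x <= n, Rt x, full_groups n gs & found x gs]) /\
  (~~ rej -> forall x, x <= n -> Rt x ->
    (forall gs, full_groups n gs -> found x gs) -> out).
Proof.
move=> rh /=; rewrite /search den_seq den_seq.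
set s1 := digit_table a_dig _ _ _; set h1 := den inp s1 h.
have F1 : framed s1 h1 h := framed_den inp s1 h.
set s2 := digit_table a_bit _ _ _; set h2 := den inp s2 h1.
have F2 : framed s2 h2 h1 := framed_den inp s2 h1.
have v2 x : x \notin mods (s1 ;; s2) -> hv h2 x = hv h x.
  by rewrite mem_cat negb_or => /andP[x1 x2]; rewrite (fv F2) // (fv F1).
have a2 a : a \notin wrs (s1 ;; s2) -> ha h2 a = ha h a.
  by rewrite mem_cat negb_or => /andP[x1 x2]; rewrite (fa F2) // (fa F1).
have dig1 := @digit_tableP inp n W a_dig a_q4 r_TM 4 h (TB * M4) isT isT isT isT
  (ready_n rh) (ready_TM rh) (ready_W rh).
have bit1 := @digit_tableP inp n W a_bit a_q2 r_m2 2 h1 M2 isT isT isT isT.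
have e2 : env2 n W S0 TB small L s0 i0 gap h2.
  split; rewrite ?v2 //; try (by case: rh).
  split; rewrite ?v2 //; try (by case: rh).
  - by move=> u un; rewrite a2 // (ready_W rh).
  - by move=> u un; rewrite a2 // (ready_S0 rh).
  - by move=> u un; rewrite a2 // (ready_q4 rh).
  - move=> u s un sM; rewrite (fa F2) // dig1 //; last exact: ready_dig.
    by move=> v vn Wv; rewrite (ready_q4 rh) ?(ltnW vn) // /ad Wv vn.
  move=> u z un zM; rewrite bit1 //.
  - rewrite /bit /dig modn2; case: (W u) => //=; by case: (u < n).
  - by rewrite (fv F1) // ready_n.
  - by rewrite (fv F1) // ready_m2.
  - by move=> v vn; rewrite (fa F1) // ready_W.
  - by move=> v vn Wv; rewrite (fa F1) // (ready_q2 rh).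
  by move=> i; rewrite (fa F1) // ready_bit.
have root2 u : u <= n -> ha h2 a_root u = Rt u by move=> un; rewrite a2 // (ready_root rh).
have out2 : hv h2 r_out = 0 by rewrite v2 // (ready_out rh).
rewrite den_when -[eval _ _ _]/(1 - hv h2 r_rej) v2 // (ready_rej rh) b2n_not b2n_neq0.
case: rej rh => rh /=; first by rewrite out2.
pose I i g := [/\ env2 n W S0 TB small L s0 i0 gap g, ha g a_root = ha h2 a_root,
  hv g r_out != 0 -> exists x gs, [/\ x < i, Rt x, full_groups n gs & found x gs]
  & forall x, x < i -> Rt x -> (forall gs, full_groups n gs -> found x gs) -> hv g r_out != 0].
have : I (hv h2 r_n1) (den inp (SFor r_x r_n1 (When (Arr a_root r_x) solve)) h2).
  apply: den_loop => [|x g]; first by split=> //; rewrite out2.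
  rewrite v2 // (ready_n1 rh) ltnS => xn F [eg rg g1 g2].
  set k := setv g r_x x.
  have ek : env2 n W S0 TB small L s0 i0 gap k.
    by apply: (env2_same (h := g)) => //; apply: setv_same.
  rewrite den_when -[eval _ _ _]/(ha g a_root x) rg root2 // b2n_neq0.
  case: ifP => Rx; last first.
    split=> // [/g1[y [gs [yx Ry fg fy]]]|y]; first by exists y, gs; split=> //; apply: ltnW.
    by rewrite ltnS leq_eqVlt => /orP[/eqP->|yx]; [rewrite Rx | apply: g2].
  have [gs fgs solveE] := solveP xn inp_adjE ek erefl.
  have F3 : framed solve (den inp solve k) k := framed_den inp solve k.
  split.
  - by apply: env2_same ek; apply: framed_same F3.
  - by rewrite (fa F3).
  - move/solveE; case=> [/g1[y [gs' [yx Ry fg fy]]]|fx].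
      by exists y, gs'; split=> //; apply: ltnW.
    by exists x, gs.
  move=> y; rewrite ltnS leq_eqVlt => /orP[/eqP->|yx] Ry fy; apply/solveE.
    by right; apply: fy.
  by left; apply: g2 fy.
rewrite v2 // (ready_n1 rh) => -[_ _ g1 g2]; split.
  by move/g1 => [x [gs [xn Rx fg fx]]]; split=> //; exists x, gs.
by move=> _ x xn Rx fx; apply: g2 fx.
Qed.

End Search.

(** * The preprocessing *)

Section Pre.
Variables (inp : nat -> nat) (n k : nat) (eN : rel nat) (B S : pred nat).
Hypothesis inp0 : inp 0 = n.
Hypothesis inp1 : inp 1 = k.
Hypothesis inp_BE : forall v, v < n -> inp (2 + v) = B v.
Hypothesis inp_SE : forall v, v < n -> inp (2 + n + v) = S v.
Hypothesis inp_adjE : forall u v, u < n -> v < n -> inp (2 + n + n + u * n + v) = eN u v.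
Hypothesis eN_irr : irreflexive eN.

Lemma count_loopP x y e h (f : pred nat) :
  hv h r_n = n -> x != y -> x != r_n -> y != r_n ->
  (forall g i, i < n -> (forall z, z != x -> z != y -> hv g z = hv h z) ->
    (forall a, ha g a = ha h a) -> hv g x = i -> eval inp g e = f i) ->
  hv (den inp (count_loop x y e) h) y = count f (iota 0 n).
Proof.
move=> hn xy xn yn He; rewrite /count_loop den_seq den_asg.
set h1 := setv h y _.
have h1n : hv h1 r_n = n by rewrite /= updE eq_sym (negbTE yn).
pose I i g := hv g y = count f (iota 0 i).
suff : I (hv h1 r_n) (den inp (SFor x r_n (y <:- Plus y e)) h1) by rewrite h1n.
apply: den_loop => [|i g]; first by rewrite /I /= updE eqxx.
rewrite h1n => iN F Ig; rewrite den_asg /I iotaS -cats1 count_cat /= addn0 !updE eqxx.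
rewrite [y == x]eq_sym (negbTE xy) [hv g y]Ig; congr (_ + _).
apply: He => //.
- move=> z zx zy; rewrite /= updE (negbTE zx) (fv F) ?inE ?negb_or ?zx //.
  by rewrite /= updE (negbTE zy).
- by move=> a; rewrite /= (fa F).
by rewrite /= updE eqxx.
Qed.

Lemma eval_dbl h e : eval inp h (Dbl e) = 2 * eval inp h e.
Proof. by rewrite mul2n -addnn. Qed.

Definition degB v := count (fun u => eN v u && ~~ B u) (iota 0 n).
Definition deltaN := foldl (fun d v => if B v then d else minn d (degB v))
  (count (predC B) (iota 0 n)) (iota 0 n).

Lemma leq_deltaN m : (m <= deltaN) = (m <= count (predC B) (iota 0 n)) &&
  all (fun v => B v || (m <= degB v)) (iota 0 n).
Proof.
rewrite /deltaN; move: (count (predC B) (iota 0 n)) => d; move: (iota 0 n) => s.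
elim: s d => [|v s IH] d /=; first by rewrite andbT.
by rewrite IH; case: (B v); rewrite //= leq_min -andbA.
Qed.

Lemma compute_deltaP h : hv h r_n = n -> hv (den inp compute_delta h) r_delta = deltaN.
Proof.
move=> hn; rewrite /compute_delta den_seq; set h1 := den inp (count_loop _ _ _) h.
have F1 : framed (count_loop r_v r_delta (Not (inp_B r_v))) h1 h := framed_den inp _ h.
have d1 : hv h1 r_delta = count (predC B) (iota 0 n).
  apply: count_loopP => // g i iN _ _ gi /=.
  by rewrite gi inp_BE // b2n_not.
have n1 : hv h1 r_n = n by rewrite (fv F1).
pose I i g := hv g r_delta = foldl (fun d v => if B v then d else minn d (degB v))
  (count (predC B) (iota 0 n)) (iota 0 i).
suff : I (hv h1 r_n) (den inp (SFor r_v r_n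
    (When (Not (inp_B r_v))
       (count_loop r_u r_d (And (inp_adj r_v r_u) (Not (inp_B r_u))) ;;
        When (Lt r_d r_delta) (r_delta <:- r_d)))) h1) by rewrite n1.
apply: den_loop => // v g; rewrite n1 => vN F Ig.
rewrite den_when /= /upd /= inp_BE // b2n_not b2n_neq0.
rewrite /I iotaS foldl_rcons; case: (B v) => //=.
rewrite den_seq; set g1 := setv g r_v v; set g2 := den inp (count_loop _ _ _) g1.
have F2 : framed (count_loop r_u r_d (And (inp_adj r_v r_u) (Not (inp_B r_u)))) g2 g1 := framed_den inp _ g1.
have dv : hv g2 r_d = degB v.
  apply: count_loopP => //; first by rewrite /= /upd /= (fv F).
  move=> g3 u uN H _ gu /=; rewrite gu !H // [hv g1 r_n]/= /upd /= (fv F) // n1.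
  by rewrite inp_adjE // inp_BE // b2n_not b2n_and.
have dd : hv g2 r_delta = hv g r_delta by rewrite (fv F2).
rewrite den_when den_asg -[eval _ _ _]/(1 - (hv g2 r_d + 1 - hv g2 r_delta)) b2n_lt b2n_neq0.
rewrite dv dd -Ig minnC /minn; case: ltnP => _; last exact: dd.
by rewrite /= updE.
Qed.

Definition numS := count S (iota 0 n).
Definition numB := count B (iota 0 n).
Definition paramD := numS - deltaN + numB + 1.
Definition goal_len := maxn (2 * deltaN + k) 3.

Lemma compute_paramsP h : hv h r_n = n -> hv h r_delta = deltaN -> hv h r_k = k ->
  let h' := den inp compute_params h in
  [/\ hv h' r_D8 = 8 * paramD, hv h' r_T = 512 * paramD, hv h' r_L = goal_len
    & hv h' r_small = (deltaN <= 2048 * paramD)].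
Proof.
move=> hn hd hk; cbv zeta; rewrite /compute_params den_seq; set h1 := den inp (count_loop _ _ _) h.
have F1 : framed (count_loop r_v r_s (inp_S r_v)) h1 h := framed_den inp _ h.
have s1 : hv h1 r_s = numS.
  by apply: count_loopP => // g i iN H _ gi /=; rewrite gi H // hn inp_SE.
rewrite den_seq; set h2 := den inp (count_loop _ _ _) h1.
have F2 : framed (count_loop r_v r_b (inp_B r_v)) h2 h1 := framed_den inp _ h1.
have b2 : hv h2 r_b = numB.
  apply: count_loopP; rewrite ?(fv F1) // => g i iN H _ gi /=.
  by rewrite gi inp_BE.
have s2 : hv h2 r_s = numS by rewrite (fv F2).
have d2 : hv h2 r_delta = deltaN by rewrite (fv F2) // (fv F1).
have k2 : hv h2 r_k = k by rewrite (fv F2) // (fv F1).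
clearbody h2; rewrite den_seq den_asg; set h3 := setv _ r_D _.
have D3 : hv h3 r_D = paramD by rewrite /h3 /= /upd /= b2 s2 d2.
have d3 : hv h3 r_delta = deltaN by [].
have k3 : hv h3 r_k = k by [].
clearbody h3; rewrite den_seq den_asg; set h4 := setv _ r_D8 _.
have D4 : hv h4 r_D8 = 8 * paramD by rewrite /h4 /= /upd /= D3; lia.
have d4 : hv h4 r_delta = deltaN by [].
have k4 : hv h4 r_k = k by [].
clearbody h4; rewrite den_seq den_asg; set h5 := setv _ r_T _.
have D5 : hv h5 r_T = 512 * paramD.
  by rewrite -[LHS]/(eval inp h4 (Dbl (Dbl (Dbl (Dbl (Dbl (Dbl r_D8))))))) !eval_dbl /= D4; lia.
have d5 : hv h5 r_delta = deltaN by [].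
have k5 : hv h5 r_k = k by [].
have e5 : hv h5 r_D8 = 8 * paramD by [].
clearbody h5; rewrite den_seq den_asg; set h6 := setv _ r_L _.
have L6 : hv h6 r_L = 2 * deltaN + k by rewrite /h6 /= /upd /= d5 k5; lia.
have d6 : hv h6 r_delta = deltaN by [].
have T6 : hv h6 r_T = 512 * paramD by [].
have e6 : hv h6 r_D8 = 8 * paramD by [].
clearbody h6; rewrite den_seq den_when den_asg; set h7 := (if _ then _ else _).
have [L7 d7 T7 e7] : [/\ hv h7 r_L = goal_len, hv h7 r_delta = deltaN,
    hv h7 r_T = 512 * paramD & hv h7 r_D8 = 8 * paramD].
  rewrite /h7 -[eval _ _ (Lt _ _)]/(1 - (hv h6 r_L + 1 - 3)) b2n_lt b2n_neq0 L6 /goal_len den_asg.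
  by case: ltnP => lt; split=> //=; rewrite ?L6; lia.
clearbody h7; split=> //.
rewrite -[LHS]/(1 - (hv h7 r_delta - (hv h7 r_T + hv h7 r_T + (hv h7 r_T + hv h7 r_T)))).
rewrite b2n_leq d7 T7; congr nat_of_bool; lia.
Qed.

Lemma setup_smallP h : hv h r_n = n -> (forall i, ha h a_W i = 0) -> (forall i, ha h a_root i = 0) ->
  let h' := den inp setup_small h in
  (forall u, ha h' a_W u = (u < n) && S u) /\ (forall u, ha h' a_root u = (u < n) && S u).
Proof.
move=> hn hW hR /=.
pose I i g := (forall u, ha g a_W u = (u < i) && S u) /\ (forall u, ha g a_root u = (u < i) && S u).
suff : I (hv h r_n) (den inp setup_small h) by rewrite hn.
apply: den_loop => // i g; rewrite hn => iN F [I1 I2].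
rewrite den_seq !den_sto /= /upd /= (fv F) // hn inp_SE //.
by split=> u /=; rewrite updE ?I1 ?I2 ltnS; case: (ltngtP u i) => //= ->.
Qed.

Definition freeI u := ~~ S u && ~~ B u.
Definition few v := count (fun u => freeI u && eN v u) (iota 0 n) < 512 * paramD.
Definition reject := count freeI (iota 0 n) < 1024 * paramD.
Definition W0 v := ~~ reject && (B v || S v && few v).

Lemma compute_W0P h : hv h r_n = n -> hv h r_T = 512 * paramD -> (forall i, ha h a_W i = 0) ->
  (forall i, ha h a_I i = 0) ->
  let h' := den inp compute_W0 h in
  (forall u, ha h' a_W u = (u < n) && W0 u) /\
  hv h' r_rej = reject.
Proof.
move=> hn hT hW hI; cbv zeta; rewrite /compute_W0 den_seq; set l1 := SFor r_v r_n (Sto a_I _ _); set h1 := den inp l1 h.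
have F1 : framed l1 h1 h := framed_den inp l1 h.
have I1 u : u < n -> ha h1 a_I u = freeI u.
  pose I i g := forall u, u < i -> ha g a_I u = freeI u.
  suff : I (hv h r_n) h1 by rewrite hn; apply.
  apply: den_loop => // i g; rewrite hn => iN F Ig.
  rewrite den_sto /= /upd /= (fv F) // hn inp_SE // inp_BE // !b2n_not b2n_and.
  move=> v; rewrite /= updE ltnS leq_eqVlt => /orP[/eqP->|vi]; first by rewrite eqxx.
  by rewrite ltn_eqF // Ig.
rewrite den_seq; set h2 := den inp (count_loop _ _ _) h1.
have F2 : framed (count_loop r_v r_I0 (Arr a_I r_v)) h2 h1 := framed_den inp _ h1.
have c2 : hv h2 r_I0 = count freeI (iota 0 n).
  apply: count_loopP; rewrite ?(fv F1) // => g i iN H Ha gi /=.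
  by rewrite gi Ha I1.
have n2 : hv h2 r_n = n by rewrite (fv F2) // (fv F1).
have T2 : hv h2 r_T = 512 * paramD by rewrite (fv F2) // (fv F1).
have W2 i : ha h2 a_W i = 0 by rewrite (fa F2) // (fa F1).
have I2 u : u < n -> ha h2 a_I u = freeI u by move=> un; rewrite (fa F2) // I1.
clearbody h2; rewrite den_seq den_asg; set h3 := setv _ r_rej _.
have r3 : hv h3 r_rej = reject.
  rewrite -[LHS]/(1 - (hv h2 r_I0 + 1 - (hv h2 r_T + hv h2 r_T))) b2n_lt c2 T2 /reject; congr nat_of_bool; lia.
have [n3 T3] : hv h3 r_n = n /\ hv h3 r_T = 512 * paramD by [].
have W3 i : ha h3 a_W i = 0 by apply: W2.
have I3 u : u < n -> ha h3 a_I u = freeI u by apply: I2.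
clearbody h3; set l4 := SFor r_v _ _.
split; last by rewrite frame_v.
pose I i g := forall u, ha g a_W u = (u < i) && W0 u.
suff : I (hv h3 r_n) (den inp l4 h3) by rewrite n3; apply.
apply: den_loop => // v g; rewrite n3 => vN F Ig.
rewrite den_seq den_sto; set g1 := setv g r_v v; set g2 := den inp (count_loop _ _ _) g1.
have F4 : framed (count_loop r_u r_d (And (Arr a_I r_u) (inp_adj r_v r_u))) g2 g1 := framed_den inp _ g1.
have n4 : hv g1 r_n = n by rewrite /= /upd /= (fv F).
have d4 : hv g2 r_d = count (fun u => freeI u && eN v u) (iota 0 n).
  apply: count_loopP => // g3 u uN H Ha gu /=.
  by rewrite gu !H // n4 Ha /= (fa F) // I3 // inp_adjE // b2n_and.
have v4 : hv g2 r_v = v by rewrite (fv F4).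
have n5 : hv g2 r_n = n by rewrite (fv F4).
have T5 : hv g2 r_T = 512 * paramD by rewrite (fv F4) //= /upd /= (fv F).
have W5 : ha g2 a_W = ha g a_W by rewrite (fa F4).
have rej5 : hv g2 r_rej = reject by rewrite (fv F4) //= /upd /= (fv F).
clearbody g2; rewrite /= v4 n5 d4 T5 rej5 inp_BE // inp_SE // b2n_lt b2n_and b2n_or b2n_not b2n_and.
move=> u; rewrite /= updE W5 Ig ltnS; case: (ltngtP u v) => //= ->.
by rewrite /W0 /few.
Qed.

Definition unpair (M : seq (nat * nat)) := flatten [seq [:: q.1; q.2] | q <- M].
Definition freeS v := S v && ~~ W0 v.

Definition is_matching (M : seq (nat * nat)) :=
  uniq (unpair M) /\ all (fun q => [&& q.1 < n, q.2 < n, freeS q.1, freeS q.2 & eN q.1 q.2]) M.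

Definition saturates (M : seq (nat * nat)) a b :=
  freeS a -> freeS b -> eN a b -> (a \in unpair M) || (b \in unpair M).

Lemma greedy_matchingP h : hv h r_n = n -> hv h r_D8 = 8 * paramD ->
  (forall u, u < n -> ha h a_W u = W0 u) -> (forall u, ha h a_M u = 0) ->
  let h' := den inp greedy_matching h in
  exists M, [/\ is_matching M, size M <= 8 * paramD, hv h' r_mc = size M,
    forall v, ha h' a_M v = (v \in unpair M)
  & size M < 8 * paramD -> forall a b, a < n -> b < n -> saturates M a b].
Proof.
move=> hn hD hW hM; cbv zeta; rewrite /greedy_matching den_seq.
pose J v u g := exists M, [/\ is_matching M, size M <= 8 * paramD, hv g r_mc = size M,
    forall w, ha g a_M w = (w \in unpair M)
  & size M < 8 * paramD -> forall a b, b < n -> (a < v) || (a == v) && (b < u) -> saturates M a b].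
set h1 := den inp (r_mc <:- Cst 0) h.
suff : J (hv h1 r_n) 0 (den inp (SFor r_v r_n (SFor r_u r_n
    (When (And (And (free_S r_v) (free_S r_u)) (And (inp_adj r_v r_u) (Lt r_mc r_D8)))
       (Sto a_M r_v (Cst 1) ;; Sto a_M r_u (Cst 1) ;; r_mc <:- Plus r_mc (Cst 1))))) h1).
  rewrite -[hv h1 r_n]/(hv h r_n) hn => -[M [m1 m2 m3 m4 m5]]; exists M; split=> //.
  by move=> lt a b an bn; apply: m5 => //; rewrite an.
apply: (@den_loop inp (fun v => J v 0)).
  by exists [::]; split=> // _ a b _; rewrite andbF.
move=> v g vN F Jg; rewrite -[hv h1 r_n]/(hv h r_n) hn in vN.
set g1 := setv g r_v v.
have Jg1 : J v 0 g1 by case: Jg => M [m1 m2 m3 m4 m5]; exists M; split.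
have n1 : hv g1 r_n = n by rewrite /= /upd /= (fv F).
have D1 : hv g1 r_D8 = 8 * paramD by rewrite /= /upd /= (fv F).
have W1 u : u < n -> ha g1 a_W u = W0 u by move=> un; rewrite /= (fa F) // hW.
have v1 : hv g1 r_v = v by [].
suff : J v (hv g1 r_n) (den inp (SFor r_u r_n
    (When (And (And (free_S r_v) (free_S r_u)) (And (inp_adj r_v r_u) (Lt r_mc r_D8)))
       (Sto a_M r_v (Cst 1) ;; Sto a_M r_u (Cst 1) ;; r_mc <:- Plus r_mc (Cst 1)))) g1).
  rewrite n1 => -[M [m1 m2 m3 m4 m5]]; exists M; split=> // lt a b bn.
  by rewrite andbF orbF ltnS leq_eqVlt orbC => ab; apply: m5; rewrite ?bn ?andbT.
clearbody g1; apply: den_loop => // u g2 uN Fk [M [m1 m2 m3 m4 m5]].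
rewrite n1 in uN; rewrite den_when.
have -> : (eval inp (setv g2 r_u u) (And (And (free_S r_v) (free_S r_u)) (And (inp_adj r_v r_u) (Lt r_mc r_D8))) != 0)
   = [&& freeS v && (v \notin unpair M), freeS u && (u \notin unpair M), eN v u & size M < 8 * paramD].
  rewrite /= /upd /= !(fv Fk (x := r_v)) // !(fv Fk (x := r_n)) // !(fv Fk (x := r_D8)) //.
  rewrite v1 n1 D1 m3 !m4 !(fa Fk (a := a_W)) // !W1 // !inp_SE // inp_adjE //.
  by rewrite b2n_lt !b2n_not !b2n_and b2n_neq0 /freeS !andbA.
case: ifP => [/and4P[/andP[fv' vM] /andP[fu uM] evu lt]|cnd].
  exists ((v, u) :: M); split=> //=.
  - case: m1 => m1 m1'; split; rewrite /= ?m1' ?fv' ?fu ?evu ?vN ?uN //.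
    rewrite inE negb_or vM uM m1 !andbT; apply/eqP => Evu; by rewrite Evu eN_irr in evu.
  - by rewrite !updE /= m3 addn1.
  - move=> w; rewrite /upd /= (fv Fk) // v1 m4 !inE.
    by case: (eqVneq w u) => [_|_]; rewrite ?orbT //; case: (w == v).
  move=> lt2 a b bn D fa' fb eab.
  have Sat : forall a' b', b' < n -> (a' < v) || (a' == v) && (b' < u) -> saturates M a' b'.
    by apply: m5; apply: ltnW.
  have := Sat a b bn; rewrite /saturates fa' fb eab.
  case/orP: D => [->|/andP[/eqP-> _]] /=; last by rewrite inE eqxx.
  by move=> /(_ isT isT isT isT)/orP[]wM; rewrite !inE wM !orbT.
exists M; split=> // lt a b bn.
case/orP => [av|/andP[/eqP->]]; first by apply: m5; rewrite ?av.
rewrite ltnS leq_eqVlt => /orP[/eqP->|bu]; last by apply: m5; rewrite ?eqxx ?bu ?orbT.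
move=> f1 f2 e1; apply/negPn/negP; rewrite negb_or => /andP[n2 n3].
by rewrite f1 f2 e1 n2 n3 lt in cnd.
Qed.

(* The virtual vertex n stands for everything outside W. *)
Definition large_W (M : seq (nat * nat)) v :=
  (v == n) || (v < n) && (W0 v || (size M < 8 * paramD) && (v \in unpair M)).
Definition large_S0 M v := (v < n) && (S v && ~~ large_W M v).
(** A bound on the number of cycle edges inside S0: none after a maximal matching has been moved to
    W, otherwise the trivial bound. *)
Definition large_gap (M : seq (nat * nat)) := if size M < 8 * paramD then 0 else n.

Lemma setup_largeP h : hv h r_n = n -> hv h r_T = 512 * paramD -> hv h r_D8 = 8 * paramD ->
  hv h r_gap = 0 -> (forall a, a < 5 -> forall i, ha h a i = 0) ->
  let h' := den inp setup_large h in
  exists M, [/\ is_matching M /\ size M <= 8 * paramD,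
    size M < 8 * paramD -> forall a b, a < n -> b < n -> saturates M a b,
    hv h' r_rej = reject /\ hv h' r_gap = large_gap M,
    forall u, ha h' a_W u = large_W M u &
    (forall u, u < n -> ha h' a_S0 u = large_S0 M u) /\ forall u, ha h' a_root u = (u == n)].
Proof.
move=> hn hT hD hg h0; cbv zeta; rewrite /setup_large den_seq.
have [W1 rej1] := compute_W0P hn hT (h0 a_W isT) (h0 a_I isT).
set h1 := den inp compute_W0 h in W1 rej1 *.
have F1 : framed compute_W0 h1 h := framed_den inp _ h.
have n1 : hv h1 r_n = n by rewrite (fv F1).
have D1 : hv h1 r_D8 = 8 * paramD by rewrite (fv F1).
have M1 u : ha h1 a_M u = 0 by rewrite (fa F1) // h0.
have g1 : hv h1 r_gap = 0 by rewrite (fv F1).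
have R1 u : ha h1 a_root u = 0 by rewrite (fa F1) // h0.
have S1 u : ha h1 a_S0 u = 0 by rewrite (fa F1) // h0.
clearbody h1; rewrite den_seq.
have W1' u : u < n -> ha h1 a_W u = W0 u by move=> un; rewrite W1 un.
have [M [m1 m2 m3 m4 m5]] := greedy_matchingP n1 D1 W1' M1.
set h2 := den inp greedy_matching h1 in m3 m4 *.
have F2 : framed greedy_matching h2 h1 := framed_den inp _ h1.
exists M.
have n2 : hv h2 r_n = n by rewrite (fv F2).
have D2 : hv h2 r_D8 = 8 * paramD by rewrite (fv F2).
have g2 : hv h2 r_gap = 0 by rewrite (fv F2).
have R2 u : ha h2 a_root u = 0 by rewrite (fa F2).
have S2 u : ha h2 a_S0 u = 0 by rewrite (fa F2).
have W2 u : ha h2 a_W u = (u < n) && W0 u by rewrite (fa F2) // W1.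
have rej2 : hv h2 r_rej = reject by rewrite (fv F2).
clearbody h2; rewrite den_seq den_if.
have -> : (eval inp h2 (Lt r_mc r_D8) != 0) = (size M < 8 * paramD).
  by rewrite -[eval _ _ _]/(1 - (hv h2 r_mc + 1 - hv h2 r_D8)) b2n_lt b2n_neq0 m3 D2.
set h3 := (if _ then _ else _).
have [W3 n3 [rej3 g3] R3] : [/\ forall u, ha h3 a_W u =
     (u < n) && (W0 u || (size M < 8 * paramD) && (u \in unpair M)), hv h3 r_n = n,
   hv h3 r_rej = reject /\ hv h3 r_gap = large_gap M &
   forall u, ha h3 a_root u = 0].
  rewrite /h3 /large_gap; case: (size M < 8 * paramD); last first.
    by rewrite !den_asg; split=> // u; rewrite /= W2 orbF.
  set l3 := SFor _ _ _; have F3 : framed l3 (den inp l3 h2) h2 := framed_den inp l3 h2.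
  split; rewrite ?(fv F3) // => u; last by rewrite (fa F3).
  pose I i g := forall u, ha g a_W u = (u < n) && (W0 u || (u < i) && (u \in unpair M)).
  have : I (hv h2 r_n) (den inp l3 h2).
    apply: den_loop => [v|i g]; first by rewrite W2 orbF.
    rewrite n2 => iN F Ig v; rewrite den_sto /= /upd /= !Ig (fa F) // m4 b2n_or iN ltnn orbF.
    by rewrite ltnS; case: (ltngtP v i) => [//|//|->]; rewrite iN.
  by rewrite n2 => ->; case: (u < n).
have S3 u : ha h3 a_S0 u = 0 by rewrite /h3; case: ifP => // _; rewrite frame_a.
clearbody h3; rewrite den_seq; set l4 := SFor _ _ _; set h4 := den inp l4 h3.
have F4 : framed l4 h4 h3 := framed_den inp l4 h3.
have n4 : hv h4 r_n = n by rewrite (fv F4).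
have W4 : forall u, ha h4 a_W u = ha h3 a_W u by move=> u; rewrite (fa F4).
have S4 u : u < n -> ha h4 a_S0 u = large_S0 M u.
  pose I i g := forall u, u < i -> ha g a_S0 u = large_S0 M u.
  suff : I (hv h3 r_n) h4 by rewrite n3; apply.
  apply: den_loop => // i g; rewrite n3 => iN F Ig v.
  rewrite den_sto /= /upd /= (fv F) // (fa F) // n3 W3 inp_SE // iN b2n_not b2n_and.
  rewrite ltnS leq_eqVlt => /orP[/eqP->|vi]; last by rewrite ltn_eqF // Ig.
  by rewrite eqxx /large_S0 /large_W iN ltn_eqF.
have rej4 : hv h4 r_rej = reject by rewrite (fv F4).
have g4 : hv h4 r_gap = large_gap M by rewrite (fv F4).
have R4 u : ha h4 a_root u = 0 by rewrite (fa F4).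
clearbody h4; rewrite den_seq !den_sto; split=> //.
  move=> u; rewrite /= /upd /= n4 W4 W3 /large_W.
  by case: eqP.
by split=> u; [apply: S4 | rewrite /= /upd /= n4 R4; case: eqP].
Qed.

Lemma compute_weightsP h (W S0 : pred nat) : hv h r_n = n ->
  (forall u, u < n -> ha h a_W u = W u) -> (forall u, u < n -> ha h a_S0 u = S0 u) ->
  (forall u, S0 u -> ~~ W u) ->
  (forall i, ha h a_q4 i = 0) ->
  let h' := den inp compute_weights h in
  [/\ hv h' r_S0 = count S0 (iota 0 n), hv h' r_I0 = count (fun u => ~~ W u && ~~ S0 u) (iota 0 n),
    [/\ hv h' r_m2 = wt W 2 n, hv h' r_m4 = wt W 4 n & hv h' r_TB = 2 * (n * n) + 1],
    forall u, u < n -> W u -> ha h' a_q2 u = wt W 2 u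
  & forall u, u <= n -> ha h' a_q4 u = ad n W u].
Proof.
move=> hn hW hS SW hq; cbv zeta; rewrite /compute_weights den_seq; set h1 := den inp (count_loop _ _ _) h.
have F1 : framed (count_loop r_v r_S0 (Arr a_S0 r_v)) h1 h := framed_den inp _ h.
have s1 : hv h1 r_S0 = count S0 (iota 0 n).
  by apply: count_loopP => // g i iN _ Ha gi /=; rewrite gi Ha hS.
have n1 : hv h1 r_n = n by rewrite (fv F1).
have W1 u : u < n -> ha h1 a_W u = W u by rewrite (fa F1) // => /hW.
have S1 u : u < n -> ha h1 a_S0 u = S0 u by rewrite (fa F1) // => /hS.
have q1 u : ha h1 a_q4 u = 0 by rewrite (fa F1).
clearbody h1; rewrite den_seq; set h2 := den inp (count_loop _ _ _) h1.
have F2 : framed (count_loop r_v r_I0 (Not (Plus (Arr a_W r_v) (Arr a_S0 r_v)))) h2 h1 := framed_den inp _ h1.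
have i2 : hv h2 r_I0 = count (fun u => ~~ W u && ~~ S0 u) (iota 0 n).
  apply: count_loopP => // g i iN _ Ha gi /=; rewrite gi !Ha W1 // S1 //.
  by move: (SW i); case: (W i); case: (S0 i) => // /(_ isT).
have n2 : hv h2 r_n = n by rewrite (fv F2).
have s2 : hv h2 r_S0 = count S0 (iota 0 n) by rewrite (fv F2).
have W2 u : u < n -> ha h2 a_W u = W u by rewrite (fa F2) // => /W1.
have q2 u : ha h2 a_q4 u = 0 by rewrite (fa F2).
clearbody h2; rewrite den_seq den_asg den_seq den_asg; set h3 := setv (setv _ _ _) _ _.
rewrite den_seq; set l4 := SFor _ _ _; set h4 := den inp l4 h3.
have F4 : framed l4 h4 h3 := framed_den inp l4 h3.
pose I i g := [/\ hv g r_m2 = wt W 2 i, hv g r_m4 = wt W 4 i,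
  forall u, u < i -> W u -> ha g a_q2 u = wt W 2 u &
  forall u, ha g a_q4 u = if W u && (u < i) then wt W 4 u else 0].
have : I (hv h3 r_n) h4.
  apply: den_loop => [|i g].
    by split=> // u; rewrite andbF; apply: q2.
  rewrite -[hv h3 r_n]/(hv h2 r_n) n2 => iN F [I1 I2 I3 I4].
  rewrite den_when -[eval _ _ _]/(ha g a_W i) (fa F) // W2 // b2n_neq0.
  case: ifP => Wi; last first.
    split=> /=; rewrite ?updE /= ?I1 ?I2 ?wtS ?Wi ?muln1 //.
      move=> u; rewrite ltnS leq_eqVlt => /orP[/eqP->|]; [by rewrite Wi | exact: I3].
    move=> u; rewrite I4 ltnS [in RHS]leq_eqVlt; by case: (eqVneq u i) => [->|_] //=; rewrite Wi.
  rewrite !den_seq !den_asg !den_sto; split=> /=; rewrite /upd /= ?I1 ?I2 ?wtS ?Wi; try lia.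
    by move=> u; rewrite ltnS leq_eqVlt; case: eqP => [->|_] //=; apply: I3.
  move=> u; rewrite I4 ltnS [in RHS]leq_eqVlt; case: eqP => [->|_] //=; by rewrite Wi.
rewrite -[hv h3 r_n]/(hv h2 r_n) n2 => -[I1 I2 I3 I4].
have n4 : hv h4 r_n = n by rewrite (fv F4).
have s4 : hv h4 r_S0 = count S0 (iota 0 n) by rewrite (fv F4).
have i4 : hv h4 r_I0 = count (fun u => ~~ W u && ~~ S0 u) (iota 0 n) by rewrite (fv F4).
clearbody h4; rewrite den_asg; split=> //; first by split; rewrite //= /upd /= n4; lia.
by move=> u _; apply: I4.
Qed.

Definition small_W v := (v < n) && S v.
Definition blank (h : store) := (forall x, x != 1 -> hv h x = 0) /\ forall a i, ha h a i = 0.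
Let TB := 2 * (n * n) + 1.

Lemma prepareP h0 : blank h0 ->
  let h := den inp (read_sizes ;; preprocess ;; compute_TM) h0 in
  if deltaN <= 2048 * paramD then
    ready n small_W pred0 small_W TB true false goal_len 0
      (count (predC small_W) (iota 0 n)) 0 h
  else exists M, [/\ is_matching M, size M <= 8 * paramD,
    size M < 8 * paramD -> forall a b, a < n -> b < n -> saturates M a b &
    ready n (large_W M) (large_S0 M) (pred1 n) TB false reject
      goal_len (count (large_S0 M) (iota 0 n))
      (count (fun u => ~~ large_W M u && ~~ large_S0 M u) (iota 0 n)) (large_gap M) h].
Proof.
move=> [v0 a0] /=; rewrite den_seq; set h1 := den inp read_sizes h0.
have n1 : hv h1 r_n = n by rewrite -[LHS]/(inp 0).
have n11 : hv h1 r_n1 = n.+1 by rewrite -[LHS]/(inp 0 + 1) inp0 addn1.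
have k1 : hv h1 r_k = k by rewrite -[LHS]/(inp 1).
have {v0} v0 x : x \notin [:: 1; r_n; r_n1; r_k] -> hv h1 x = 0.
  by rewrite !inE !negb_or => /and4P[? ? ? ?]; rewrite frame_v ?v0 // !inE !negb_or; apply/and3P.
have {}a0 a i : ha h1 a i = 0 by rewrite frame_a.
clearbody h1; rewrite den_seq /preprocess den_seq; set h2 := den inp compute_delta h1.
have F2 : framed compute_delta h2 h1 := framed_den inp _ h1.
have d2 : hv h2 r_delta = deltaN by apply: compute_deltaP.
have n2 : hv h2 r_n = n by rewrite (fv F2).
have k2 : hv h2 r_k = k by rewrite (fv F2).
have n12 : hv h2 r_n1 = n.+1 by rewrite (fv F2).
have v2 x : x \in [:: r_out; r_rej; r_gap; r_small] -> hv h2 x = 0.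
  by rewrite !inE => /or4P[]/eqP->; rewrite (fv F2) // v0.
have a2 a i : ha h2 a i = 0 by rewrite (fa F2).
clearbody h2; rewrite den_seq; set h3 := den inp compute_params h2.
have F3 : framed compute_params h3 h2 := framed_den inp _ h2.
have [D3 T3 L3 s3] : [/\ hv h3 r_D8 = 8 * paramD, hv h3 r_T = 512 * paramD, hv h3 r_L = goal_len
    & hv h3 r_small = (deltaN <= 2048 * paramD)] by apply: compute_paramsP.
have n3 : hv h3 r_n = n by rewrite (fv F3).
have n13 : hv h3 r_n1 = n.+1 by rewrite (fv F3).
have v3 x : x \in [:: r_out; r_rej; r_gap] -> hv h3 x = 0.
  by rewrite !inE => /or3P[]/eqP->; rewrite (fv F3) // v2.
have a3 a i : ha h3 a i = 0 by rewrite (fa F3).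
clearbody h3; rewrite den_seq den_if -[eval _ _ _]/(hv h3 r_small) s3 b2n_neq0.
have finish (W S0 Rt : pred nat) (small rej : bool) gap g :
    (forall u, S0 u -> ~~ W u) ->
    [/\ hv g r_n = n, hv g r_n1 = n.+1, hv g r_small = small & hv g r_L = goal_len] ->
    [/\ hv g r_rej = rej, hv g r_gap = gap & hv g r_out = 0] ->
    [/\ forall u, u <= n -> ha g a_W u = W u, forall u, u < n -> ha g a_S0 u = S0 u
      & forall u, u <= n -> ha g a_root u = Rt u] ->
    (forall a, a \in [:: a_q2; a_q4; a_dig; a_bit] -> forall i, ha g a i = 0) ->
    ready n W S0 Rt TB small rej goal_len (count S0 (iota 0 n))
      (count (fun u => ~~ W u && ~~ S0 u) (iota 0 n)) gap
      (den inp compute_TM (den inp compute_weights g)).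
  move=> SW [gn gn1 gsm gL] [grej ggap gout] [gW gS0 gR] gz.
  have [w1 w2 [w3 w4 w5] w6 w7] := compute_weightsP gn (fun u un => gW u (ltnW un)) gS0 SW
    (gz a_q4 isT).
  have F : framed (compute_weights ;; compute_TM)
      (den inp compute_TM (den inp compute_weights g)) g := framed_den inp (_ ;; _) g.
  have FT : framed compute_TM (den inp compute_TM (den inp compute_weights g))
    (den inp compute_weights g) := framed_den inp _ _.
  split; try by rewrite (fv F).
  - by rewrite (fv FT).
  - by rewrite (fv FT).
  - by rewrite (fv FT).
  - by rewrite -[LHS]/(hv (den inp compute_weights g) r_TB * hv (den inp compute_weights g) r_m4) w4 w5.
  - by rewrite (fv FT).
  - by rewrite (fv FT).
  - by move=> u un; rewrite (fa F) // gW.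
  - by move=> u un; rewrite (fa F) // gS0.
  - by move=> u un; rewrite (fa F) // gR.
  - by move=> u un Wu; rewrite (fa FT) // w6.
  - by move=> u un; rewrite (fa FT) // w7.
  - by move=> i; rewrite (fa F) // gz.
  by move=> i; rewrite (fa F) // gz.
case: (leqP deltaN _) => small.
  set g := den inp setup_small h3; have Fg : framed setup_small g h3 := framed_den inp _ h3.
  have [gW gR] : (forall u, ha g a_W u = (u < n) && S u) /\
    (forall u, ha g a_root u = (u < n) && S u) by apply: setup_smallP => // i; apply: a3.
  have := finish small_W pred0 small_W true false 0 g.
  rewrite count_pred0 (@eq_count _ (fun u => ~~ small_W u && ~~ false) (predC small_W)); last first.
    by move=> u; rewrite andbT.
  apply=> //; first by rewrite !(fv Fg) // s3 small.
  - by rewrite !(fv Fg) // !v3.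
  - by split=> u _; rewrite ?gW ?gR // (fa Fg) // a3.
  by move=> a; rewrite !inE => /or4P[]/eqP-> i; rewrite (fa Fg).
have [|||||M [[m1 m2] m3 [m4 m5] m6 [m7 m8]]] := @setup_largeP h3 => //.
- by rewrite v3.
set g := den inp setup_large h3 in m4 m5 m6 m7 m8 *.
have Fg : framed setup_large g h3 := framed_den inp _ h3.
exists M; split=> //; apply: finish => //.
- by move=> u; rewrite /large_S0 => /and3P[].
- by rewrite !(fv Fg) // s3 leqNgt small.
- by rewrite m4 m5 (fv Fg) // v3.
by move=> a; rewrite !inE => /or4P[]/eqP-> i; rewrite (fa Fg).
Qed.

End Pre.

(** * Correctness *)

Section Found.
Variables (n : nat) (eN : rel nat) (W S0 : pred nat) (small : bool) (L s0 i0 gap x : nat).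
Hypothesis x_root : W n -> x = n.
Let TB := 2 * (n * n) + 1.

Lemma digits_cntE E : (forall u, u < n -> W u -> deg E u < 4) ->
  digits_cnt n W (code n W S0 E) = cnt n W E.
Proof.
move=> d4; rewrite /digits_cnt /cnt; apply: eq_in_count => u; rewrite mem_iota /= => un.
by rewrite deg_code //; case: (W u) => //=; rewrite un.
Qed.

Lemma within_code E z : (forall u, u < n -> W u -> deg E u < 4) ->
  within n W (code n W S0 E) z = uses_only n W E z.
Proof.
move=> d4; rewrite /within /uses_only; apply: eq_in_all => u; rewrite mem_iota /= => un.
rewrite deg_code // /bit; case: (W u) => //=; rewrite un /=.
by case: (odd _).
Qed.

Lemma found_config gs : full_groups n gs ->
  found n eN W S0 TB small L s0 i0 gap x gs ->
  exists E, [/\ config n eN W x E, small -> [/\ W x, x < n & deg E x = 2]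
    & accepts L s0 i0 gap (tau n S0 E) (cnt n W E)].
Proof.
move=> [ugs _] [t [c [tT cM dok acc rch]]].
have [E [uE _ oE dE [Es pE]]] := reach_config ugs rch.
have d4 u : u < n -> W u -> deg E u < 4 by move=> un Wu; apply: leq_ltn_trans (dE u un Wu) _.
have Et : t = tau n S0 E.
  move: Es; rewrite codeE [RHS]addnC; case/mulD_inj => //.
  by apply: enc_lt.
rewrite Es digits_cntE // Et in acc.
have dok' u : u < n -> W u -> deg E u = 0 \/ deg E u = 2.
  move=> un Wu; case/andP: dok => /allP/(_ u); rewrite mem_iota => /(_ un).
  by rewrite Es deg_code // Wu un /= => /orP[]/eqP-> _; [left | right].
exists E; split=> //; last first.
  move=> sm; case/andP: dok => _; rewrite sm Es deg_code //=.
  by case: ifP => //= /andP[? ?] /eqP.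
split=> //; apply/(par_connected oE x_root).
rewrite Es in pE; rewrite (@eq_parl _ _ (within n W (code n W S0 E))) // => z _.
by rewrite within_code.
Qed.

Lemma full_groups_size gs : full_groups n gs -> size gs <= n * n.
Proof.
move=> [ugs gsE]; have <- : size [seq (a, b) | a <- iota 0 n, b <- iota 0 n] = n * n by rewrite size_allpairs !size_iota.
apply: uniq_leq_size => // -[a b]; rewrite gsE => /andP[an bn].
by apply/allpairsP; exists (a, b); rewrite !mem_iota.
Qed.

(** There are at most n * n groups, each used at most once, and an edge adds at most 2 to [tau];
    this explains the value of [TB]. *)
Lemma config_found E gs : full_groups n gs -> config n eN W x E ->
  (small -> [/\ W x, x < n & deg E x = 2]) ->
  accepts L s0 i0 gap (tau n S0 E) (cnt n W E) ->
  found n eN W S0 TB small L s0 i0 gap x gs.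
Proof.
move=> fgs [uE oE dE cE] sm acc.
have sgs := full_groups_size fgs; case: fgs => ugs gsE.
have Egs : {subset [seq i.1 | i <- E] <= gs}.
  move=> _ /mapP[[[a b] [u w]] xE ->]; rewrite gsE.
  by have /and3P[/= -> ->] := allP oE _ xE.
have sE : size E <= n * n.
  by apply: leq_trans sgs; rewrite -(size_map fst); apply: uniq_leq_size.
have d4 u : u < n -> W u -> deg E u < 4 by move=> un Wu; case: (dE u un Wu) => ->.
exists (tau n S0 E), (enc W 4 (deg E) n); split.
- by apply: leq_ltn_trans (tau_le n S0 E) _; rewrite /TB addn1 ltnS leq_mul2l sE.
- exact: enc_lt.
- rewrite addnC -codeE; apply/andP; split.
    apply/allP => u; rewrite mem_iota => un; apply/implyP => Wu.
    by rewrite deg_code // Wu un; case: (dE u un Wu) => ->.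
  by apply/implyP => /sm[Wx xn d2]; rewrite deg_code // Wx xn d2.
- by rewrite addnC -codeE digits_cntE.
rewrite addnC -codeE; apply: config_reach => //.
- by move=> u un Wu; case: (dE u un Wu) => ->.
- by rewrite /TB addn1 ltnS leq_mul2l sgs.
rewrite (@eq_parl _ _ (uses_only n W E)) => [|z _]; last exact: within_code.
exact/(par_connected oE x_root).
Qed.

End Found.

Lemma card_iota n (P : pred nat) : #|[set x : 'I_n | P x]| = count P (iota 0 n).
Proof.
rewrite cardsE -val_enum_ord count_map cardE [in LHS]/enum_mem size_filter -enumT.
by apply: eq_count.
Qed.

Lemma count_uniq_iota n (c : seq nat) (P : pred nat) : uniq c -> all (fun a => a < n) c ->
  count P c = count (fun u => (u \in c) && P u) (iota 0 n).
Proof.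
move=> uc lc.
have /permP/(_ P)<- : perm_eq (filter [in c] (iota 0 n)) c.
  apply: uniq_perm; rewrite ?filter_uniq ?iota_uniq // => x.
  rewrite mem_filter mem_iota /=; apply: andb_idr => /(allP lc) //.
by rewrite count_filter; apply: eq_count => x; rewrite /= andbC.
Qed.

Lemma count_le_iota n (c : seq nat) (P : pred nat) : uniq c -> all (fun a => a < n) c ->
  count P c <= count P (iota 0 n).
Proof. by move=> uc lc; rewrite (count_uniq_iota P uc lc); apply: sub_count => u /andP[]. Qed.

Lemma lift_seq n (c : seq nat) : all (fun a => a < n) c -> exists c' : seq 'I_n, c = map val c'.
Proof.
elim: c => [|a c IH] /=; first by exists [::].
by case/andP=> an /IH[c' ->]; exists (Ordinal an :: c').
Qed.

Lemma lift_seqs n (cs : seq (seq nat)) : all (fun a => a < n) (flatten cs) ->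
  exists cs' : seq (seq 'I_n), cs = map (map val) cs'.
Proof.
elim: cs => [|c cs IH] /=; first by exists [::].
by rewrite all_cat => /andP[/lift_seq[c' ->] /IH[cs' ->]]; exists (c' :: cs').
Qed.

(** * Passing between ordinals and natural numbers *)

Section Lift.
Variables (n : nat) (e : rel 'I_n).

Definition liftP (X : pred 'I_n) (a : nat) := if insub a is Some x then X x else false.
Definition liftR (a b : nat) := if insub a is Some x then liftP (e x) b else false.

Lemma liftPE X (x : 'I_n) : liftP X x = X x.
Proof. by rewrite /liftP valK. Qed.

Lemma liftP_lt X a : liftP X a -> a < n.
Proof. by rewrite /liftP; case: insubP. Qed.

Lemma liftRE (x y : 'I_n) : liftR x y = e x y.
Proof. by rewrite /liftR valK liftPE. Qed.

Lemma liftR_lt a b : liftR a b -> (a < n) && (b < n).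
Proof. by rewrite /liftR; case: insubP => // x -> _ /liftP_lt. Qed.

Lemma liftR_sym : symmetric e -> symmetric liftR.
Proof.
move=> sym a b; apply/idP/idP => /[dup]/liftR_lt/andP[an bn];
  by rewrite (liftRE (Ordinal an) (Ordinal bn)) (liftRE (Ordinal bn) (Ordinal an)) sym.
Qed.

Lemma liftR_irr : irreflexive e -> irreflexive liftR.
Proof. by move=> irr a; rewrite /liftR; case: insubP => // x _ <-; rewrite liftPE irr. Qed.

Lemma path_val x (c : seq 'I_n) : path liftR (val x) (map val c) = path e x c.
Proof. by rewrite path_map; apply: eq_path => a b; rewrite /= liftRE. Qed.

Lemma ucycle_val (c : seq 'I_n) : ucycleb liftR (map val c) = ucycleb e c.
Proof.
rewrite /ucycleb map_inj_uniq; last exact: val_inj.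
congr (_ && _); case: c => // x c; by rewrite /= -map_rcons path_val.
Qed.

Lemma has_cycleE l : has_cycle_geq e l <->
  exists c, [/\ 2 < size c, ucycle liftR c, all (fun a => a < n) c & l <= size c].
Proof.
split=> [[c [c2 uc lc]]|[c [c2 uc cn lc]]].
  exists (map val c); rewrite !size_map; split=> //; first by rewrite /ucycle -/(ucycleb _ _) ucycle_val.
  by apply/allP => _ /mapP[x _ ->]; apply: ltn_ord.
have [c' Ec] := lift_seq cn; exists c'; subst c; rewrite size_map in c2 lc.
by split=> //; rewrite /ucycle -/(ucycleb _ _) -ucycle_val.
Qed.

End Lift.

Section MinDegree.
Variables (n : nat) (e : rel 'I_n) (B : {set 'I_n}).

Lemma leq_min_degree (T : finType) (f : rel T) m :
  (m <= min_degree f) = (m <= #|T|) && [forall x, m <= degree f x].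
Proof.
rewrite /min_degree; apply/idP/andP => [le|[le /forallP H]]; last first.
  by elim/big_ind: _ => // a b; rewrite leq_min => -> ->.
split.
  by apply: leq_trans le _; elim/big_rec: _ => // x y _ le; rewrite geq_min le orbT.
apply/forallP => x; apply: leq_trans le _.
elim: (index_enum T) (mem_index_enum x) => // z r IHr.
by rewrite inE big_cons geq_min => /orP[/eqP<- | /IHr->]; rewrite ?leqnn ?orbT.
Qed.

Lemma deltaNE : deltaN n (liftR e) (liftP [in B]) = min_degree (del_vertices e B).
Proof.
apply/eqP; rewrite eqn_leq; apply/andP.
suff H m : (m <= deltaN n (liftR e) (liftP [in B])) = (m <= min_degree (del_vertices e B)).
  by rewrite -H leqnn H leqnn.
rewrite leq_deltaN leq_min_degree; congr andb.
  rewrite -card_iota card_sig -cardsE; congr (_ <= _); apply: eq_card => x.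
  by rewrite !inE liftPE.
have degE (x : 'I_n) (xB : x \notin B) : degB n (liftR e) (liftP [in B]) x =
    degree (del_vertices e B) (exist _ x xB).
  rewrite /degB -card_iota /degree -(card_imset _ val_inj); apply: eq_card => y.
  rewrite !inE liftRE liftPE; apply/andP/imsetP => [[exy yB]|[z]].
    by exists (exist _ y yB) => //; rewrite inE.
  by rewrite inE => exz ->; split=> //; apply: (valP z).
apply/allP/forallP => H.
  case=> x xB; have := H x; rewrite mem_iota liftPE /= (negbTE xB) (degE x xB).
  by apply; rewrite ltn_ord.
move=> a; rewrite mem_iota => an; rewrite (liftPE [in B] (Ordinal an)).
by case: (boolP (Ordinal an \in B)) => //= xB; rewrite (degE _ xB).
Qed.

End MinDegree.

(** A vertex of S with fewer than [T] neighbours in [I] misses at least half of [I], whereas at most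
    p |I| pairs of [I] and S are nonadjacent. *)
Lemma few_bound (V : finType) (e : rel V) (S I : {set V}) p T : symmetric e ->
  (forall u, u \in I -> #|[set s in S | ~~ e u s]| <= p) -> 2 * T <= #|I| -> 0 < #|I| ->
  #|[set s in S | #|[set u in I | e s u]| < T]| <= 2 * p.
Proof.
move=> sym miss TI I0; set Z := [set s in S | _].
rewrite -(leq_pmul2r I0).
have zI z : z \in Z -> #|I| <= 2 * #|[set u in I | ~~ e z u]|.
  rewrite inE => /andP[_]; have := cardsID [set u | e z u] I.
  have -> : I :&: [set u | e z u] = [set u in I | e z u] by apply/setP=> u; rewrite !inE.
  have -> : I :\: [set u | e z u] = [set u in I | ~~ e z u].
    by apply/setP=> u; rewrite !inE andbC.
  move: TI; gen_lia.
have -> : #|Z| * #|I| = \sum_(z in Z) #|I| by rewrite sum_nat_const.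
apply: leq_trans (_ : \sum_(z in Z) 2 * #|[set u in I | ~~ e z u]| <= _).
  exact: leq_sum.
rewrite -big_distrr /= -mulnA leq_mul2l /=.
have -> : \sum_(z in Z) #|[set u in I | ~~ e z u]| = \sum_(u in I) #|[set z in Z | ~~ e u z]|.
  under eq_bigr => z _ do rewrite -sum1dep_card.
  under [RHS]eq_bigr => z _ do rewrite -sum1dep_card.
  rewrite (exchange_big_dep [in I]) /=; last by move=> z u _ /andP[].
  apply: eq_bigr => u uI; apply: eq_bigl => z; by rewrite uI /= sym.
rewrite mulnC -sum_nat_const; apply: leq_sum => u uI; apply: leq_trans (miss u uI).
by apply/subset_leq_card/subsetP => z; rewrite !inE -andbA => /and3P[-> _ ->].
Qed.

Lemma count_next_le (eN : rel nat) (c : seq nat) (P Q : pred nat) : ucycle eN c ->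
  {in c, forall y, P y -> Q (next c y)} -> count P c <= count Q c.
Proof.
move=> cyc H; rewrite -(count_next cyc Q).
rewrite (@eq_in_count _ P (fun y => P y && Q (next c y))); first by apply: sub_count => y /andP[].
by move=> y yc; apply/esym/andb_idr/H.
Qed.

Lemma unpair_cat M1 M2 : unpair (M1 ++ M2) = unpair M1 ++ unpair M2.
Proof. by rewrite /unpair map_cat flatten_cat. Qed.

Lemma unpair_filter a M : subseq (unpair (filter a M)) (unpair M).
Proof.
elim: M => // q M IH; rewrite [filter _ _]/=; case: (a q).
  by apply: (cat_subseq (subseq_refl [:: q.1; q.2])).
by apply: subseq_trans IH _; apply: (suffix_subseq [:: q.1; q.2]).
Qed.

(** Each element of [F] lies on at most one edge of the matching. *)
Lemma matching_avoiding (F : seq nat) M g : uniq (unpair M) -> g + size F <= size M ->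
  exists M', [/\ size M' = g, uniq (unpair M'), {subset M' <= M} &
    {in unpair M', forall v, v \notin F}].
Proof.
move=> uM le; pose M1 := filter (fun q => (q.1 \notin F) && (q.2 \notin F)) M.
have sM1 : g <= size M1.
  have hit : count (predC (fun q : nat * nat => (q.1 \notin F) && (q.2 \notin F))) M <= size F.
    apply: leq_trans (_ : count [in F] (unpair M) <= _).
      elim: (M) => //= q M2 IH; rewrite negb_and !negbK; move: IH; rewrite -/(unpair M2).
      by rewrite ![in X in _ -> _ <= X]/=; case: (q.1 \in F); case: (q.2 \in F); gen_lia.
    rewrite -size_filter; apply: uniq_leq_size; first exact: filter_uniq.
    by move=> v; rewrite mem_filter => /andP[].
  move: le hit; rewrite size_filter -(count_predC (fun q : nat * nat => (q.1 \notin F) && (q.2 \notin F)) M).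
  by gen_lia.
exists (take g M1); split.
- by rewrite size_takel.
- have := subseq_uniq (unpair_filter _ _) uM => /(_ (fun q => (q.1 \notin F) && (q.2 \notin F))).
  by rewrite -/M1 -{1}(cat_take_drop g M1) unpair_cat cat_uniq => /andP[].
- by move=> q /mem_take; rewrite mem_filter => /andP[].
move=> v /flattenP[_ /mapP[q /mem_take + ->]]; rewrite mem_filter => /andP[/andP[q1 q2] _].
by rewrite !inE => /orP[]/eqP->.
Qed.

(** * Structure of the graph and the case of small minimum degree *)

Section Correct.
Variables (n : nat) (e : rel 'I_n) (B S : {set 'I_n}) (p k : nat).
Hypothesis sym : symmetric e.
Hypothesis irr : irreflexive e.
Hypothesis cover : vertex_cover e S.
Hypothesis S_card : #|S| = min_degree (del_vertices e B) + p.

Let eN := liftR e.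
Let nB := liftP [in B].
Let nS := liftP [in S].
Let delta := min_degree (del_vertices e B).
Let D := p + #|B| + 1.
Let L := maxn (2 * delta + k) 3.

Lemma params : [/\ deltaN n eN nB = delta, paramD n eN nB nS = D & goal_len n k eN nB = L].
Proof.
have dE : deltaN n eN nB = delta by apply: deltaNE.
have sE : numS n nS = #|S|.
  by rewrite /numS -card_iota; apply: eq_card => x; rewrite !inE /nS liftPE.
have bE : numB n nB = #|B|.
  by rewrite /numB -card_iota; apply: eq_card => x; rewrite !inE /nB liftPE.
split=> //; last by rewrite /goal_len dE.
by rewrite /paramD dE sE bE S_card -/delta addKn.
Qed.

Lemma eN_sym : symmetric eN. Proof. exact: liftR_sym. Qed.
Lemma eN_irr : irreflexive eN. Proof. exact: liftR_irr. Qed.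

Lemma coverN a b : eN a b -> nS a || nS b.
Proof.
move=> /[dup]/liftR_lt/andP[an bn].
rewrite -[a]/(nat_of_ord (Ordinal an)) -[b]/(nat_of_ord (Ordinal bn)) /eN liftRE /nS !liftPE.
exact: cover.
Qed.

Lemma cycle_goal : has_cycle_geq e (2 * delta + k) <->
  exists c, [/\ 2 < size c, ucycle eN c, all (fun a => a < n) c & L <= size c].
Proof.
rewrite has_cycleE; split=> -[c [c2 uc cn lc]]; exists c; split=> //.
  by rewrite geq_max lc.
by apply: leq_trans lc; rewrite leq_maxl.
Qed.

(** With S0 empty, a cycle has length 2 [cnt] - [tau], so the first inequality of [accepts] alone
    expresses that it is long; the other two follow for every long cycle. *)
Lemma small_correct :
  (exists x E, [/\ x <= n, small_W n nS x, config n eN (small_W n nS) x E,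
    deg E x = 2 & accepts L 0 (count (predC (small_W n nS)) (iota 0 n)) 0
      (tau n pred0 E) (cnt n (small_W n nS) E)]) <->
  has_cycle_geq e (2 * delta + k).
Proof.
rewrite cycle_goal; split.
  case=> x [E [xn Wx cE dx /and3P[acc _ _]]].
  have [c [uc cc cn sc]] : exists c, [/\ uniq c, cycle eN c, all (fun a => a < n) c
      & size c + tau n pred0 E = 2 * cnt n (small_W n nS) E].
    apply: (@config_cycle n eN (small_W n nS) pred0 eN_sym x) => //.
      by case/andP: Wx.
    by rewrite /small_W ltnn.
  have Lc : L <= size c.
    by rewrite add0n -sc leq_add2r in acc.
  exists c; split=> //; last by apply/andP.
  by apply: leq_trans Lc; rewrite leq_maxr.
case=> c [c2 uc cn Lc].
have [x xc Sx] : exists2 x, x \in c & nS x.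
  case: c c2 uc {cn Lc} => [//|a [//|b c]] _ /andP[/= /andP[/coverN/orP[Sa|Sb] _] _].
    by exists a; rewrite ?inE ?eqxx.
  by exists b; rewrite ?inE ?eqxx ?orbT.
have xn : x < n by apply: (allP cn).
have Wx : small_W n nS x by rewrite /small_W xn.
have anch : [/\ x = n, small_W n nS n & exists2 y, y \in c & ~~ small_W n nS y && ~~ small_W n nS (next c y)] \/
    [/\ small_W n nS x, x \in c & forall a : nat, pred0 a = false] by right.
have indep a b : eN a b -> ~~ small_W n nS a -> ~~ pred0 a -> ~~ small_W n nS b -> pred0 b.
  move=> eab; have /andP[an bn] := liftR_lt eab.
  by rewrite /small_W an bn /= => /negbTE Sa _ /negbTE Sb; have := coverN eab; rewrite Sa Sb.
have [F [cF dF F1 F2]] := @cycle_config n eN _ pred0 eN_sym eN_irr (fun a => fun h : false => False_ind _ (notF h))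
  indep x c uc c2 cn anch.
exists x, F; split=> //; first exact: ltnW.
  by rewrite dF // xc.
have cI : count (fun a => ~~ small_W n nS a && ~~ pred0 a) c <= count (predC (small_W n nS)) (iota 0 n).
  have /andP[_ un] := uc.
  apply: leq_trans (count_le_iota (predC (small_W n nS)) un cn).
  by apply: sub_count => a /andP[].
have z : count (fun a => pred0 a && pred0 (next c a)) c = 0 by rewrite -(count_pred0 c).
rewrite z in F1; rewrite z in F2; rewrite /accepts; move: F1 F2 cI Lc.
clear; gen_lia.
Qed.

(** All neighbours of [u] are in S, and at least delta of them exist even in G - B; only |S| - delta
    = p vertices of S remain. *)
Lemma miss_le (u : 'I_n) : u \notin S -> u \notin B -> #|[set s in S | ~~ e u s]| <= p.
Proof.
move=> uS uB; have [dE _ _] := params.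
have : delta <= degB n eN nB u.
  rewrite -dE; have := leq_deltaN n eN nB (deltaN n eN nB); rewrite leqnn => /esym/andP[_ /allP/(_ u)].
  by rewrite mem_iota ltn_ord /= {1}/nB liftPE (negbTE uB) => /(_ isT).
rewrite /degB -card_iota => deg.
have /subset_leq_card le : [set x : 'I_n | eN u x && ~~ nB x] \subset S :&: [set s | e u s].
  apply/subsetP => x; rewrite !inE /eN liftRE => /andP[eux _]; rewrite eux andbT.
  by have := cover eux; rewrite (negbTE uS).
have := cardsID [set s | e u s] S; rewrite S_card -/delta.
have -> : S :\: [set s | e u s] = [set s in S | ~~ e u s].
  by apply/setP=> s; rewrite !inE andbC.
by move: deg le; gen_lia.
Qed.

(** Vertices outside S are never consecutive, so at most delta + p of the at least 2 delta cycle
    vertices are in S and at least delta - p are outside. Without those in B this leaves delta - p -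
    |B| vertices of I0. *)
Lemma cycle_not_rejected : 2048 * D < delta -> has_cycle_geq e (2 * delta + k) -> ~~ reject n eN nB nS.
Proof.
move=> big /cycle_goal[c [_ uc cn Lc]]; have [_ dE _] := params.
rewrite /reject dE -leqNgt.
have /andP[_ un] := uc.
have c1 : count (predC nS) c <= count nS c.
  apply: (count_next_le uc) => y yc Sy; have /andP[cc _] := uc.
  by have := coverN (next_cycle cc yc); rewrite (negbTE Sy).
have c2 := count_predC nS c.
have c3 : count nS c <= delta + p.
  rewrite -S_card; apply: leq_trans (count_le_iota nS un cn) _.
  by rewrite -card_iota; apply/subset_leq_card/subsetP => x; rewrite inE /nS liftPE.
have c4 : count (predC nS) c <= count (freeI nB nS) (iota 0 n) + #|B|.
  apply: leq_trans (count_le_iota (predC nS) un cn) _.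
  have -> : #|B| = count nB (iota 0 n).
    by rewrite -card_iota; apply: eq_card => x; rewrite inE /nB liftPE.
  rewrite -count_predUI; apply: leq_trans (leq_addr _ _); apply: sub_count => x /=.
  by rewrite /freeI => ->; rewrite orNb.
move: Lc; rewrite geq_max => /andP[Lc _].
by move: big c1 c2 c3 c4 Lc; rewrite /D; gen_lia.
Qed.

(** * The case of large minimum degree *)

Section Large.
Variable M : seq (nat * nat).
Hypothesis big : 2048 * D < delta.
Hypothesis not_rej : ~~ reject n eN nB nS.
Hypothesis matchM : is_matching n eN nB nS M.
Hypothesis sizeM : size M <= 8 * D.
Hypothesis maximal : size M < 8 * D -> forall a b, a < n -> b < n -> saturates n eN nB nS M a b.

Let I := freeI nB nS.
Let W := large_W n eN nB nS M.
Let S0 := large_S0 n eN nB nS M.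
Let gap := large_gap n eN nB nS M.
Let s0 := count S0 (iota 0 n).
Let i0 := count (fun u => ~~ W u && ~~ S0 u) (iota 0 n).
Let capped := ~~ (size M < 8 * D).
Let m := #|B| + 2 * p + (~~ capped) * (2 * size M).

Lemma large_WE v : v < n -> W v = nB v || nS v && few n eN nB nS v || ~~ capped && (v \in unpair M).
Proof.
move=> vn; have [_ dE _] := params.
by rewrite /W /large_W /W0 not_rej vn ltn_eqF //= dE /capped negbK.
Qed.

Lemma large_W_root : W n. Proof. by rewrite /W /large_W eqxx. Qed.

Lemma unpair_S v : v \in unpair M -> [/\ v < n, nS v & ~~ (nB v || nS v && few n eN nB nS v)].
Proof.
case: matchM => _ /allP H /flattenP[_ /mapP[[a b] abM ->]].
have /and5P[/= an bn fa fb _] := H _ abM.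
by rewrite !inE => /orP[]/eqP->; [move: fa | move: fb]; rewrite /freeS /W0 not_rej => /andP[].
Qed.

Lemma size_unpair : size (unpair M) = 2 * size M.
Proof. by rewrite /unpair; elim: (M) => //= x t ->; rewrite mulnS. Qed.

Lemma I0E v : v < n -> ~~ W v && ~~ S0 v = I v.
Proof.
move=> vn; rewrite /S0 /large_S0 -/(W v) vn /I /freeI.
case: (boolP (W v)) => /=; rewrite large_WE //.
  case/orP => [/orP[->|/andP[-> _]]|/andP[_ /unpair_S[_ -> _]]] //; by rewrite andbF.
by rewrite !negb_or => /andP[/andP[-> _] _]; rewrite !andbT.
Qed.

Lemma few_le : count (fun v => nS v && few n eN nB nS v) (iota 0 n) <= 2 * p.
Proof.
have [_ dE _] := params; move: not_rej; rewrite /reject dE -leqNgt -card_iota => bigI.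
have := @few_bound _ e S [set x : 'I_n | I x] p (512 * D) sym.
rewrite mulnA => /(_ _ bigI)H; rewrite -card_iota; apply: leq_trans (H _ _).
- apply/subset_leq_card/subsetP => x; rewrite !inE /nS liftPE /few dE -card_iota => /andP[-> /=].
  congr (_ < _); apply: eq_card => u; by rewrite !inE /eN liftRE.
- by move=> u; rewrite inE /I /freeI /nS /nB !liftPE => /andP[? ?]; apply: miss_le.
by apply: leq_trans bigI; rewrite /D addn1.
Qed.

Lemma large_W_le : count W (iota 0 n) <= m.
Proof.
have E : {in iota 0 n, W =1 predU (predU nB (fun v => nS v && few n eN nB nS v)) (fun v => ~~ capped && (v \in unpair M))}.
  by move=> v; rewrite mem_iota => vn; rewrite large_WE.
rewrite (eq_in_count E) /m; apply: leq_trans (_ : _ <= count (predU nB (fun v => nS v && few n eN nB nS v)) (iota 0 n) +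
   count (fun v => ~~ capped && (v \in unpair M)) (iota 0 n)) _.
  by rewrite -count_predUI leq_addr.
apply: leq_add.
  apply: leq_trans (_ : _ <= count nB (iota 0 n) + count (fun v => nS v && few n eN nB nS v) (iota 0 n)) _.
    by rewrite -count_predUI leq_addr.
  apply: leq_add; last exact: few_le.
  by rewrite -card_iota; apply/subset_leq_card/subsetP => x; rewrite inE /nB liftPE.
case: capped; first by rewrite count_pred0.
rewrite mul1n -size_unpair -[size _]count_predT.
have [uM _] := matchM.
rewrite (@count_uniq_iota n _ _ uM); first by apply: sub_count => v /= ->.
by apply/allP => v /unpair_S[].
Qed.

Lemma W_S0_le : count W (iota 0 n) + s0 <= delta + p + #|B|.
Proof.
rewrite -S_card -count_predUI.
have -> : count (predI W S0) (iota 0 n) = 0.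
  apply/eqP; rewrite eqn0Ngt -has_count; apply/hasPn => v _ /=.
  by rewrite /S0 /large_S0 -/(W v); case: (W v) => //=; rewrite !andbF.
rewrite addn0 -card_iota; apply: leq_trans (_ : #|S :|: B| <= _); last first.
  by rewrite cardsU leq_subr.
apply/subset_leq_card/subsetP => x; rewrite !inE /S0 /large_S0 -/(W x) large_WE //.
case: (boolP (x \in B)) => [_|xB]; first by rewrite orbT.
have {1}-> : nB x = false by rewrite /nB liftPE; apply/negbTE.
have -> : (x \in S) = nS x by rewrite /nS liftPE.
rewrite orbF /=.
by case/orP => [/orP[/andP[]//|/andP[_ /unpair_S[]//]]|/and3P[]].
Qed.

Lemma S0_W v : S0 v -> ~~ W v.
Proof. by case/and3P. Qed.

Lemma indep a b : eN a b -> ~~ W a -> ~~ S0 a -> ~~ W b -> S0 b.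
Proof.
move=> eab Wa Sa Wb; have /andP[an bn] := liftR_lt eab.
have := I0E an; rewrite Wa Sa /= => /esym/andP[/negbTE nSa _].
by rewrite /S0 /large_S0 -/(W b) bn Wb andbT /=; have := coverN eab; rewrite nSa.
Qed.

Lemma few_W_le : m + 4 <= 18 * D.
Proof. by move: sizeM; rewrite /m /capped /D; case: ltnP => /=; lia. Qed.

(** The matching is maximal and its ends are in W, so an edge inside S0 could have been added to
    it. *)
Lemma S0_pairs a b : ~~ capped -> S0 a -> S0 b -> eN a b = false.
Proof.
rewrite /capped negbK => ncap /and3P[an Sa Wa] /and3P[bn Sb Wb]; apply/negP => eab.
have free v : v < n -> nS v -> ~~ W v -> freeS n eN nB nS v && (v \notin unpair M).
  move=> vn Sv; rewrite large_WE // /freeS Sv /W0 not_rej /= /capped negbK ncap.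
  by rewrite negb_or /= Sv.
have /andP[fa na] := free a an Sa Wa; have /andP[fb nb] := free b bn Sb Wb.
by have := maximal ncap an bn fa fb eab; rewrite (negbTE na) (negbTE nb).
Qed.

(** If no two consecutive vertices were outside W, at least half of the cycle would lie in W, which
    has only [m] < delta vertices. So the virtual root is available, and the inequalities follow
    from the two length formulas and their sum. *)
Lemma large_cycle_config : has_cycle_geq e (2 * delta + k) ->
  exists E, config n eN W n E /\ accepts L s0 i0 gap (tau n S0 E) (cnt n W E).
Proof.
move=> /cycle_goal[c [c2 uc cn Lc]]; have /andP[cc un] := uc.
have Lbig : 2 * delta <= size c.
  by apply: leq_trans Lc; rewrite leq_max (leq_trans (leq_addr k _)).
have [y yc ny] : exists2 y, y \in c & ~~ W y && ~~ W (next c y).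
  apply/hasP; apply: contraT => /hasPn none.
  have c1 : count (predC W) c <= count W c.
    apply: (count_next_le uc) => y /none; rewrite negb_and negbK => /orP[Wy|]; last by rewrite negbK.
    by rewrite /= Wy.
  have c3 := count_predC W c.
  have c4 := leq_trans (count_le_iota W un cn) large_W_le.
  by move: big few_W_le c1 c3 c4 Lbig; gen_lia.
have anch : [/\ n = n, W n & exists2 y, y \in c & ~~ W y && ~~ W (next c y)] \/
    [/\ W n, n \in c & forall a : nat, S0 a = false].
  by left; split=> //; [apply: large_W_root | exists y].
have [F [cF dF F1 F2]] := cycle_config eN_sym eN_irr S0_W indep uc c2 cn anch.
exists F; split=> //.
have g_le : count (fun a => S0 a && S0 (next c a)) c <= gap.
  rewrite /gap /large_gap; have [_ dE _] := params; rewrite dE; case: ifP => cap.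
    rewrite leqn0 eqn0Ngt -has_count; apply/hasPn => a ac; apply/negP => /andP[Sa Sb].
    by have := next_cycle cc ac; rewrite S0_pairs // /capped cap.
  apply: leq_trans (count_size _ _) _.
  by rewrite -[size c]count_predT -[X in _ <= X](size_iota 0) -count_predT count_le_iota.
have cs := count_le_iota S0 un cn.
have ci := count_le_iota (fun a => ~~ W a && ~~ S0 a) un cn.
rewrite -/s0 in cs; rewrite -/i0 in ci; rewrite /accepts.
move: (cnt n W F) (tau n S0 F) F1 F2 g_le cs ci Lc => x t F1.
rewrite /= in F1; move: F1; gen_lia.
Qed.

Section Completion.
Variables (E : seq edge) (g : nat).
Hypothesis confE : config n eN W n E.
Hypothesis g_room : g <= if capped then 2 * D else 0.
(** The number of single vertices of I0 added as pieces: more than the 3 (m + p) that [complete]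
    asks for, and at least two pieces. *)
Let Q := 3 * (m + p) + 2.

(** The pieces of the configuration are supplemented by [g] matching edges and [Q] single vertices
    of I0. A matching edge adds 2 + 1 on the left and 2 ends on the right, hence the new term [g]; a
    single vertex adds 1 on both sides. *)
Lemma padded_pieces : exists ps, [/\ all (piece_ok eN W) ps,
  uniq (flatten ps) /\ all (fun v => v < n) (flatten ps),
  forall w, w < n -> W w -> (w \in flatten ps) = (deg E w == 2),
  count S0 (flatten ps) + cnt n W E + size ps =
    count (fun v => ~~ W v && ~~ S0 v) (flatten ps) + tau n S0 E + sumn (map (piece_ends S0) ps) + g
  & [/\ size (flatten ps) <= 3 * m + 2 * g + Q, Q <= size ps <= m + g + Q
     & Q <= count (fun v => ~~ W v && ~~ S0 v) (flatten ps)]].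
Proof.
have [ps [okp [up pn] Wp ide [size1 size2]]] := config_pieces eN_sym S0_W large_W_root confE.
have cnt_m : cnt n W E <= m.
  apply: leq_trans large_W_le; rewrite /cnt; apply: sub_count => u /andP[] //.
have sF : size (flatten ps) <= 3 * m by move: size1 size2 cnt_m; gen_lia.
have [uM /allP Mok] := matchM.
have [Mg [sg ug subg avg]] : exists M', [/\ size M' = g, uniq (unpair M'), {subset M' <= M} &
    {in unpair M', forall v, v \notin flatten ps}].
  case: (boolP capped) => cap; last first.
    by move: g_room; rewrite (negbTE cap) leqn0 => /eqP->; exists [::].
  (* This is where the 8 D comes from: when the matching is capped, m = |B| + 2 p <= 2 D, so the
     pieces have at most 6 D vertices, and [g] is at most 2 D. *)
  apply: matching_avoiding => //; move: (cap); rewrite /capped -leqNgt => le8.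
  by move: g_room sF le8; rewrite cap /m cap /D /= mul0n addn0; gen_lia.
pose P v := (~~ W v && ~~ S0 v) && (v \notin flatten ps).
pose qs := take Q (filter P (iota 0 n)).
have Qle : Q <= 58 * D by move: few_W_le; rewrite /Q /D; lia.
have sq : size qs = Q.
  have [_ dE _] := params; have := not_rej; rewrite /reject dE -leqNgt => Ibig.
  have EI : count (freeI nB nS) (iota 0 n) = count (fun v => ~~ W v && ~~ S0 v) (iota 0 n).
    by apply: eq_in_count => v; rewrite mem_iota => vn; rewrite I0E.
  have split : count (fun v => ~~ W v && ~~ S0 v) (iota 0 n) <= count P (iota 0 n) + count [in flatten ps] (iota 0 n).
    rewrite -count_predUI; apply: leq_trans (leq_addr _ _); apply: sub_count => v /= h.
    by rewrite /P h; case: (v \in _).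
  have inF : count [in flatten ps] (iota 0 n) <= size (flatten ps).
    rewrite -size_filter; apply: uniq_leq_size; first by rewrite filter_uniq ?iota_uniq.
    by move=> v; rewrite mem_filter => /andP[].
  rewrite size_takel // size_filter; move: few_W_le Qle Ibig split inF sF; rewrite EI.
  by gen_lia.
have qsP v : v \in qs -> [/\ v < n, ~~ W v, ~~ S0 v & v \notin flatten ps].
  by move/mem_take; rewrite mem_filter mem_iota => /andP[/andP[/andP[? ?] ?] ?].
have uq : uniq qs by apply: take_uniq; rewrite filter_uniq ?iota_uniq.
have MgP q : q \in Mg -> [/\ S0 q.1, S0 q.2 & eN q.1 q.2].
  move=> qM; have capM : 0 < g by rewrite -sg; case: (Mg) qM.
  have cap : capped by move: capM g_room; case: capped => //; case: g.
  have /and5P[q1 q2 f1 f2 eq12] := Mok q (subg q qM).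
  have S0S v : v < n -> freeS n eN nB nS v -> S0 v.
    move=> vn; rewrite /freeS => /andP[Sv w0]; rewrite /S0 /large_S0 -/(W v) vn Sv large_WE // cap /= orbF.
    by move: w0; rewrite /W0 not_rej.
  by split=> //; apply: S0S.
pose pairs := [seq [:: q.1; q.2] | q <- Mg]; pose singles := [seq [:: v] | v <- qs].
have fs : flatten singles = qs by rewrite /singles; elim: (qs) => //= v t ->.
have fp : flatten pairs = unpair Mg by [].
have upS v : v \in unpair Mg -> S0 v.
  by case/flattenP=> _ /mapP[q /MgP[q1 q2 _] ->]; rewrite !inE => /orP[]/eqP->.
have S0n v : S0 v -> v < n by case/andP.
exists (ps ++ pairs ++ singles).
have flatE : flatten (ps ++ pairs ++ singles) = flatten ps ++ unpair Mg ++ qs.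
  by rewrite !flatten_cat fs fp.
have szp : size pairs = g by rewrite size_map.
have szs : size singles = Q by rewrite size_map.
have c1 : count S0 (unpair Mg) = 2 * g.
  rewrite -sg; have : all S0 (unpair Mg) by apply/allP.
  rewrite all_count => /eqP->; by rewrite /unpair; elim: (Mg) => //= x t ->; rewrite mulnS.
have c2 : count (fun v => ~~ W v && ~~ S0 v) (unpair Mg) = 0.
  by apply/eqP; rewrite eqn0Ngt -has_count; apply/hasPn => v /upS Sv; rewrite Sv andbF.
have c3 : count S0 qs = 0.
  by apply/eqP; rewrite eqn0Ngt -has_count; apply/hasPn => v /qsP[].
have c4 : count (fun v => ~~ W v && ~~ S0 v) qs = Q.
  rewrite -sq; apply/eqP; rewrite -all_count; apply/allP => v /qsP[_ a b _]; by rewrite a b.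
have e1 : sumn (map (piece_ends S0) pairs) = 2 * g.
  rewrite -sg /pairs; elim: (Mg) MgP => //= q t IH MgP.
  have [q1 q2 _] := MgP q (mem_head _ _); rewrite q1 q2 IH ?mulnS // => q' q't.
  by apply: MgP; rewrite inE q't orbT.
have e2 : sumn (map (piece_ends S0) singles) = 0.
  rewrite /singles; elim: (qs) qsP => //= v t IH H.
  have [_ _ /negbTE-> _] := H v (mem_head _ _); rewrite IH // => w wt.
  by apply: H; rewrite inE wt orbT.
have sup : size (unpair Mg) = 2 * g.
  by rewrite -sg /unpair; elim: (Mg) => //= x t ->; rewrite mulnS.
split.
- rewrite !all_cat okp /=; apply/andP; split; apply/allP => q /mapP.
    by case=> x /MgP[x1 x2 x3] ->; rewrite /piece_ok /= x3 !S0_W.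
  by case=> v /qsP[_ Wv _ _] ->; rewrite /piece_ok /= Wv.
- rewrite flatE; split; last first.
    rewrite !all_cat pn /=; apply/andP; split; apply/allP => v; first by move/upS/S0n.
    by case/qsP.
  rewrite !cat_uniq up ug uq !andbT /=; apply/andP; split; apply/hasPn => v.
    by rewrite mem_cat => /orP[/avg|/qsP[]].
  by move=> /qsP[_ _ nS0 _]; apply: contra nS0 => /upS.
- move=> w wn Ww; rewrite flatE !mem_cat -Wp //.
  have -> : (w \in unpair Mg) = false by apply/negP => /upS/S0_W; rewrite Ww.
  have -> : (w \in qs) = false by apply/negP => /qsP[_]; rewrite Ww.
  by rewrite !orbF.
- rewrite flatE !count_cat !size_cat !map_cat !sumn_cat szp szs c1 c2 c3 c4 e1 e2.
  by move: ide; move: (tau n S0 E) (cnt n W E) => t c; gen_lia.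
rewrite flatE !size_cat count_cat !count_cat szp szs c2 c4 sup sq.
have sp := leq_trans size2 cnt_m; move: sF sp; generalize m Q; generalize (size ps) (size (flatten ps)).
by generalize (count (fun v => ~~ W v && ~~ S0 v) (flatten ps)); clear; split; lia.
Qed.

Lemma S0_large : delta <= m + s0.
Proof.
apply: leq_trans (_ : count nS (iota 0 n) <= _).
  have -> : count nS (iota 0 n) = #|S|.
    by rewrite -card_iota; apply: eq_card => x; rewrite inE /nS liftPE.
  by rewrite S_card leq_addr.
apply: leq_trans (_ : count W (iota 0 n) + s0 <= _); last by rewrite leq_add2r large_W_le.
rewrite -count_predUI; apply: leq_trans (leq_addr _ _).
rewrite (@eq_in_count _ nS (fun v => (v < n) && nS v)); last first.
  by move=> v; rewrite mem_iota => /= ->.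
by apply: sub_count => v /andP[vn Sv] /=; rewrite /S0 /large_S0 -/(W v) vn Sv orbN.
Qed.

(** [complete] is applied with T = 512 D: the pieces, [m] and [g] are small multiples of D, while S0
    has at least delta - m vertices and delta > 2048 D. *)
Lemma completion : exists c, [/\ ucycle eN c, 2 < size c, all (fun v => v < n) c,
  size c = cnt n W E + count S0 c + count (fun v => ~~ W v && ~~ S0 v) c /\
  count S0 c + cnt n W E = count (fun v => ~~ W v && ~~ S0 v) c + tau n S0 E + g
  & count S0 c = s0 \/ count (fun v => ~~ W v && ~~ S0 v) c = i0].
Proof.
have [ps [okp [up pn] Wp ide [size1 /andP[size2 size3] size4]]] := padded_pieces.
have [ps' Eps] := lift_seqs pn; subst ps.
pose WV := [set x : 'I_n | W x]; pose SV := [set x : 'I_n | S0 x].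
pose IV := [set x : 'I_n | ~~ W x && ~~ S0 x].
have [_ dE _] := params.
have gD : g <= 2 * D by move: g_room; case: capped => //; case: (g).
have Qle : Q <= 58 * D by move: few_W_le; rewrite /Q /D; lia.
have Tm : 4 * m + 4 * p + 4 <= 512 * D by move: few_W_le; rewrite /D; lia.
have flatE : flatten [seq map val q | q <- ps'] = map val (flatten ps') by rewrite map_flatten.
have cSV (s : seq 'I_n) : count [in SV] s = count S0 (map val s).
  by rewrite count_map; apply: eq_count => x; rewrite /= inE.
have cIV (s : seq 'I_n) : count [in IV] s = count (fun v => ~~ W v && ~~ S0 v) (map val s).
  by rewrite count_map; apply: eq_count => x; rewrite /= inE.
have cWV (s : seq 'I_n) : count [in WV] s = count W (map val s).
  by rewrite count_map; apply: eq_count => x; rewrite /= inE.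
have eqends : [seq S0_ends SV q | q <- ps'] = [seq piece_ends S0 q | q <- [seq map val q | q <- ps']].
  rewrite -map_comp; apply: eq_map => -[//|x q] /=.
  by rewrite !inE last_map.
have h1 : [disjoint WV & SV].
  by rewrite -setI_eq0; apply/eqP/setP => x; rewrite !inE; apply/negP => /andP[Wx /S0_W]; rewrite Wx.
have h2 : [disjoint WV & IV].
  by rewrite -setI_eq0; apply/eqP/setP => x; rewrite !inE; case: (W x).
have h3 : [disjoint SV & IV].
  by rewrite -setI_eq0; apply/eqP/setP => x; rewrite !inE; case: (S0 x); rewrite ?andbF.
have h4 x : [|| x \in WV, x \in SV | x \in IV].
  by rewrite !inE; case: (W x); case: (S0 x).
have h5 x y : x \in IV -> e x y -> y \notin IV.
  rewrite !inE => /andP[Wx Sx] exy; apply/negP => /andP[Wy].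
  by rewrite (indep (a := x)) // /eN liftRE.
have h6 : #|WV| <= m by rewrite card_iota; apply: large_W_le.
have h7 v : v \in IV -> #|[set s in SV | ~~ e v s]| <= p.
  rewrite inE I0E // /I /freeI /nS /nB !liftPE => /andP[vS vB].
  apply: leq_trans (miss_le vS vB); apply/subset_leq_card/subsetP => x; rewrite !inE.
  by case/andP=> /and3P[_ + _] ->; rewrite /nS liftPE => ->.
have h8 s : s \in SV -> 512 * D <= #|[set v in IV | e s v]|.
  rewrite inE => /and3P[_ Ss]; rewrite -/(W s) large_WE // !negb_or Ss /= -andbA => /and3P[_ + _].
  rewrite /few dE -leqNgt -card_iota => le; apply: leq_trans le _.
  apply/subset_leq_card/subsetP => x; rewrite !inE /eN liftRE => /andP[Ix ->].
  by rewrite andbT I0E.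
have h9 : 1 < size ps' by rewrite size_map in size2; apply: leq_trans size2; rewrite /Q addn2.
have h10 : all (piece_ends_in e (~: WV)) ps'.
  move: okp; rewrite all_map; apply: sub_all => -[//|x q] /=.
  by rewrite path_val last_map !inE.
have h11 : uniq (flatten ps') by rewrite -(map_inj_uniq val_inj) -flatE.
rewrite flatE !size_map in size1 size2 size3.
have h12 : size (flatten ps') + 2 * size ps' < 512 * D.
  by move: size1 size3 gD Qle few_W_le; gen_lia.
have h13 : size (flatten ps') + 3 * size ps' + 2 * p + 1 < #|SV|.
  rewrite card_iota -/s0; move: S0_large big size1 size3 gD Qle few_W_le; rewrite /D.
  by gen_lia.
have h14 : 3 * (m + p) < count [in IV] (flatten ps').
  by rewrite cIV -flatE; apply: leq_trans size4; rewrite /Q addn2.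
have [C [uC C2 CW Cid Cfull]] := complete sym h1 h2 h3 h4 h5 h6 h7 h8 Tm h9 h10 h11 h12 h13 h14.
rewrite cSV !cIV cSV -flatE eqends in Cid.
have uCv : uniq C by have /andP[] := uC.
have Cn : all (fun v => v < n) (map val C) by apply/allP => _ /mapP[x _ ->]; apply: ltn_ord.
have uCn : uniq (map val C) by rewrite (map_inj_uniq val_inj).
have full (A : {set 'I_n}) : {subset A <= C} -> count [in A] C = #|A|.
  move=> AC; rewrite -size_filter -(card_uniqP (filter_uniq _ uCv)); apply: eq_card => x.
  by rewrite mem_filter andb_idr // => /AC.
have cW : count W (map val C) = cnt n W E.
  rewrite (count_uniq_iota W uCn Cn); apply: eq_in_count => u; rewrite mem_iota => un.
  rewrite andbC; case: (boolP (W u)) => //= Wu; rewrite -Wp // flatE.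
  rewrite (mem_map val_inj C (Ordinal un)) (mem_map val_inj (flatten ps') (Ordinal un)).
  by apply: CW; rewrite inE.
exists (map val C); split.
- by rewrite /ucycle -/(ucycleb _ _) ucycle_val.
- by rewrite size_map.
- exact: Cn.
- split.
    have c1 := count_predC W (map val C); have c2 := count_predC S0 (filter (predC W) (map val C)).
    rewrite !count_filter size_filter in c2.
    rewrite (@eq_count _ (predI S0 (predC W)) S0) in c2; last first.
      by move=> v /=; apply: andb_idr; apply: S0_W.
    rewrite (@eq_count _ (predI (predC S0) (predC W)) (fun v => ~~ W v && ~~ S0 v)) in c2; last first.
      by move=> v /=; rewrite andbC.
    by rewrite -c1 cW -c2 addnA.
  move: Cid ide; move: (cnt n W E) (tau n S0 E) => x t; rewrite size_map; gen_lia.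
case: Cfull => /full sub; [left | right].
  by rewrite -cSV sub card_iota.
by rewrite -cIV sub (card_iota n (fun v => ~~ W v && ~~ S0 v)).
Qed.

End Completion.

Lemma large_config_cycle E : config n eN W n E -> accepts L s0 i0 gap (tau n S0 E) (cnt n W E) ->
  has_cycle_geq e (2 * delta + k).
Proof.
move=> cE /and3P[]; set t := tau n S0 E => acc1 acc2 acc3.
have cnt_le : cnt n W E <= count W (iota 0 n) by apply: sub_count => u /andP[].
have Ld : 2 * delta <= L by rewrite leq_max leq_addr.
(* The number of edges inside S0 is chosen least such that 2 i0 + tau + g reaches L. If it is
   positive, the third inequality keeps 2 (s0 + cnt) - tau - g at least L. The same inequality with
   |W| + |S0| <= delta + p + |B| and L >= 2 delta gives g <= 2 (p + |B|). *)
have room : L - (2 * i0 + t) <= if capped then 2 * D else 0.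
  move: acc2 W_S0_le acc3; rewrite /gap /large_gap; have [_ -> _] := params.
  rewrite /capped; case: ltnP => /= _; first by rewrite addn0 => le _ _; rewrite leqn0 subn_eq0.
  by move: cnt_le Ld acc1; generalize t (cnt n W E) L s0 i0; rewrite /D; gen_lia.
have [c [uc c2 cn [c3 c4] full]] := completion cE room.
rewrite cycle_goal; exists c; split=> //.
case: full => full; rewrite full in c3 c4; move: c3 c4; rewrite -/t.
  by move: acc1 acc2 acc3; generalize t L (cnt n W E) s0 i0; gen_lia.
by move: acc1 acc2 acc3; generalize t L (cnt n W E) s0 i0; gen_lia.
Qed.

End Large.

End Correct.

(** * Running time *)

(** The exponent [d] is fixed by the program, so raising n^2 4^(K q) to it leaves a bound of the
    same kind. The summand 3 n + 9 is the time of the prologue. *)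
Lemma time_bound A d K : exists c, forall n q M, M <= (2 * (n * n) + 1) * 4 ^ (K * q.+1) ->
  A * M.+1 ^ d + 3 * n + 9 <= c * 2 ^ (c * q) * n.+1 ^ c.
Proof.
pose u := A * (2 * 4 ^ K) ^ d + 9; exists (u + (2 * (K * d) + (2 * d + 1))) => n q M leM.
set c := u + _.
have n1 : 0 < n.+1 by [].
have E1 : M.+1 <= 2 * 4 ^ K * (n.+1 ^ 2 * 2 ^ (2 * K * q)).
  have -> : 2 * 4 ^ K * (n.+1 ^ 2 * 2 ^ (2 * K * q)) = 2 * n.+1 ^ 2 * 4 ^ (K * q.+1).
    by rewrite mulnS expnD -(mulnA 2 K q) (expnM 2 2) mulnACA.
  have : 0 < 4 ^ (K * q.+1) by rewrite expn_gt0.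
  by move: leM; move: (4 ^ _) => x; rewrite -mulnn; nia.
have E2 : A * M.+1 ^ d <= (A * (2 * 4 ^ K) ^ d) * (2 ^ (2 * (K * d) * q) * n.+1 ^ (2 * d)).
  rewrite -mulnA leq_mul2l; apply/orP; right.
  have -> : (2 * 4 ^ K) ^ d * (2 ^ (2 * (K * d) * q) * n.+1 ^ (2 * d)) =
      (2 * 4 ^ K * (n.+1 ^ 2 * 2 ^ (2 * K * q))) ^ d.
    rewrite [RHS]expnMn (expnMn (n.+1 ^ 2)) -(expnM n.+1) -(expnM 2 (2 * K * q)).
    by rewrite [in RHS](mulnC (n.+1 ^ _)) (mulnA 2) (mulnAC (2 * K)).
  by case: (d) => // d'; rewrite leq_exp2r.
have E3 : 2 ^ (2 * (K * d) * q) * n.+1 ^ (2 * d) <= 2 ^ (c * q) * n.+1 ^ c.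
  apply: leq_mul; apply: leq_pexp2l => //; last by rewrite /c; lia.
  by rewrite leq_mul2r; apply/orP; right; rewrite /c; lia.
have E4 : n.+1 <= 2 ^ (c * q) * n.+1 ^ c.
  rewrite -{1}[n.+1]mul1n; apply: leq_mul; first by rewrite expn_gt0.
  by rewrite -{1}(expn1 n.+1); apply: leq_pexp2l => //; rewrite /c; lia.
rewrite -mulnA; move: E2 E3 E4; generalize (2 ^ (c * q) * n.+1 ^ c) => X E2 E3 E4.
apply: leq_trans (_ : u * X <= _); last by rewrite leq_mul2r /c leq_addr orbT.
rewrite /u mulnDl -addnA; apply: leq_add; last by lia.
by apply: leq_trans E2 _; rewrite leq_mul2l E3 orbT.
Qed.

(** * Reading the input word *)

Section Encoding.
Variables (n : nat) (e : rel 'I_n) (B S : {set 'I_n}) (k : nat).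
Let inp := nth 0 (encode_instance e B S k).

Lemma nth_allpairs (T : Type) (f : T -> T -> nat) (x0 : T) s t i j : i < size s -> j < size t ->
  nth 0 [seq f x y | x <- s, y <- t] (i * size t + j) = f (nth x0 s i) (nth x0 t j).
Proof.
elim: s i => //= x s IH [|i] si tj; rewrite nth_cat size_map.
  by rewrite mul0n tj (nth_map x0).
by rewrite mulSn -addnA ltnNge leq_addr /= addKn IH.
Qed.

Lemma size_encode : size (encode_instance e B S k) = n * n + n + n + 2.
Proof. by rewrite /encode_instance !size_cat size_allpairs !size_map -enumT size_enum_ord /=; lia. Qed.

Lemma encode_end i : n * n + n + n + 2 <= i -> inp i = 0.
Proof. by move=> le; rewrite /inp nth_default ?size_encode. Qed.

Lemma encode_set (f : 'I_n -> bool) s v : v < n ->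
  nth 0 ([seq nat_of_bool (f i) | i <- enum 'I_n] ++ s) v = liftP f v.
Proof.
move=> vn; rewrite nth_cat size_map size_enum_ord vn (nth_map (Ordinal vn)) ?size_enum_ord //.
have -> : nth (Ordinal vn) (enum 'I_n) v = Ordinal vn by apply: val_inj; rewrite /= nth_enum_ord.
by rewrite -[v in RHS]/(val (Ordinal vn)) liftPE.
Qed.

Lemma encode_B v : v < n -> inp (2 + v) = liftP [in B] v.
Proof. by move=> vn; rewrite /inp /encode_instance nth_cat /= addKn encode_set. Qed.

Lemma encode_S v : v < n -> inp (2 + n + v) = liftP [in S] v.
Proof.
move=> vn; rewrite /inp /encode_instance -addnA nth_cat /= addKn.
by rewrite nth_cat size_map size_enum_ord ltnNge leq_addr /= addKn encode_set.
Qed.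

Lemma encode_adj u v : u < n -> v < n -> inp (2 + n + n + u * n + v) = liftR e u v.
Proof.
move=> un vn; rewrite /inp /encode_instance -!addnA nth_cat /= addKn.
rewrite nth_cat size_map size_enum_ord ltnNge leq_addr /= addKn.
rewrite nth_cat size_map size_enum_ord ltnNge leq_addr /= addKn.
have := @nth_allpairs _ (fun i j => nat_of_bool (e i j)) (Ordinal un) (enum 'I_n) (enum 'I_n) u v.
rewrite size_enum_ord => -> //.
rewrite -[u in RHS]/(val (Ordinal un)) -[v in RHS]/(val (Ordinal vn)) liftRE.
by congr (nat_of_bool (e _ _)); apply: val_inj; rewrite /= nth_enum_ord.
Qed.

End Encoding.

(** * The whole program decides the problem *)

Section Decision.
Variables (n : nat) (e : rel 'I_n) (B S : {set 'I_n}) (p k : nat).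
Hypothesis sym : symmetric e.
Hypothesis irr : irreflexive e.
Hypothesis cover : vertex_cover e S.
Hypothesis S_card : #|S| = min_degree (del_vertices e B) + p.
Let inp := nth 0 (encode_instance e B S k).
(** The largest |W| occurs when W = S, with delta + p <= 2048 D + p <= 2049 D vertices; the tables
    then have at most [TB] * 4^|W| states. *)
Let max_value := (2 * (n * n) + 1) * 4 ^ (2049 * (p + #|B|).+1).

Lemma ready_bounded W S0 Rt small rej L s0 i0 gap h :
  ready n W S0 Rt (2 * (n * n) + 1) small rej L s0 i0 gap h ->
  count W (iota 0 n) <= 2049 * (p + #|B|).+1 -> bounded bounds3 max_value h.
Proof.
move=> rh cW.
have le4 : wt W 4 n <= 4 ^ (2049 * (p + #|B|).+1) by apply: leq_pexp2l.
have le2 : wt W 2 n <= wt W 4 n by rewrite /wt; case: (count _ _) => // c; rewrite leq_exp2r.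
have w0 : 0 < wt W 4 n by apply: wt_gt0.
have n1 : n < 2 * (n * n) + 1 by nia.
move=> x; rewrite !inE => H; apply: leq_trans (_ : _ <= (2 * (n * n) + 1) * wt W 4 n) _; last first.
  by rewrite leq_mul2l le4 orbT.
case: rh => E1 E2 E3 E4 E5 E6 _ _ _ _ _ _ _ _ _ _ _ _ _ _.
by case/or4P: H => [/eqP->|/eqP->|/eqP->|/or3P[]/eqP->]; rewrite ?E1 ?E2 ?E3 ?E4 ?E5 ?E6;
  move: le2 w0 n1; generalize (wt W 2 n) (wt W 4 n) (n * n); clear; nia.
Qed.

Lemma decision h0 : blank h0 ->
  let h := den inp (read_sizes ;; preprocess ;; compute_TM) h0 in
  bounded bounds3 max_value h /\
  (hv (den inp search h) r_out != 0 <->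
    has_cycle_geq e (2 * min_degree (del_vertices e B) + k)).
Proof.
move=> bl h.
have [dE DE LE] := params k S_card.
have inpA := @encode_adj n e B S k.
have P := prepareP (erefl : inp 0 = n) (erefl : inp 1 = k) (@encode_B n e B S k) (@encode_S n e B S k) inpA
  (liftR_irr irr) bl.
cbv zeta in P; move: P; rewrite -/h dE DE LE; set D := p + #|B| + 1; set L := maxn _ 3.
case: leqP => [small rd | large [M [m1 m2 m3 rd]]].
  split.
    apply: ready_bounded rd _; rewrite /small_W.
    have -> : count (fun v => (v < n) && liftP [in S] v) (iota 0 n) = #|S|.
      rewrite -card_iota; apply: eq_card => x; by rewrite !inE ltn_ord liftPE.
    by rewrite S_card; move: small; rewrite /D; gen_lia.
  have [out1 out2] := searchP inpA rd; apply: iff_trans (small_correct B k sym irr cover).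
  split.
    case/out1=> _ [x [gs [xn Wx fgs fx]]].
    have xW : small_W n (liftP [in S]) n -> x = n by rewrite /small_W ltnn.
    have [E [cE dx acc]] := found_config xW fgs fx.
    by exists x, E; split=> //; case: (dx isT).
  case=> x [E [xn Wx cE dx acc]]; apply: (out2 isT x xn Wx) => gs fgs.
  apply: (config_found _ fgs cE) => //; first by rewrite /small_W ltnn.
  by move=> _; split=> //; case/andP: Wx.
have [out1 out2] := searchP inpA rd.
split.
  apply: ready_bounded rd _.
  (* Tables are built for rejected instances too, so their size matters; apart from the virtual
     vertex, W then contains only ends of matching edges. *)
  case: (boolP (reject n (liftR e) (liftP [in B]) (liftP [in S]))) => rej; last first.
    apply: leq_trans (large_W_le k sym cover S_card rej m1) _.
    by have := few_W_le k S_card large rej m2 m3; rewrite -/D; move: (_ * _) => X; rewrite /D; gen_lia.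
  apply: leq_trans (_ : count [in unpair M] (iota 0 n) <= _).
    rewrite (@eq_in_count _ (large_W _ _ _ _ _) (fun v => (size M < 8 * paramD n (liftR e) (liftP [in B]) (liftP [in S])) && (v \in unpair M))).
      by apply: sub_count => v /andP[].
    by move=> v; rewrite mem_iota /large_W /W0 rej /= => vn; rewrite ltn_eqF // vn.
  apply: leq_trans (_ : size (unpair M) <= _).
    rewrite -size_filter; apply: uniq_leq_size; first by rewrite filter_uniq ?iota_uniq.
    by move=> v; rewrite mem_filter => /andP[].
  by rewrite size_unpair; move: m2; rewrite /D; gen_lia.
have root_n : large_W n (liftR e) (liftP [in B]) (liftP [in S]) M n -> n = n by [].
split.
  case/out1=> rej [x [gs [xn /eqP Ex fgs fx]]]; subst x.
  have [E [cE _ acc]] := found_config root_n fgs fx.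
  exact: (large_config_cycle sym cover S_card large rej m1 m2 m3 cE acc).
move=> cyc; have rej := cycle_not_rejected cover S_card large cyc.
have [E [cE acc]] := large_cycle_config sym irr cover S_card large rej m1 m2 m3 cyc.
apply: (out2 rej n (leqnn n) (eqxx n)) => gs fgs.
exact: (config_found root_n fgs cE).
Qed.

End Decision.

(** Computes the input size n * n + n + n + 2 into variable 1, which the loop language cannot
    assign. The product is a repeated addition in [tr 0], with [n] in [tr 1] and the counter in
    [tr 2]. *)
Definition prologue :=
  Seq (Read (tr 1) (tr 0)) (Seq (Read (tr 2) (tr 0)) (Seq (Const (tr 3) 1)
    (Seq (While (tr 2) (Seq (Add (tr 0) (tr 0) (tr 1)) (Sub (tr 2) (tr 2) (tr 3))))
      (Seq (Read (tr 1) (vr 2)) (Seq (Add (vr 1) (tr 0) (tr 1)) (Seq (Add (vr 1) (vr 1) (tr 1))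
        (Seq (Const (tr 3) 2) (Add (vr 1) (vr 1) (tr 3))))))))).

Lemma prologue_runs w n : nth 0 w 0 = n ->
  exists2 l, runs prologue (init_state w) (3 * n + 9) l &
  [/\ regs l (vr 1) = n * n + n + n + 2, forall x, x != 1 -> regs l (vr x) = 0 & mem l = nth 0 w].
Proof.
move=> wn.
set l1 := set_reg (init_state w) (tr 1) (mem (init_state w) (regs (init_state w) (tr 0))).
set l2 := set_reg l1 (tr 2) (mem l1 (regs l1 (tr 0))).
set l3 := set_reg l2 (tr 3) 1.
have e2 : regs l3 (tr 2) = n by rewrite /= !regE.
have e3 : regs l3 (tr 3) = 1 by rewrite /= !regE.
have [l4 r4 [v4 k4 m4]] := runs_times_loop (d := 0) e2 e3.
eexists.
  apply: (@runs_le _ _ _ (1 + (1 + (1 + (3 * n + 1 + (1 + (1 + (1 + (1 + 1))))))))); first lia.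
  apply: runs_seq; first exact: runs_read.
  apply: runs_seq; first exact: runs_read.
  apply: runs_seq; first exact: runs_const.
  apply: runs_seq; first exact: r4.
  apply: runs_seq; first exact: runs_read.
  apply: runs_seq; first exact: runs_add.
  apply: runs_seq; first exact: runs_add.
  by apply: runs_seq; [exact: runs_const | exact: runs_add].
have z2 : regs l4 (vr 2) = 0 by rewrite (keeps_vr _ k4) /= !regE.
split=> [|x x1|] /=.
- by rewrite !regE /= v4 z2 m4 /= !regE /= wn.
- by rewrite !regE (negbTE x1) (keeps_vr _ k4) /= !regE.
by rewrite m4.
Qed.

Definition program_text := (read_sizes ;; preprocess ;; compute_TM) ;; search.

Lemma program_runs inp off M h l : (forall i, off <= i -> inp i = 0) -> sim inp off h l ->
  let h' := den inp (read_sizes ;; preprocess ;; compute_TM) h in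
  bounded bounds3 M h' ->
  exists2 l', runs (comp_stm program_text 0) l (cost M program_text) l' &
    regs l' (vr r_out) = hv (den inp search h') r_out.
Proof.
move=> inp_off S h' bd; have /and4P[ok1 ok2 ok3 ok4] := ok_segments.
have b0 : bounded [::] M h by [].
have [l1 r1 [S1 _]] := comp_stm_sim inp_off 0 S b0 ok1.
set h1 := den inp read_sizes h in S1.
set h2 := den inp preprocess h1.
have h'E : h' = den inp compute_TM h2 by [].
have b2 : bounded bounds2 M h2.
  move=> x xb; rewrite -(den_bound inp h2 xb ok3) -h'E; apply: bd.
  move: xb; rewrite !inE; do 4![case/orP => [->|]; rewrite ?orbT //].
  by move->; rewrite !orbT.
have b1 : bounded bounds1 M h1.
  move=> x xb; rewrite -(den_bound inp h1 xb ok2); apply: b2.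
  by move: xb; rewrite !inE => /orP[]->; rewrite ?orbT.
have [l2 r2 [S2 _]] := comp_stm_sim inp_off 0 S1 b1 ok2.
have [l3 r3 [S3 _]] := comp_stm_sim inp_off 0 S2 b2 ok3.
have [l4 r4 [S4 _]] := comp_stm_sim inp_off 0 S3 bd ok4.
exists l4; last by case: S4 => ->.
apply: runs_seq; last exact: r4.
by apply: runs_seq; [exact: r1 | apply: runs_seq; [exact: r2 | exact: r3]].
Qed.

Theorem theorem7 :
  exists (P : cmd) (c : nat),
  forall (n : nat) (e : rel 'I_n) (B S : {set 'I_n}) (p k : nat),
    symmetric e -> irreflexive e ->
    vertex_cover e S ->
    #|S| = min_degree (del_vertices e B) + p ->
    decides_within P (encode_instance e B S k)
      (has_cycle_geq e (2 * min_degree (del_vertices e B) + k))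
      (c * 2 ^ (c * (p + #|B|)) * n.+1 ^ c).
Proof.
have [c time] := time_bound (size_stm program_text) (depth program_text) 2049.
exists (Seq prologue (comp_stm program_text 0)), c => n e B S p k sym irr cover S_card.
set w := encode_instance e B S k.
have [l0 r0 [off0 reg0 mem0]] := @prologue_runs w n erefl.
pose off := n * n + n + n + 2.
(* In the initial store all variables except the input size, and all arrays, are zero, because
   machine memory is zero beyond the input. *)
pose h0 := Store (fun x => if x == 1 then off else 0) (fun _ _ => 0).
have S0 : sim (nth 0 w) off h0 l0.
  split=> //=; first by move=> x; case: eqP => [->|/eqP x1]; [exact: off0 | exact: reg0].
    by move=> i _; rewrite mem0.
  by move=> a i _; rewrite mem0; apply: encode_end; rewrite leq_addl.
have blank0 : blank h0 by split=> // x /= /negbTE->.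
have [bd ans] := decision k sym irr cover S_card blank0.
have [l1 r1 out1] := program_runs (@encode_end n e B S k) S0 bd.
rewrite -out1 in ans; case: (runs_seq r0 r1) => t run le.
exists t, l1; split=> //.
apply: leq_trans le _; apply: leq_trans (time n (p + #|B|) _ (leqnn _)).
by rewrite addnC addnA !leq_add2r cost_le.
Qed.
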